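(* Let $0\le k\le n-1$. As the mesh size $h$ varies over a family of shape regular simplicial subdivisions $\mathcal{G}_h$ of $\Omega$, $$\left|\mathsf{icr}(\delta_{k+1},\mathbf{W}^*_{h0}\Lambda^{k+1})-\mathsf{icr}(d^k_h,\mathbf{W}^{\rm nc}_h\Lambda^k)\right|=\mathcal{O}(h),$$ that is, the left-hand side is bounded by $Ch$ with a constant $C$ uniform for the family.
   Context: Let $n\ge 1$ and let $\Omega\subset\mathbb{R}^n$ be a bounded polyhedral domain. A family of simplicial subdivisions $\mathcal{G}_h$ (with $h$ the maximal diameter of the cells) is shape regular if the ratio of diameter to inradius of all simplices is bounded uniformly over the family. Poincaré inequality criterion. For Hilbert spaces $X,Y$ and a closed linear operator $T$ with domain $D\subset X$ and values in $Y$ (here $D$ is finite-dimensional), let $D^{\lrcorner}=\{v\in D:\langle v,w\rangle_X=0\ \forall\,w\in D\text{ with }Tw=0\}$ and $\mathsf{icr}(T,D)=\sup_{0\ne v\in D^{\lrcorner}}\|v\|_X/\|Tv\|_Y$ if $D^{\lrcorner}\neq\{0\}$, $\mathsf{icr}(T,D)=0$ if $D^{\lrcorner}=\{0\}$. All norms are the $L^2(\Omega)$ norms of forms. Forms. $d^k$ is the exterior derivative on $k$-forms, $\star$ the Hodge star, $\langle\cdot,\cdot\rangle_{L^2\Lambda^k}$ the $L^2(\Omega)$ inner product, and $\delta_k$ the codifferential on $k$-forms, i.e. the formal adjoint of $d^{k-1}$: $\langle d^{k-1}\mu,\eta\rangle_{L^2\Lambda^k}=\langle\mu,\delta_k\eta\rangle_{L^2\Lambda^{k-1}}$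 whenever one of the smooth forms $\mu,\eta$ has compact support (thus $\delta_k=\pm\star d^{n-k}\star$). $H^*\Lambda^k(\Omega)=\{\mu\in L^2\Lambda^k(\Omega):\delta_k\mu\in L^2\Lambda^{k-1}(\Omega)\}$ with the graph norm, and $H^*_0\Lambda^k(\Omega)$ is the closure in it of smooth compactly supported forms. Whitney forms. $\mathcal{P}_0\Lambda^k$ denotes constant-coefficient $k$-forms. The Koszul operator is $\kappa(dx^{\alpha_1}\wedge\dots\wedge dx^{\alpha_k})=\sum_{j=1}^k(-1)^{j+1}x^{\alpha_j}dx^{\alpha_1}\wedge\dots\wedge\widehat{dx^{\alpha_j}}\wedge\dots\wedge dx^{\alpha_k}$; $\mathcal{P}_1^-\Lambda^k=\mathcal{P}_0\Lambda^k+\kappa(\mathcal{P}_0\Lambda^{k+1})$, $\mathcal{P}_1^{*,-}\Lambda^k=\star(\mathcal{P}_1^-\Lambda^{n-k})$. $\mathcal{P}_1^-\Lambda^k(\mathcal{G}_h)$ and $\mathcal{P}_1^{*,-}\Lambda^k(\mathcal{G}_h)$ are the corresponding piecewise spaces (no inter-element continuity). $d^k_h$ is $d^k$ applied cell by cell. Spaces. $\mathbf{W}^*_{h0}\Lambda^k=\mathcal{P}_1^{*,-}\Lambda^k(\mathcal{G}_h)\cap H^*_0\Lambda^k(\Omega)$, and for $0\le k\le n-1$, $\mathbf{W}^{\rm nc}_h\Lambda^k=\{\omega_h\in\mathcal{P}_1^-\Lambda^k(\mathcal{G}_h):\langle\omega_h,\delta_{k+1}\eta_h\rangle_{L^2\Lambda^k}-\langle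 d^k_h\omega_h,\eta_h\rangle_{L^2\Lambda^{k+1}}=0\ \forall\,\eta_h\in\mathbf{W}^*_{h0}\Lambda^{k+1}\}$. *)

(* Defs.v *)
From HB Require Import structures.
From mathcomp Require Import all_boot all_order all_algebra finmap.
From mathcomp Require Import all_classical all_reals all_analysis.

Set Implicit Arguments.
Unset Strict Implicit.
Unset Printing Implicit Defensive.

Import Order.TTheory GRing.Theory Num.Theory.
Import numFieldNormedType.Exports.

Local Open Scope classical_set_scope.
Local Open Scope ring_scope.

Definition measure_rV_display : measure_display -> measure_display.
Proof. exact. Qed.

Section measurable_rV.
Context {d} {T : measurableType d} (n : nat).

Let coors : 'I_n -> 'rV[T]_n -> T := fun i x => x ord0 i.

Let rV_set0 : g_sigma_preimage coors set0.
Proof. exact: sigma_algebra0. Qed.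

Let rV_setC A : g_sigma_preimage coors A -> g_sigma_preimage coors (~` A).
Proof. exact: sigma_algebraC. Qed.

Let rV_bigcup (F : _^nat) : (forall i, g_sigma_preimage coors (F i)) ->
  g_sigma_preimage coors (\bigcup_i (F i)).
Proof. exact: sigma_algebra_bigcup. Qed.

HB.instance Definition _ := @isMeasurable.Build (measure_rV_display d)
  'rV[T]_n (g_sigma_preimage coors) rV_set0 rV_setC rV_bigcup.

Lemma measurable_coord_rV (i : 'I_n) :
  measurable_fun [set: 'rV[T]_n] (fun x : 'rV[T]_n => x ord0 i).
Proof.
move=> _ Y mY; rewrite setTI; apply: sub_sigma_algebra => /=.
rewrite -bigcup_seq/=; exists i => /=; first by rewrite mem_index_enum.
by exists Y => //; rewrite setTI.
Qed.

Lemma measurable_fun_rVP d' (T' : measurableType d') (f : T' -> 'rV[T]_n) :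
  (forall i, measurable_fun [set: T'] (fun x => f x ord0 i)) ->
  measurable_fun [set: T'] f.
Proof.
move=> mf.
suff : g_sigma_preimage (fun i => coors i \o f) `<=` measurable.
  rewrite g_sigma_preimage_comp => H _ A mA; apply: H; exists A => //.
apply: smallest_sub; first exact: sigma_algebra_measurable.
case: n f mf @coors => [|m] f mf coors'; first by rewrite big_ord0.
rewrite -bigcup_mkord_ord; apply: bigcup_sub => i Ii.
by move=> A [B mB <-]; exact: mf.
Qed.

End measurable_rV.

Section lebesgue_measure_rV.
Context {R : realType}.
Local Open Scope ereal_scope.

Definition cons_rV n (p : measurableTypeR R * 'rV[R]_n) : 'rV[R]_n.+1 :=
  \row_i (if unlift ord0 i is Some j then p.2 ord0 j else p.1).

Definition uncons_rV n (v : 'rV[R]_n.+1) : measurableTypeR R * 'rV[R]_n :=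
  (v ord0 ord0, \row_j v ord0 (lift ord0 j)).

Lemma cons_rVK n : cancel (@cons_rV n) (@uncons_rV n).
Proof.
case=> x v; rewrite /uncons_rV /cons_rV mxE unlift_none; congr pair.
by apply/rowP => j; rewrite !mxE liftK.
Qed.

Lemma uncons_rVK n : cancel (@uncons_rV n) (@cons_rV n).
Proof.
move=> v; apply/rowP => i; rewrite mxE.
by case: (unliftP ord0 i) => [j|] -> //=; rewrite mxE.
Qed.

Lemma measurable_cons_rV n : measurable_fun setT (@cons_rV n).
Proof.
apply: measurable_fun_rVP => i; rewrite /cons_rV.
case: (unliftP ord0 i) => [j|] ->.
  rewrite [X in measurable_fun _ X](_ : _ =
    (fun v : 'rV[R]_n => v ord0 j) \o snd); last first.
    by apply/funext => p; rewrite /= mxE liftK.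
  apply: measurableT_comp => //; exact: measurable_coord_rV.
rewrite [X in measurable_fun _ X](_ : _ = fst).
  exact: measurable_fst.
by apply/funext => p; rewrite /= mxE unlift_none.
Qed.

Lemma measurable_uncons_rV n : measurable_fun setT (@uncons_rV n).
Proof.
apply/measurable_fun_pairP; split.
  exact: measurable_coord_rV.
apply: measurable_fun_rVP => i.
rewrite [X in measurable_fun _ X](_ : _ =
    (fun v : 'rV[R]_n.+1 => v ord0 (lift ord0 i))).
  exact: measurable_coord_rV.
by apply/funext => p; rewrite /= mxE.
Qed.

Section step.
Context n (mu : {sigma_finite_measure set 'rV[R]_n -> \bar R}).

Definition cons_measure : set 'rV[R]_n.+1 -> \bar R :=
  pushforward (lebesgue_measure \x mu) (@cons_rV n).

HB.instance Definition _ := Measure.copy cons_measure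
  (measure_function_pushforward__canonical__measure_function_Measure
     (lebesgue_measure \x mu) (@measurable_cons_rV n)).

Let cons_measure_sigma_finite : sigma_finite setT cons_measure.
Proof.
have /sigma_finiteP[F [TF ndF Foo]] := sigma_finiteT (@lebesgue_measure R).
have /sigma_finiteP[G [TG ndG Goo]] := sigma_finiteT mu.
exists (fun i => @uncons_rV n @^-1` (F i `*` G i)).
  rewrite -preimage_bigcup [X in _ @^-1` X](_ : _ = setT) ?preimage_setT //.
  apply/seteqP; split => // -[x y] _.
  have [i _ Fx] : (\bigcup_i F i) x by rewrite -TF.
  have [j _ Gy] : (\bigcup_i G i) y by rewrite -TG.
  exists (maxn i j) => //; split.
  - by move: x Fx; exact/subsetPset/ndF/leq_maxl.
  - by move: y Gy; exact/subsetPset/ndG/leq_maxr.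
move=> i; have [mF Fi] := Foo i; have [mG Gi] := Goo i.
have mFG : measurable (F i `*` G i) by exact: measurableX.
split; first by rewrite -[X in measurable X]setTI; exact: measurable_uncons_rV.
rewrite /cons_measure /pushforward -comp_preimage.
rewrite [X in X @^-1` _](_ : _ = id); last first.
  by apply/funext => p /=; rewrite cons_rVK.
by rewrite preimage_id product_measure1E// lte_mul_pinfty// ge0_fin_numE.
Qed.

HB.instance Definition _ := Measure_isSigmaFinite.Build _ _ _ cons_measure
  cons_measure_sigma_finite.

End step.

Fixpoint lebesgue_rV n : {sigma_finite_measure set 'rV[R]_n -> \bar R} :=
  match n return {sigma_finite_measure set 'rV[R]_n -> \bar R} with
  | 0 => \d_ (0%R : 'rV[R]_0)
  | m.+1 => cons_measure (lebesgue_rV m)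
  end.

Lemma lebesgue_rV_box n (A : 'I_n -> set R) :
  (forall i, measurable (A i)) ->
  lebesgue_rV n [set x | forall i, A i (x ord0 i)] =
  \prod_(i < n) lebesgue_measure (A i).
Proof.
elim: n A => [|n IHn] A mA.
  rewrite big_ord0 /= diracE mem_set //; by case.
pose B := [set x : 'rV[R]_n | forall i, A (lift ord0 i) (x ord0 i)].
have mB : measurable B.
  rewrite (_ : B = \bigcap_(i in [set: 'I_n])
      (fun x : 'rV[R]_n => x ord0 i) @^-1` A (lift ord0 i)).
    apply: fin_bigcap_measurable => // i _.
    by rewrite -[X in measurable X]setTI; exact: measurable_coord_rV.
  by apply/seteqP; split => [x xA i _|x xA i]; [exact: xA|exact: xA].
rewrite big_ord_recl -IHn //.
apply: etrans (product_measure1E lebesgue_measure (lebesgue_rV n) (mA ord0) mB).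
rewrite /= /cons_measure /pushforward; congr (_ _).
apply/seteqP; split => -[x v] /= H.
- by split => [|i]; [have := H ord0|have := H (lift ord0 i)];
    rewrite mxE ?unlift_none ?liftK.
- move=> i; rewrite mxE; case: (unliftP ord0 i) => [j|] -> //=.
    exact: H.2.
  exact: H.1.
Qed.

End lebesgue_measure_rV.

Section geometry.
Context {R : realType} {n : nat}.
Implicit Types (A Omega : set 'rV[R]_n) (K : {fset 'rV[R]_n})
  (G : {fset {fset 'rV[R]_n}}).

(* The norm that the library puts on 'rV[R]_n is the maximum norm. *)
Definition enorm (x : 'rV[R]_n) : R := Num.sqrt (\sum_i x ord0 i ^+ 2).

Definition diam A : R := sup [set enorm (p.1 - p.2) | p in A `*` A].

Definition inradius A : R :=
  sup [set r | 0 <= r /\ exists c, [set x | enorm (x - c) <= r] `<=` A].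

Definition hull K : set 'rV[R]_n :=
  [set x | exists t : 'rV[R]_n -> R,
    [/\ forall v, v \in K -> 0 <= t v, \sum_(v <- K) t v = 1
      & x = \sum_(v <- K) t v *: v]].

Definition affinely_independent K : Prop :=
  forall t : 'rV[R]_n -> R,
    \sum_(v <- K) t v = 0 -> \sum_(v <- K) t v *: v = 0 ->
    forall v, v \in K -> t v = 0.

(* A nondegenerate n-simplex is given by its n + 1 vertices; the closed simplex
   is hull K, and the open one its interior. *)
Definition is_simplex K : Prop := #|` K| = n.+1 /\ affinely_independent K.

Definition ocell K : set 'rV[R]_n := (hull K)°.

(* The interior of a finite union of simplices is open and bounded. *)
Definition bounded_polyhedral_domain Omega : Prop :=
  [/\ Omega !=set0, connected Omega &
    exists S : {fset {fset 'rV[R]_n}},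
      (forall K, K \in S -> is_simplex K) /\
      Omega = (\bigcup_(K in [set` S]) hull K)°].

(* Any two cells meet in the face (possibly empty) spanned by their common
   vertices. *)
Definition simplicial_subdivision Omega G : Prop :=
  [/\ forall K, K \in G -> is_simplex K,
      \bigcup_(K in [set` G]) hull K = closure Omega &
      forall K K', K \in G -> K' \in G ->
        hull K `&` hull K' = hull (K `&` K')%fset].

Definition mesh_size G : R := \big[Num.max/0]_(K <- G) diam (hull K).

Definition shape_regular (I : Type) (G : I -> {fset {fset 'rV[R]_n}}) : Prop :=
  exists sigma : R, forall i K, K \in G i ->
    diam (hull K) / inradius (hull K) <= sigma.

End geometry.

(* A differential form is given by its coefficients: omega stands for
   \sum_alpha omega alpha * dx^alpha, where alpha ranges over the subsets
   {alpha_1 < ... < alpha_k} of the n indices and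
   dx^alpha = dx^alpha_1 /\ ... /\ dx^alpha_k. All degrees live in one type. *)
Definition dform (R : realType) (n : nat) := {set 'I_n} -> 'rV[R]_n -> R.

Section forms.
Context {R : realType} {n : nat}.
Implicit Types (Omega : set 'rV[R]_n) (G : {fset {fset 'rV[R]_n}})
  (alpha beta : {set 'I_n}) (f : 'rV[R]_n -> R) (omega mu : dform R n)
  (P : set (dform R n)).

Definition is_kform (k : nat) omega : Prop :=
  forall alpha, #|alpha| != k -> forall x, omega alpha x = 0.

Definition partial (i : 'I_n) f : 'rV[R]_n -> R :=
  fun x => 'D_(delta_mx ord0 i) f x.

(* dx^i /\ dx^alpha = wedge_sign i alpha * dx^(i |: alpha) for i \notin alpha *)
Definition wedge_sign (i : 'I_n) alpha : R :=
  (-1) ^+ #|[set j in alpha | (j < i)%N]|.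

Definition ext_d omega : dform R n := fun beta x =>
  \sum_(i in beta) wedge_sign i beta * partial i (omega (beta :\ i)) x.

(* The coefficient of dx^alpha collects the contraction of the factor dx^i
   of dx^(i |: alpha), for each i \notin alpha. *)
Definition koszul omega : dform R n := fun alpha x =>
  \sum_(i | i \notin alpha)
    wedge_sign i alpha * x ord0 i * omega (i |: alpha) x.

(* dx^alpha /\ dx^(~: alpha) = hodge_sign alpha * dx^0 /\ ... /\ dx^(n - 1),
   so that star dx^alpha = hodge_sign alpha * dx^(~: alpha) *)
Definition hodge_sign alpha : R :=
  (-1) ^+ #|[set p : 'I_n * 'I_n |
               [&& p.1 \in alpha, p.2 \notin alpha & (p.2 < p.1)%N]]|.

Definition hodge omega : dform R n :=
  fun beta x => hodge_sign (~: beta) * omega (~: beta) x.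

Definition smooth f : Prop :=
  forall (s : seq 'I_n) x, differentiable (foldr partial f s) x.

Definition test_form Omega : set (dform R n) :=
  [set phi : dform R n | (forall alpha, smooth (phi alpha)) /\
    exists C, [/\ compact C, C `<=` Omega &
      forall alpha x, ~ C x -> phi alpha x = 0]].

Definition L2_form Omega : set (dform R n) :=
  [set omega : dform R n | forall alpha, measurable_fun Omega (omega alpha) /\
    (lebesgue_rV n).-integrable Omega (fun x => (omega alpha x ^+ 2)%:E)].

Definition L2_ip Omega omega mu : R :=
  \int[lebesgue_rV n]_(x in Omega) (\sum_alpha omega alpha x * mu alpha x).

(* The formal adjoint of ext_d on forms of all degrees: ext_d is graded and
   forms of distinct degrees are orthogonal, so that on k-forms this is the
   formal adjoint delta_k of d^(k-1). *)
Definition is_codiff Omega mu theta : Prop :=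
  forall phi, test_form Omega phi ->
    L2_ip Omega (ext_d phi) mu = L2_ip Omega phi theta.

(* A representative of the class, unique up to a null set. *)
Definition codiff Omega mu : dform R n :=
  get [set theta : dform R n | L2_form Omega theta /\ is_codiff Omega mu theta].

Definition Hstar Omega k : set (dform R n) :=
  [set mu : dform R n | [/\ is_kform k mu, L2_form Omega mu &
    exists theta, L2_form Omega theta /\ is_codiff Omega mu theta]].

Definition Hstar_norm Omega mu : R :=
  Num.sqrt (L2_ip Omega mu mu
            + L2_ip Omega (codiff Omega mu) (codiff Omega mu)).

Definition Hstar0 Omega k : set (dform R n) :=
  [set mu : dform R n | Hstar Omega k mu /\
    forall e : R, 0 < e -> exists phi,
      [/\ test_form Omega phi, is_kform k phi &
        Hstar_norm Omega (mu - phi) < e]].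

Definition P0 k : set (dform R n) :=
  [set omega : dform R n | is_kform k omega /\
    forall alpha x y, omega alpha x = omega alpha y].

Definition P1m k : set (dform R n) :=
  [set omega : dform R n | exists2 a, P0 k a & exists2 b, P0 k.+1 b &
    omega = a + koszul b].

Definition P1sm k : set (dform R n) := hodge @` P1m (n - k).

(* Piecewise forms are classes modulo the null set formed by the boundaries of
   the cells; the representative chosen vanishes there and off the mesh. *)
Definition piecewise G P : set (dform R n) :=
  [set omega : dform R n |
    (forall K, K \in G -> exists2 p, P p &
       forall alpha x, ocell K x -> omega alpha x = p alpha x) /\
    (forall x, (forall K, K \in G -> ~ ocell K x) ->
       forall alpha, omega alpha x = 0)].

Definition ext_dh G omega : dform R n := fun beta x =>
  if `[< exists2 K, K \in G & ocell K x >] then ext_d omega beta x else 0.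

Definition Wstar0 Omega G k : set (dform R n) :=
  piecewise G (P1sm k) `&` Hstar0 Omega k.

Definition Wnc Omega G k : set (dform R n) :=
  [set omega : dform R n | piecewise G (P1m k) omega /\
    forall eta, Wstar0 Omega G k.+1 eta ->
      L2_ip Omega omega (codiff Omega eta)
      - L2_ip Omega (ext_dh G omega) eta = 0].

End forms.

(* X and Y carry semidefinite inner products and stand for the Hilbert spaces
   of classes modulo elements of norm zero. *)
Section icr.
Context {R : realType} {X Y : Type}.
Context (ipX : X -> X -> R) (ipY : Y -> Y -> R) (T : X -> Y) (D : set X).

Definition ip_norm {Z : Type} (ip : Z -> Z -> R) (z : Z) : R :=
  Num.sqrt (ip z z).

Definition orth_kernel : set X :=
  [set v | D v /\ forall w, D w -> ip_norm ipY (T w) = 0 -> ipX v w = 0].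

Definition icr : \bar R :=
  let V := [set v | orth_kernel v /\ ip_norm ipX v != 0] in
  if `[< V !=set0 >]
  then ereal_sup [set (ip_norm ipX v / ip_norm ipY (T v))%:E | v in V]
  else 0%E.

End icr.

(* Main.v *)
(* On a cell with centroid c, a form of P_1^- Lambda^k is a + kappa_c b with
   differential (k + 1) b, and a form of P_1^{*,-} Lambda^(k+1) is
   e + (x - c) /\ g with codifferential - (n - k) g, where a, b, e, g are
   constant; the linear parts are orthogonal to the constants and are bounded
   by h times the (co)differential. In the variables (a, (k + 1) b) and
   (e, - (n - k) g) the equations that define Wnc say that it is the adjoint S*
   of the linear relation S given by Wstar0.

   If (e, gamma) is in S and e is orthogonal to ker S, then there is (a, e) in
   S* with a orthogonal to ker S*, and |e|^2 = <a, gamma> <= |a| |gamma|. Hence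
   S and S* have the same constant, and each icr exceeds it by at most n h.

   The codifferential of the statement is weak; by the fundamental lemma of the
   calculus of variations it agrees almost everywhere with the cellwise one. *)

Require Import Defs.
From HB Require Import structures.
From mathcomp Require Import all_boot all_order all_algebra finmap.
From mathcomp Require Import all_classical all_reals all_analysis.
From mathcomp Require Import measurable_realfun ring lra zify.

Set Implicit Arguments.
Unset Strict Implicit.
Unset Printing Implicit Defensive.

Import Order.TTheory GRing.Theory Num.Theory.
Import numFieldNormedType.Exports.

Local Open Scope classical_set_scope.
Local Open Scope ring_scope.

(** * Linear relations and their adjoints *)

(** [S] is kept as a relation because a priori the constant part of a form does not determine its
    (co)differential. This also makes adjunction exact: the pairs (a, (k + 1) b) of piecewise forms
    range over all pairs of piecewise constants, so the defining equations of Wnc cut out the whole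
    adjoint and not just a part of it; in finite dimension the adjoint of the adjoint is [S] again,
    whence the symmetry of the estimate. The form a comes from normal equations, solvable exactly
    because e is orthogonal to the kernel.

    The kernel conditions survive the passage to coordinates since a form with vanishing
    (co)differential has no linear part, so inner products with it only see constants.

    Origin of n h: Cauchy-Schwarz over the n coordinates of x - c bounds the linear part by n^(1/2)
    h times the norm of its array of coefficients; each coefficient of b or g occurs at most n times
    in that array, which costs another n^(1/2); the factors k + 1 and n - k are at least 1. *)

Definition dotmx (R : realType) N (u v : 'rV[R]_N) : R := (u *m v^T) 0 0.

Section dotmx_theory.
Context {R : realType} {N : nat}.
Implicit Types u v w : 'rV[R]_N.

Lemma dotmxE u v : dotmx u v = \sum_j u 0 j * v 0 j.
Proof. by rewrite /dotmx !mxE; apply: eq_bigr => j _; rewrite mxE. Qed.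

Lemma dotmxC u v : dotmx u v = dotmx v u.
Proof. by rewrite !dotmxE; apply: eq_bigr => j _; rewrite mulrC. Qed.

Lemma dotmxDl u v w : dotmx (u + v) w = dotmx u w + dotmx v w.
Proof. by rewrite /dotmx mulmxDl mxE. Qed.

Lemma dotmxZl c u v : dotmx (c *: u) v = c * dotmx u v.
Proof. by rewrite /dotmx -scalemxAl mxE. Qed.

Lemma dotmxDr u v w : dotmx w (u + v) = dotmx w u + dotmx w v.
Proof. by rewrite dotmxC dotmxDl !(dotmxC w). Qed.

Lemma dotmxZr c u v : dotmx u (c *: v) = c * dotmx u v.
Proof. by rewrite dotmxC dotmxZl dotmxC. Qed.

Lemma dotmx_ge0 u : 0 <= dotmx u u.
Proof. by rewrite dotmxE sumr_ge0 // => j _; rewrite -expr2 sqr_ge0. Qed.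

Lemma dotmx_eq0 u : (dotmx u u == 0) = (u == 0).
Proof.
apply/eqP/eqP => [|->]; last by rewrite /dotmx mul0mx mxE.
rewrite dotmxE => /eqP; rewrite psumr_eq0; last first.
  by move=> j _; rewrite -expr2 sqr_ge0.
move=> /allP h; apply/rowP => j; rewrite mxE.
by have := h j (mem_index_enum j); rewrite /= mulf_eq0 orbb => /eqP.
Qed.

Lemma dotmx0l u : dotmx 0 u = 0.
Proof. by rewrite /dotmx mul0mx mxE. Qed.

Lemma dotmx0r u : dotmx u 0 = 0.
Proof. by rewrite dotmxC dotmx0l. Qed.

Lemma dotmx_CS u v : dotmx u v ^+ 2 <= dotmx u u * dotmx v v.
Proof.
have [->|v0] := eqVneq v 0; first by rewrite !dotmx0r expr0n mulr0.
have vv : 0 < dotmx v v by rewrite lt_neqAle dotmx_ge0 eq_sym dotmx_eq0 v0.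
have := dotmx_ge0 (dotmx v v *: u + (- dotmx u v) *: v).
rewrite !(dotmxDl, dotmxDr, dotmxZl, dotmxZr) (dotmxC v u).
move: vv; move: (dotmx u u) (dotmx u v) (dotmx v v) => a b c c0 h.
have : 0 <= c * (a * c - b ^+ 2) by apply: le_trans h _; rewrite le_eqVlt;
  apply/orP; left; apply/eqP; ring.
by rewrite pmulr_rge0 // subr_ge0.
Qed.

Lemma dotmx_le u v :
  dotmx u v <= Num.sqrt (dotmx u u) * Num.sqrt (dotmx v v).
Proof.
rewrite -sqrtrM ?dotmx_ge0 // (le_trans (ler_norm _)) //.
by rewrite -sqrtr_sqr ler_wsqrtr // dotmx_CS.
Qed.

End dotmx_theory.

(** Cauchy-Schwarz on each column; [B] is the squared Frobenius norm of [L]. *)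
Lemma dotmx_mulmx_bound (R : realType) N M (L : 'M[R]_(N, M)) :
  exists2 B, 0 <= B &
    forall u : 'rV[R]_N, dotmx (u *m L) (u *m L) <= B * dotmx u u.
Proof.
exists (\sum_j dotmx (col j L)^T (col j L)^T).
  by apply: sumr_ge0 => j _; exact: dotmx_ge0.
move=> u; rewrite dotmxE mulr_suml; apply: ler_sum => j _.
rewrite -expr2 [leRHS]mulrC; apply: le_trans (dotmx_CS _ _).
by rewrite dotmxE mxE; under [in leRHS]eq_bigr do rewrite !mxE.
Qed.

(** Fredholm alternative: the rows of [A *m pinvmx A - 1] lie in the left kernel of [A], so a
    right-hand side killed by that kernel is attained. *)
Lemma mulmx_pinvmx_kermx (F : fieldType) m n p (A : 'M[F]_(m, n))
    (y : 'M[F]_(m, p)) :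
  kermx A *m y = 0 -> A *m (pinvmx A *m y) = y.
Proof.
move=> Ky; apply/eqP; rewrite -subr_eq0 mulmxA -{2}(mul1mx y) -mulmxBl.
suff /submxP[D ->] : (A *m pinvmx A - 1%:M <= kermx A)%MS.
  by rewrite -mulmxA Ky mulmx0.
by apply/sub_kermxP; rewrite mulmxBl mul1mx mulmxKpV // subrr.
Qed.

(** If [u *m A *m A^T = 0] then [u *m A] has square norm 0. *)
Lemma kermx_gram (R : realType) m n (A : 'M[R]_(m, n)) :
  kermx (A *m A^T) *m A = 0.
Proof.
apply/row_matrixP => i; rewrite row_mul row0.
set u := row i _; apply/eqP; rewrite -dotmx_eq0 /dotmx trmx_mul.
have -> : u *m A *m (A^T *m u^T) = u *m (A *m A^T) *m u^T by rewrite !mulmxA.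
by rewrite /u -row_mul mulmx_ker row0 mul0mx mxE.
Qed.

Section subspace.
Context {F : fieldType} {N : nat} (V : set 'rV[F]_N).
Hypotheses (V0 : V 0) (VP : forall c u v, V u -> V v -> V (c *: u + v)).

(** Among the matrices with rows in [V] take one of maximal rank: a vector of [V] outside its row
    space would raise the rank. This turns a linear relation, given as a predicate, into a
    matrix. *)
Lemma subspace_row_space : exists M : 'M[F]_N, forall v, V v <-> (v <= M)%MS.
Proof.
have sV m (M : 'M[F]_(m, N)) : (forall i, V (row i M)) ->
    forall v, (v <= M)%MS -> V v.
  move=> VM v /submxP[D ->]; rewrite mulmx_sum_row.
  elim/big_rec: _ => // i x _ Vx.
  exact: VP.
pose P (r : nat) := `[< exists2 M : 'M[F]_N, (forall i, V (row i M)) & \rank M = r>].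
have P0 : exists r, P r.
  by exists 0; apply/asboolP; exists 0; [move=> i; rewrite row0|rewrite mxrank0].
have Pb r : P r -> (r <= N)%N.
  by move=> /asboolP[M _ <-]; exact: rank_leq_row.
case: (ex_maxnP P0 Pb) => r /asboolP[M VM rkM] rmax.
exists M => v; split=> [Vv|]; last exact: sV.
apply/negPn/negP => vM.
have VMv i : V (row i (M + v)%MS).
  apply: (sV _ (col_mx M v)); last by rewrite (submx_trans (row_sub _ _)) // addsmxE.
  move=> j; case: (splitP j) => [j1|j1] e.
    rewrite (_ : j = lshift 1 j1); last exact/val_inj.
    by rewrite -row_usubmx col_mxKu.
  rewrite (_ : j = rshift N j1); last exact/val_inj.
  by rewrite -row_dsubmx col_mxKd (ord1 j1) (_ : row 0 v = v) //; apply/rowP => q; rewrite mxE.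
have : (\rank (M + v)%MS <= r)%N by apply: rmax; apply/asboolP; exists (M + v)%MS.
rewrite -rkM leqNgt => /negP; apply.
have : (M < M + v)%MS.
  by rewrite /ltmx addsmxSl /=; apply: contra vM => /(submx_trans _); apply; rewrite addsmxSr.
by move/rank_ltmx.
Qed.

End subspace.

(** Write [S] as the set of pairs [(u *m E, u *m Y)]. The required vector is sought in the row space
    of [Y], as [z^T *m Y], which places it in the range of [S]; the adjoint equations then become
    the normal equations [Y *m Y^T *m z = E *m x^T]. One matrix [L] serves all [x], so the lift is
    bounded. *)
Lemma adjoint_relation_lift (R : realType) N1 N0
    (S : 'rV[R]_N1 -> 'rV[R]_N0 -> Prop) :
  S 0 0 ->
  (forall c x y x' y', S x y -> S x' y' -> S (c *: x + x') (c *: y + y')) ->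
  exists L : 'M[R]_(N1, N0), forall x y, S x y ->
    (forall x', S x' 0 -> dotmx x x' = 0) ->
    (forall x' y', S x' y' -> dotmx (x *m L) y' = dotmx x x') /\
    exists x', S x' (x *m L).
Proof.
move=> S0 SP.
have [|c u v|M MP] := @subspace_row_space _ _ [set v | S (lsubmx v) (rsubmx v)].
- by rewrite /= !linear0.
- by rewrite /= !linearP; exact: SP.
have {MP} SM x y : S x y <-> (row_mx x y <= M)%MS.
  by rewrite -MP /= row_mxKl row_mxKr.
pose E := lsubmx M; pose Y := rsubmx M.
have SEY u : S (u *m E) (u *m Y).
  by apply/SM; rewrite -mul_mx_row hsubmxK submxMl.
have EYS x y : S x y -> exists u, x = u *m E /\ y = u *m Y.
  move=> /SM/submxP[u]; rewrite -(hsubmxK M) mul_mx_row => /eq_row_mx[-> ->].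
  by exists u.
exists (E^T *m (pinvmx (Y *m Y^T))^T *m Y) => x y _ xker; split; last first.
  by eexists; rewrite !mulmxA; exact: SEY.
set z := pinvmx (Y *m Y^T) *m (E *m x^T).
have -> : x *m (E^T *m (pinvmx (Y *m Y^T))^T *m Y) = z^T *m Y.
  by rewrite /z !trmx_mul !trmxK !mulmxA.
(* Solvability: a row vector in the left kernel of the Gram matrix kills [Y], so its product with
   [E] is in the kernel of [S], to which [x] is orthogonal. *)
have zE : Y *m Y^T *m z = E *m x^T.
  apply: mulmx_pinvmx_kermx; apply/row_matrixP => i; rewrite mulmxA row_mul row0.
  have /xker : S (row i (kermx (Y *m Y^T) *m E)) 0.
    have := SEY (row i (kermx (Y *m Y^T))).
    have -> : row i (kermx (Y *m Y^T)) *m Y = 0.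
      by rewrite -row_mul (kermx_gram Y) row0.
    by rewrite -row_mul.
  rewrite dotmxC /dotmx => h; apply/rowP => j; rewrite !(ord1 j).
  by rewrite [RHS]mxE -[RHS]h.
move: z zE => z zE x' y' /EYS[u [-> ->]].
have zY : z^T *m Y *m Y^T = x *m E^T.
  transitivity ((Y *m Y^T *m z)^T); last by rewrite zE trmx_mul trmxK.
  by rewrite trmx_mul (trmx_mul Y) trmxK mulmxA.
by rewrite /dotmx 2!trmx_mul !mulmxA zY.
Qed.

(** The relation is its own double adjoint: the columns of [cokermx M] cut out the row space
    representing [S], and each of them, rotated by a quarter turn, is an element of the adjoint. *)
Lemma adjoint_relationK (R : realType) N1 N0
    (S : 'rV[R]_N1 -> 'rV[R]_N0 -> Prop) :
  S 0 0 ->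
  (forall c x y x' y', S x y -> S x' y' -> S (c *: x + x') (c *: y + y')) ->
  forall x y,
    (forall a b, (forall x' y', S x' y' -> dotmx a y' = dotmx b x') ->
      dotmx x b = dotmx y a) -> S x y.
Proof.
move=> S0 SP x y xyS.
have [|c u v|M MP] := @subspace_row_space _ _ [set v | S (lsubmx v) (rsubmx v)].
- by rewrite /= !linear0.
- by rewrite /= !linearP; exact: SP.
have {MP} SM x1 y1 : S x1 y1 <-> (row_mx x1 y1 <= M)%MS.
  by rewrite -MP /= row_mxKl row_mxKr.
apply/SM; rewrite submxE; apply/eqP/rowP => j; rewrite [RHS]mxE.
pose w := (col j (cokermx M))^T.
have wM u : (u <= M)%MS -> dotmx u w = 0.
  rewrite submxE => /eqP uM.
  transitivity ((u *m cokermx M) 0 j); last by rewrite uM [LHS]mxE.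
  by rewrite dotmxE [RHS]mxE; apply: eq_bigr => i _; rewrite !mxE.
have rowD (u : 'rV[R]_N1) (v : 'rV[R]_N0) : dotmx (row_mx u v) w =
  dotmx u (lsubmx w) + dotmx v (rsubmx w).
  by rewrite -{1}(hsubmxK w) /dotmx tr_row_mx mul_row_col mxE.
(* If [(w1, w2)] is orthogonal to [S], then [(- w2, w1)] belongs to the adjoint relation. *)
have := xyS (- rsubmx w) (lsubmx w).
have -> : dotmx y (- rsubmx w) = - dotmx y (rsubmx w).
  by rewrite -scaleN1r dotmxZr mulN1r.
move=> h.
have : dotmx (row_mx x y) w = 0.
  rewrite rowD h ?addNr // => x' y' /SM/wM; rewrite rowD => /eqP.
  rewrite addr_eq0 => /eqP; rewrite (dotmxC _ x') => ->.
  by rewrite -scaleN1r dotmxZl mulN1r dotmxC.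
by move=> <-; rewrite dotmxE [LHS]mxE; apply: eq_bigr => i _; rewrite !mxE.
Qed.

(** * The constant [icr] computed from a pair of coordinate maps *)

Section icr_theory.
Context {R : realType} {X Y : Type} (ipX : X -> X -> R) (ipY : Y -> Y -> R)
  (T : X -> Y) (D : set X).

Lemma icr_ge0 : (0 <= icr ipX ipY T D)%E.
Proof.
rewrite /icr; case: asboolP => [[v Vv]|_] //.
apply: (@le_trans _ _ (ip_norm ipX v / ip_norm ipY (T v))%:E).
  by rewrite lee_fin divr_ge0 // /ip_norm sqrtr_ge0.
by apply: ereal_sup_ubound; exists v.
Qed.

Lemma icr_le (c : \bar R) : (0 <= c)%E ->
  (forall v, orth_kernel ipX ipY T D v ->
    ((ip_norm ipX v / ip_norm ipY (T v))%:E <= c)%E) ->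
  (icr ipX ipY T D <= c)%E.
Proof.
move=> c0 h; rewrite /icr; case: asboolP => // _.
by apply: ge_ereal_sup => _ [v [Dv _] <-]; exact: h.
Qed.

(** Elements of norm 0, which the supremum leaves out, have ratio 0. *)
Lemma icr_ub v : orth_kernel ipX ipY T D v ->
  ((ip_norm ipX v / ip_norm ipY (T v))%:E <= icr ipX ipY T D)%E.
Proof.
move=> Dv; have [v0|v0] := eqVneq (ip_norm ipX v) 0.
  by rewrite v0 mul0r icr_ge0.
rewrite /icr; case: asboolP => [_|]; last by case; exists v.
by apply: ereal_sup_ubound; exists v.
Qed.

End icr_theory.

(* On [D] the operator [T] and the two semi-inner products are described by
   the linear relation [(x v, y v)]: [y v] is [T v], and [x v] is [v] up to a
   component whose size is controlled by [T v]. *)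
Record icr_coordinates (R : realType) (X Y : Type) (ipX : X -> X -> R)
    (ipY : Y -> Y -> R) (T : X -> Y) (D : set X) N1 N0 (x : X -> 'rV[R]_N1)
    (y : X -> 'rV[R]_N0) (rho : R) : Prop := IcrCoordinates {
  coord0 : exists2 v, D v & x v = 0 /\ y v = 0;
  coordP : forall c v w, D v -> D w ->
    exists2 u, D u & x u = c *: x v + x w /\ y u = c *: y v + y w;
  coord_kerE : forall v w, D v -> D w -> y w = 0 -> ipX v w = dotmx (x v) (x w);
  coord_imE : forall v, D v -> ipY (T v) (T v) = dotmx (y v) (y v);
  coord_ge : forall v, D v -> dotmx (x v) (x v) <= ipX v v;
  coord_le : forall v, D v ->
    ipX v v <= dotmx (x v) (x v) + rho ^+ 2 * dotmx (y v) (y v) }.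

Definition coord_rel (X : Type) (D : set X) A B (x : X -> A) (y : X -> B) a b :=
  exists2 v, D v & x v = a /\ y v = b.

Section icr_adjoint.
Context {R : realType}.

Lemma coord_rel_linear X Y ipX ipY T D N1 N0 x y rho :
  @icr_coordinates R X Y ipX ipY T D N1 N0 x y rho ->
  coord_rel D x y 0 0 /\
  forall c a b a' b', coord_rel D x y a b -> coord_rel D x y a' b' ->
    coord_rel D x y (c *: a + a') (c *: b + b').
Proof.
move=> h; split; first exact: (coord0 h).
by move=> c _ _ _ _ [v Dv [<- <-]] [w Dw [<- <-]]; exact: (coordP h).
Qed.

(** The kernel of [T] is where [y] vanishes, and there [ipX] agrees with the inner product of the
    coordinates [x]. *)
Lemma coord_orth_kernel X Y ipX ipY T D N1 N0 x y rho v :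
  @icr_coordinates R X Y ipX ipY T D N1 N0 x y rho ->
  orth_kernel ipX ipY T D v <->
  D v /\ forall a, coord_rel D x y a 0 -> dotmx (x v) a = 0.
Proof.
move=> h; have ker w : D w -> (ip_norm ipY (T w) = 0) <-> y w = 0.
  move=> Dw; rewrite /ip_norm (coord_imE h Dw); split=> [/eqP|->].
    by rewrite sqrtr_eq0 => ?; apply/eqP; rewrite -dotmx_eq0 eq_le dotmx_ge0 andbT.
  by rewrite dotmx0l sqrtr0.
split=> -[Dv orth]; split=> //.
  by move=> _ [w Dw [<- yw]]; rewrite -(coord_kerE h Dv Dw yw); apply: orth => //; exact/ker.
by move=> w Dw /(ker _ Dw) yw; rewrite (coord_kerE h Dv Dw yw); apply: orth; exists w.
Qed.

(** The norm of [v] is at most the square root of [|x|^2 + rho^2 |y|^2], hence at most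
    [|x| + rho |y|]. *)
Lemma icr_le_coord X Y ipX ipY T D N1 N0 x y rho B :
  @icr_coordinates R X Y ipX ipY T D N1 N0 x y rho -> 0 <= rho -> 0 <= B ->
  (forall v, orth_kernel ipX ipY T D v ->
    Num.sqrt (dotmx (x v) (x v)) <= B * Num.sqrt (dotmx (y v) (y v))) ->
  (icr ipX ipY T D <= (B + rho)%:E)%E.
Proof.
move=> h rho0 B0 hB; apply: icr_le => [|v Dv]; first by rewrite lee_fin addr_ge0.
rewrite lee_fin /ip_norm (coord_imE h Dv.1).
have := hB v Dv; set s := Num.sqrt (dotmx (y v) (y v)) => xs.
have s0 : 0 <= s by exact: sqrtr_ge0.
(* An image of norm 0 gives the quotient 0, since division by 0 yields 0. *)
have [->|sn0] := eqVneq s 0; first by rewrite invr0 mulr0 addr_ge0.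
rewrite ler_pdivrMr ?lt_neqAle 1?eq_sym ?sn0 //.
rewrite -(@ger0_norm _ ((B + rho) * s)) ?mulr_ge0 ?addr_ge0 // -sqrtr_sqr ler_wsqrtr //.
apply: le_trans (coord_le h Dv.1) _.
have -> : dotmx (y v) (y v) = s ^+ 2 by rewrite sqr_sqrtr // dotmx_ge0.
have : dotmx (x v) (x v) <= (B * s) ^+ 2.
  by rewrite -(sqr_sqrtr (dotmx_ge0 (x v))) lerXn2r // nnegrE ?sqrtr_ge0 ?mulr_ge0.
move=> /le_trans xx; apply: (@le_trans _ _ ((B * s) ^+ 2 + rho ^+ 2 * s ^+ 2)).
  by rewrite lerD2r xx.
rewrite -subr_ge0 (_ : _ - _ = 2 * (B * rho) * s ^+ 2); last by ring.
by rewrite !mulr_ge0 // sqr_ge0.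
Qed.

(** [|x|^2 = <a, y> <= |a| |y| <= B |x| |y|]; divide by [|x|]. *)
Lemma coord_lift_le N1 N0 (x : 'rV[R]_N1) (a y : 'rV[R]_N0) B :
  0 <= B -> dotmx a y = dotmx x x ->
  Num.sqrt (dotmx a a) <= B * Num.sqrt (dotmx x x) ->
  Num.sqrt (dotmx x x) <= B * Num.sqrt (dotmx y y).
Proof.
move=> B0 axx aB; set s := Num.sqrt (dotmx x x).
have s0 : 0 <= s by exact: sqrtr_ge0.
have [->|sn0] := eqVneq s 0; first by rewrite mulr_ge0 // sqrtr_ge0.
have spos : 0 < s by rewrite lt_neqAle eq_sym sn0.
rewrite -(ler_pM2r spos) -expr2 sqr_sqrtr ?dotmx_ge0 // -axx.
apply: le_trans (dotmx_le _ _) _.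
by rewrite mulrAC ler_wpM2r // sqrtr_ge0.
Qed.

(** The operator bound of the lift is a finite constant. It depends on the mesh and serves only to
    make the difference of the two constants an ordinary real number. *)
Lemma icr_lty X Y ipX ipY T D N1 N0 x y rho :
  @icr_coordinates R X Y ipX ipY T D N1 N0 x y rho -> 0 <= rho ->
  (icr ipX ipY T D < +oo)%E.
Proof.
move=> h rho0; have [S0 SP] := coord_rel_linear h.
have [L LP] := adjoint_relation_lift S0 SP.
have [B B0 BP] := dotmx_mulmx_bound L.
apply: (@le_lt_trans _ _ (Num.sqrt B + rho)%:E); last exact: ltry.
apply: (icr_le_coord h) => [//||v /(coord_orth_kernel _ h)[Dv orth]]; first exact: sqrtr_ge0.
have Sv : coord_rel D x y (x v) (y v) by exists v.
have [adj _] := LP _ _ Sv orth.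
apply: (@coord_lift_le _ _ _ (x v *m L)); rewrite ?sqrtr_ge0 //.
  exact: adj.
by rewrite -sqrtrM // ler_wsqrtr.
Qed.

(** The lift [a] of [x v] satisfies [(a, x v) \in S*], so it is the coordinate of some [w] in [D']
    with image [x v]. The constant of [D'] bounds [|a|] by [|x v|], and this bound transfers back to
    [v]. *)
Lemma icr_le_adjoint X Y ipX ipY T D X' Y' ipX' ipY' T' D' N1 N0 x y x' y' rho :
  @icr_coordinates R X Y ipX ipY T D N1 N0 x y rho ->
  @icr_coordinates R X' Y' ipX' ipY' T' D' N0 N1 x' y' rho ->
  0 <= rho ->
  (forall a b, coord_rel D' x' y' a b <->
    forall v, D v -> dotmx a (y v) = dotmx b (x v)) ->
  (icr ipX ipY T D <= icr ipX' ipY' T' D' + rho%:E)%E.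
Proof.
move=> h h' rho0 adjP; have [S0 SP] := coord_rel_linear h.
have [L LP] := adjoint_relation_lift S0 SP.
have := icr_lty h' rho0; have := icr_ge0 ipX' ipY' T' D'.
case icrE : (icr ipX' ipY' T' D') => [B| |] //; rewrite lee_fin => B0 _.
apply: (icr_le_coord h) => // v /(coord_orth_kernel _ h)[Dv orth].
have Sv : coord_rel D x y (x v) (y v) by exists v.
have [adj [x'' Sx'']] := LP _ _ Sv orth.
apply: (@coord_lift_le _ _ _ (x v *m L)); rewrite ?sqrtr_ge0 //; first exact: adj.
have : coord_rel D' x' y' (x v *m L) (x v).
  by apply/adjP => w Dw; apply: adj; exists w.
move=> [w D'w [xw yw]]; rewrite -xw -yw.
(* The lift lies in the range of [S], hence is orthogonal to the kernel of the adjoint. *)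
have wK : orth_kernel ipX' ipY' T' D' w.
  apply/(coord_orth_kernel _ h'); split=> // a /adjP a0.
  case: Sx'' => u Du [_ yu].
  by rewrite xw dotmxC -yu a0 // dotmx0l.
have := icr_ub wK; rewrite icrE lee_fin /ip_norm (coord_imE h' D'w).
set s := Num.sqrt (dotmx (y' w) _).
have s0 : 0 <= s by exact: sqrtr_ge0.
(* For an image of norm 0 the quotient is 0 and bounds nothing; but that image is [x v], which then
   vanishes together with its lift. *)
have [s00|sn0] := eqVneq s 0.
  move=> _; move/eqP: s00; rewrite sqrtr_eq0 yw => yv0.
  have /eqP : dotmx (x v) (x v) = 0 by apply/eqP; rewrite eq_le yv0 dotmx_ge0.
  by rewrite dotmx_eq0 xw => /eqP ->; rewrite mul0mx dotmx0l sqrtr0 mulr_ge0.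
rewrite ler_pdivrMr ?lt_neqAle 1?eq_sym ?sn0 //.
by apply: le_trans; rewrite ler_wsqrtr // (coord_ge h').
Qed.

(** Since the double adjoint is the relation itself, the one-sided estimate applies in both
    directions. *)
Lemma icr_dist_adjoint X Y ipX ipY T D X' Y' ipX' ipY' T' D'
    N1 N0 x y x' y' rho :
  @icr_coordinates R X Y ipX ipY T D N1 N0 x y rho ->
  @icr_coordinates R X' Y' ipX' ipY' T' D' N0 N1 x' y' rho ->
  0 <= rho ->
  (forall a b, coord_rel D' x' y' a b <->
    forall v, D v -> dotmx a (y v) = dotmx b (x v)) ->
  (`| icr ipX ipY T D - icr ipX' ipY' T' D' | <= rho%:E)%E.
Proof.
move=> h h' rho0 adjP; have [S0 SP] := coord_rel_linear h.
have adjP' a b : coord_rel D x y a b <->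
    forall v, D' v -> dotmx a (y' v) = dotmx b (x' v).
  split=> [[v Dv [<- <-]] w D'w|abD'].
    have /adjP/(_ v Dv) : coord_rel D' x' y' (x' w) (y' w) by exists w.
    by move=> adj; rewrite (dotmxC (x v)) -adj dotmxC.
  apply: (adjoint_relationK S0 SP) => a' b' ab'.
  have /adjP[w D'w [<- <-]] : forall v, D v -> dotmx a' (y v) = dotmx b' (x v).
    by move=> v Dv; apply: ab'; exists v.
  exact: abD'.
have := icr_le_adjoint h h' rho0 adjP; have := icr_le_adjoint h' h rho0 adjP'.
have := icr_lty h' rho0; have := icr_ge0 ipX' ipY' T' D'.
have := icr_lty h rho0; have := icr_ge0 ipX ipY T D.
case: (icr ipX ipY T D) => [A| |] //; case: (icr ipX' ipY' T' D') => [B| |] //.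
rewrite -!EFinD !lee_fin /= => _ _ _ _ BA AB.
by rewrite ler_norml; apply/andP; split; lra.
Qed.

End icr_adjoint.

(** * Lebesgue measure on [R^n] *)

Section boxes.
Context {R : realType} {n : nat}.
Implicit Types (l r x : 'rV[R]_n) (U : set 'rV[R]_n).

Definition obox l r : set 'rV[R]_n :=
  [set x | forall i, l 0 i < x 0 i < r 0 i].
Definition cbox l r : set 'rV[R]_n :=
  [set x | forall i, l 0 i <= x 0 i <= r 0 i].

Lemma obox_sub_cbox l r : obox l r `<=` cbox l r.
Proof. by move=> x lxr i; have /andP[/ltW -> /ltW ->] := lxr i. Qed.

Lemma measurable_coord_preimage i (A : set R) :
  measurable A -> measurable [set x : 'rV[R]_n | A (x 0 i)].
Proof.
move=> mA; rewrite -[X in measurable X]setTI.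
exact: (@measurable_coord_rV _ (measurableTypeR R)).
Qed.

Lemma measurable_box (A : 'I_n -> set R) : (forall i, measurable (A i)) ->
  measurable [set x : 'rV[R]_n | forall i, A i (x 0 i)].
Proof.
move=> mA; rewrite (_ : mkset _ =
    \bigcap_(i in [set: 'I_n]) [set x : 'rV[R]_n | A i (x 0 i)]).
  by apply: fin_bigcap_measurable => // i _; exact: measurable_coord_preimage.
by apply/seteqP; split=> [x Ax i _|x Ax i]; exact: Ax.
Qed.

Lemma oboxE l r : obox l r = [set x | forall i, `]l 0 i, r 0 i[%classic (x 0 i)].
Proof. by apply/seteqP; split=> x h i; have := h i; rewrite /= in_itv. Qed.

Lemma cboxE l r : cbox l r = [set x | forall i, `[l 0 i, r 0 i]%classic (x 0 i)].
Proof. by apply/seteqP; split=> x h i; have := h i; rewrite /= in_itv. Qed.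

Lemma measurable_obox l r : measurable (obox l r).
Proof. by rewrite oboxE;
  apply: (@measurable_box (fun i => `]l 0 i, r 0 i[%classic)) => i; exact: measurable_itv. Qed.

Lemma measurable_cbox l r : measurable (cbox l r).
Proof. by rewrite cboxE;
  apply: (@measurable_box (fun i => `[l 0 i, r 0 i]%classic)) => i; exact: measurable_itv. Qed.

Lemma compact_cbox l r : compact (cbox l r).
Proof.
rewrite cboxE; apply: (@rV_compact _ _ (fun i => `[l 0 i, r 0 i]%classic)) => i.
exact: segment_compact.
Qed.

Lemma lebesgue_rV_cbox_lty l r : (lebesgue_rV n (cbox l r) < +oo)%E.
Proof.
rewrite cboxE (lebesgue_rV_box (A := fun i => `[l 0 i, r 0 i]%classic));
  last by move=> i; exact: measurable_itv.
rewrite -ge0_fin_numE; last by apply: prode_ge0 => i _; exact: measure_ge0.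
elim/big_ind : _ => [//|x y|i _]; first exact: fin_numM.
by rewrite lebesgue_measure_itv; case: ifPn.
Qed.

Lemma lebesgue_rV_obox_gt0 l r : (forall i, l 0 i < r 0 i) ->
  (0 < lebesgue_rV n (obox l r))%E.
Proof.
move=> lr; rewrite oboxE (lebesgue_rV_box (A := fun i => `]l 0 i, r 0 i[%classic));
  last by move=> i; exact: measurable_itv.
elim/big_ind : _ => [|x y|i _]; [by rewrite lte01|exact: mule_gt0|].
by rewrite lebesgue_measure_itv /= lte_fin lr -EFinB lte_fin subr_gt0.
Qed.

Lemma ball_obox x (e : R) : 0 < e ->
  ball x e = obox (x - const_mx e) (x + const_mx e).
Proof.
move=> e0; apply/seteqP; split=> y.
  move=> [_ xy] i; have := xy 0 i; rewrite /ball /= ltr_distlC => h.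
  by rewrite !mxE.
move=> xy; split=> // i j; have := xy j; rewrite (ord1 i) /ball /= ltr_distlC.
by rewrite !mxE.
Qed.

Lemma nbhs_obox x U : nbhs x U ->
  exists2 e : R, 0 < e & obox (x - const_mx e) (x + const_mx e) `<=` U.
Proof. by case/nbhs_ballP => e /= e0; rewrite ball_obox // => xU; exists e. Qed.

Lemma closed_cbox l r : closed (cbox l r).
Proof. by apply: compact_closed; [exact: norm_hausdorff|exact: compact_cbox]. Qed.

(** Boxes with rational corners, enumerated by [unpickle]. Keeping those whose closed box lies in
    [U] ensures that functions supported in the closed box are test functions on [U]. *)
Lemma open_box_cover U : open U ->
  exists2 F : (set 'rV[R]_n)^nat, U = \bigcup_k F k &
    forall k, F k = set0 \/ exists l r, cbox l r `<=` U /\ F k = obox l r.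
Proof.
move=> oU.
pose B (p : 'rV[rat]_n * 'rV[rat]_n) : set 'rV[R]_n * set 'rV[R]_n :=
  (obox (map_mx ratr p.1) (map_mx ratr p.2), cbox (map_mx ratr p.1) (map_mx ratr p.2)).
exists (fun k => if choice.unpickle k is Some p then
    if `[< (B p).2 `<=` U >] then (B p).1 else set0 else set0); last first.
  move=> k; case: (choice.unpickle k) => [p|]; last by left.
  by case: asboolP => pU; [right; eexists; eexists; split; first exact: pU|left].
apply/seteqP; split=> [x Ux|x [k _]]; last first.
  case: (choice.unpickle k) => [p|] //; case: asboolP => // pU Bx.
  by apply: pU; exact: obox_sub_cbox.
have [|e e0 xeU] := @nbhs_obox x U; first by move: oU; rewrite openE; exact.
have /choice[a aP] : forall i, exists q : rat, x 0 i - e < ratr q < x 0 i.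
  move=> i; have [|q] := @rat_in_itvoo R (x 0 i - e) (x 0 i); first by lra.
  by rewrite in_itv => ?; exists q.
have /choice[b bP] : forall i, exists q : rat, x 0 i < ratr q < x 0 i + e.
  move=> i; have [|q] := @rat_in_itvoo R (x 0 i) (x 0 i + e); first by lra.
  by rewrite in_itv => ?; exists q.
exists (choice.pickle (\row_i a i, \row_i b i)) => //.
rewrite choice.pickleK; case: asboolP => [_|].
  by move=> i; rewrite !mxE; have /andP[_ ->] := aP i; have /andP[-> _] := bP i.
case; apply: subset_trans xeU => y yab i; have := yab i; rewrite !mxE.
have := aP i; have := bP i => /andP[? ?] /andP[? ?] /andP[? ?].
by apply/andP; split; lra.
Qed.

(** The sigma-algebra is generated by the coordinates, not by the topology; countable unions of
    boxes relate the two. *)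
Lemma open_measurable_rV U : open U -> measurable U.
Proof.
move=> /open_box_cover[F -> FP]; apply: bigcupT_measurable => k.
by case: (FP k) => [->|[l [r [_ ->]]]]; [exact: measurable0|exact: measurable_obox].
Qed.

Lemma closed_measurable_rV U : closed U -> measurable U.
Proof.
by move=> cU; rewrite -(setCK U); apply: measurableC; apply: open_measurable_rV;
  exact: closed_openC.
Qed.

Lemma continuous_measurable_rV (f : 'rV[R]_n -> R) :
  continuous f -> measurable_fun setT f.
Proof.
move=> cf; apply: (measurability _ (RGenOpens.measurableE R)).
move=> _ [_ [a [b ->] <-]]; rewrite setTI.
by apply: open_measurable_rV; apply: open_comp => //= x _; exact: cf.
Qed.

Lemma lebesgue_rV_open_gt0 U : open U -> U !=set0 -> (0 < lebesgue_rV n U)%E.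
Proof.
move=> oU [x Ux]; have [|e e0 xU] := @nbhs_obox x U; first by move: oU; rewrite openE; exact.
apply: (@lt_le_trans _ _ (lebesgue_rV n (obox (x - const_mx e) (x + const_mx e)))).
  by apply: lebesgue_rV_obox_gt0 => i; rewrite !mxE; lra.
by apply: le_measure; rewrite ?inE //; [exact: measurable_obox|exact: open_measurable_rV].
Qed.

End boxes.

(** * Hyperplanes, simplices and meshes *)

Section affine.
Context {R : realType} {n : nat}.
Implicit Types (f x : 'rV[R]_n) (c : R).

Definition affine f c x : R := \sum_i f 0 i * x 0 i + c.

Lemma continuous_affine f c : continuous (affine f c).
Proof.
have h1 i : continuous (fun x : 'rV[R]_n => f 0 i * x 0 i).
  by move=> x; have := @cvgMl_tmp _ _ _ _ _ (f 0 i) _ (@coord_continuous R 1 n 0 i x); exact.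
have h : continuous (fun x : 'rV[R]_n => \sum_i f 0 i * x 0 i).
  by apply: continuous_big => [|i _]; [exact: add_continuous|exact: h1].
by move=> x; exact: (cvgD (h x) (cvg_cst c)).
Qed.

Lemma closed_affine0 f c : closed [set x | affine f c x = 0].
Proof.
rewrite (_ : mkset _ = affine f c @^-1` [set 0]) //.
by apply: closed_comp => [x _|]; [exact: continuous_affine|exact: closed_eq].
Qed.

Lemma closed_affine_ge0 f c : closed [set x | 0 <= affine f c x].
Proof.
rewrite (_ : mkset _ = affine f c @^-1` [set y | 0 <= y]) //.
by apply: closed_comp => [x _|]; [exact: continuous_affine|exact: closed_ge].
Qed.

Lemma open_affine_gt0 f c : open [set x | 0 < affine f c x].
Proof.
rewrite (_ : mkset _ = affine f c @^-1` [set y | 0 < y]) //.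
by apply: open_comp => [x _|]; [exact: continuous_affine|exact: open_gt].
Qed.

End affine.

(** Slice along the first coordinate. If a later coefficient is nonzero, every slice is null by
    induction; otherwise all slices are empty except possibly the one at [- c / f 0 0], and a single
    point is null on the line. *)
Lemma lebesgue_rV_affine0 (R : realType) n (f : 'rV[R]_n) (c : R) :
  (f != 0) || (c != 0) -> lebesgue_rV n [set x | affine f c x = 0] = 0%E.
Proof.
elim: n f c => [|n IHn] f c fc.
  have c0 : c != 0 by move: fc; rewrite (_ : f = 0) ?eqxx //; apply/rowP => -[].
  rewrite (_ : mkset _ = set0) ?measure0 // -subset0 => x /=.
  by rewrite /affine big_ord0 add0r => /eqP; rewrite (negPf c0).
pose f' := \row_(j < n) f 0 (lift ord0 j).
rewrite /= /cons_measure /pushforward /= /product_measure1.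
set A := _ @^-1` _.
have affE x y : affine f c (cons_rV (x, y)) = affine f' (f 0 0 * x + c) y.
  rewrite /affine /cons_rV big_ord_recl mxE unlift_none /= -addrA addrCA.
  by congr (_ + _); apply: eq_bigr => i _; rewrite !mxE liftK.
have secA x : xsection A x = [set y | affine f' (f 0 0 * x + c) y = 0].
  by apply/seteqP; split=> y; rewrite xsectionP /A /= affE.
have mA : measurable A.
  rewrite /A -[X in measurable X]setTI; apply: measurable_cons_rV => //.
  by apply: closed_measurable_rV; exact: closed_affine0.
have [f'0|f'n0] := eqVneq f' 0; last first.
  rewrite integral0_eq // => x _; rewrite /= secA IHn // f'n0 //.
have [f00|f0n0] := eqVneq (f 0 0) 0.
  have c0 : c != 0.
    move: fc; rewrite (_ : f = 0) ?eqxx //; apply/rowP => i; rewrite mxE.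
    case: (unliftP ord0 i) => [j|] -> //.
    by move/rowP/(_ j) : f'0; rewrite !mxE.
  rewrite integral0_eq // => x _; rewrite /= secA IHn // f00 mul0r add0r c0 orbT //.
rewrite (@ae_eq_integral _ _ _ lebesgue_measure setT (cst 0%E)) ?integral0 //.
- exact: measurable_fun_xsection.
- exists [set - c / f 0 0]; split; first exact: measurable_set1.
    exact: lebesgue_measure_set1.
  move=> x /= /existsNP[_]; rewrite secA => h; apply: contrapT => xn; apply: h.
  rewrite IHn //; apply/orP; right; apply: contra_notN xn => /eqP e.
  by apply: (mulfI f0n0); rewrite mulrCA mulfV // mulr1; apply/eqP; rewrite -addr_eq0 e.
Qed.

Section simplex.
Context {R : realType} {n : nat}.
Implicit Types (K : {fset 'rV[R]_n}) (x v : 'rV[R]_n).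

Lemma fset_sum_nth K (V : nmodType) (F : 'rV[R]_n -> V) m : #|` K| = m ->
  \sum_(v <- K) F v = \sum_(i < m) F (nth 0 K i).
Proof. by move=> <-; rewrite (big_nth 0) big_mkord. Qed.

(** The matrix with rows [(v_j, 1)] is invertible by affine independence, and the columns of its
    inverse are the barycentric coordinates as affine functions. *)
Lemma simplex_barycentric K : is_simplex K ->
  exists f : 'I_(n + 1) -> 'rV[R]_n, exists c : 'I_(n + 1) -> R,
    forall (t : 'rV[R]_n -> R) x,
      \sum_(v <- K) t v = 1 /\ x = \sum_(v <- K) t v *: v <->
      forall j : 'I_(n + 1), affine (f j) (c j) x = t (nth 0 K j).
Proof.
move=> [cK aiK]; have {}cK : #|` K| = (n + 1)%N by rewrite addn1.
pose M : 'M[R]_(n + 1) := \matrix_i row_mx (nth 0 K i) 1%:M.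
have uM (u : 'rV[R]_(n + 1)) : u *m M =
    row_mx (\sum_i u 0 i *: nth 0 K i) (\sum_i u 0 i)%:M.
  rewrite mulmx_sum_row.
  under eq_bigr do rewrite rowK scale_row_mx.
  apply/rowP => j; rewrite summxE; case: (splitP j) => k jk.
    rewrite (_ : j = lshift 1 k); last exact/val_inj.
    by rewrite row_mxEl summxE; apply: eq_bigr => i _; rewrite row_mxEl.
  rewrite (_ : j = rshift n k); last exact/val_inj.
  rewrite row_mxEr mxE (ord1 k) mulr1n; apply: eq_bigr => i _.
  by rewrite row_mxEr !mxE mulr1n mulr1.
have Mu : M \in unitmx.
  rewrite -row_free_unit -kermx_eq0; apply/eqP/row_matrixP => i; rewrite row0.
  have : row i (kermx M) *m M = 0 by rewrite -row_mul mulmx_ker row0.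
  move: (row i _) => u; rewrite uM -[X in _ = X -> _]row_mx0 => /eq_row_mx[u1 u2].
  (* Affine independence is stated for functions on the vertices, so the coefficient vector is
     transported along the position of a vertex in the list. *)
  pose t v := u 0 (insubd (cast_ord (esym (addn1 n)) ord0) (index v K)).
  have tK (j : 'I_(n + 1)) : t (nth 0 K j) = u 0 j.
    rewrite /t index_uniq ?fset_uniq //; last by rewrite cK.
    by congr (u 0 _); apply/val_inj; rewrite val_insubd ltn_ord.
  apply/rowP => j; rewrite mxE -tK; apply: (aiK t).
  - rewrite (fset_sum_nth _ cK); under eq_bigr do rewrite tK.
    by move/matrixP/(_ 0 0) : u2; rewrite !mxE mulr1n.
  - by rewrite (fset_sum_nth _ cK); under eq_bigr do rewrite tK.
  - by rewrite mem_nth // cK.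
exists (fun j => \row_i invmx M (lshift 1 i) j), (fun j => invmx M (rshift n 0) j) => t x.
have affE j : affine (\row_i invmx M (lshift 1 i) j) (invmx M (rshift n 0) j) x =
    (row_mx x 1%:M *m invmx M) 0 j.
  rewrite mxE big_split_ord /= big_ord1 row_mxEr mxE mul1r /affine.
  congr (_ + _); apply: eq_bigr => i _; rewrite row_mxEl mxE mulrC //.
pose u : 'rV[R]_(n + 1) := \row_j t (nth 0 K j).
have -> : (\sum_(v <- K) t v = 1 /\ x = \sum_(v <- K) t v *: v) <->
    u *m M = row_mx x 1%:M.
  rewrite uM !(fset_sum_nth _ cK); split=> [[t1 ->]|/eq_row_mx[<- /matrixP/(_ 0 0)]].
    by rewrite -t1; congr row_mx; [|congr _%:M]; apply: eq_bigr => i _; rewrite mxE.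
  rewrite !mxE !mulr1n => <-; split; first by apply: eq_bigr => i _; rewrite mxE.
  by apply: eq_bigr => i _; rewrite mxE.
split=> [uMx j|h]; first by rewrite affE -uMx mulmxK // mxE.
rewrite (_ : u = row_mx x 1%:M *m invmx M) ?mulmxKV //.
by apply/rowP => j; rewrite -affE h mxE.
Qed.

(** A simplex is where all barycentric coordinates are nonnegative; a set of vertices that misses
    [v] spans a part of the hyperplane where the coordinate of [v] vanishes. *)
Lemma hull_subset_affine0 K : is_simplex K ->
  exists f : 'I_(n + 1) -> 'rV[R]_n, exists c : 'I_(n + 1) -> R,
  [/\ forall j, (f j != 0) || (c j != 0),
      hull K = [set x | forall j, 0 <= affine (f j) (c j) x],
      exists x, forall j, 0 < affine (f j) (c j) x &
      forall (K' : {fset 'rV[R]_n}) v, {subset K' <= K} -> v \in K -> v \notin K' ->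
        exists j, hull K' `<=` [set x | affine (f j) (c j) x = 0]].
Proof.
move=> sK; have [cK _] := sK; have {}cK : #|` K| = (n + 1)%N by rewrite addn1.
have [f [c fc]] := simplex_barycentric sK; exists f, c; split.
- move=> j; apply/negP/negP; rewrite -negb_and; apply/negP => /andP[/eqP f0 /eqP c0].
  pose v := nth 0 K j.
  (* At the [j]-th vertex the [j]-th coordinate is 1, so this affine function is not identically
     0. *)
  have /fc/(_ j) : \sum_(w <- K) (w == v)%:R = 1 :> R /\ v = \sum_(w <- K) (w == v)%:R *: w.
    have vK : v \in enum_fset K by rewrite mem_nth // cK.
    split.
      rewrite (bigD1_seq v) ?fset_uniq //= eqxx big1 ?addr0 // => w /negPf -> //.
    by rewrite (bigD1_seq v) ?fset_uniq //= eqxx scale1r big1 ?addr0 // => w /negPf ->; rewrite scale0r.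
  rewrite f0 c0 eqxx /affine addr0 big1 => [/eqP|i _]; last by rewrite mxE mul0r.
  by rewrite eq_sym oner_eq0.
- apply/seteqP; split=> x.
    by move=> [t [t0 t1 xt]] j; rewrite (fc t x).1 // t0 // mem_nth // cK.
  move=> x0; pose t v := affine (f (insubd (cast_ord (esym (addn1 n)) ord0) (index v K)))
    (c (insubd (cast_ord (esym (addn1 n)) ord0) (index v K))) x.
  have tK (j : 'I_(n + 1)) : affine (f j) (c j) x = t (nth 0 K j).
    rewrite /t index_uniq ?fset_uniq //; last by rewrite cK.
    by rewrite (_ : insubd _ _ = j) //; apply/val_inj; rewrite val_insubd ltn_ord.
  by have [? ?] := (fc t x).2 tK; exists t; split=> // v vK; exact: x0.
- exists (\sum_(v <- K) (n + 1)%:R^-1 *: v) => j.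
  rewrite (fc (fun=> (n + 1)%:R^-1) _).1; first by rewrite invr_gt0 ltr0n addn1.
  split=> //; rewrite (fset_sum_nth _ cK) sumr_const card_ord.
  by rewrite -[LHS]mulr_natl mulfV // pnatr_eq0 addn1.
- move=> K' v K'K vK vK'.
  have jlt : (index v K < n + 1)%N by rewrite -cK index_mem.
  exists (Ordinal jlt) => x [t [_ t1 ->]] /=.
  have sumK' (V : lmodType R) (F : 'rV[R]_n -> V) : \sum_(w <- K') t w *: F w =
      \sum_(w <- K) (if w \in K' then t w else 0) *: F w.
    rewrite [RHS](eq_bigr (fun w => if w \in K' then t w *: F w else 0)); last first.
      by move=> w _; case: ifP => // _; rewrite scale0r.
    rewrite -big_mkcond -big_filter /=; apply: perm_big; apply: uniq_perm.
    - exact: fset_uniq.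
    - by rewrite filter_uniq // fset_uniq.
    - by move=> w; rewrite mem_filter; apply/idP/andP => [/[dup] + /K'K|[]].
  rewrite (fc (fun w => if w \in K' then t w else 0) _).1 /=.
    by rewrite nth_index // (negPf vK').
  split; last exact: sumK'.
  rewrite -t1; transitivity (\sum_(w <- K') (t w *: (1 : R^o))).
    by rewrite sumK'; apply: eq_bigr => w _; rewrite /GRing.scale /= mulr1.
  by apply: eq_bigr => w _; rewrite /GRing.scale /= mulr1.
Qed.

End simplex.

Section cells.
Context {R : realType} {n : nat}.
Implicit Types (K : {fset 'rV[R]_n}) (G : {fset {fset 'rV[R]_n}})
  (Omega : set 'rV[R]_n).

Lemma hull_cbox K : exists M : R,
  hull K `<=` cbox (const_mx (- M)) (const_mx M).
Proof.
exists (\sum_(v <- K) `|v|) => _ [t [t0 t1 ->]] i; rewrite !mxE -ler_norml.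
rewrite summxE (le_trans (ler_norm_sum _ _ _)) //.
rewrite big_seq [leRHS]big_seq ler_sum // => v vK.
have tv1 : t v <= 1.
  rewrite -t1 (bigD1_seq v) ?fset_uniq //= lerDl big_seq_cond sumr_ge0 //.
  by move=> w /andP[wK _]; exact: t0.
rewrite mxE normrM ger0_norm ?t0 //.
apply: (@le_trans _ _ `|v 0 i|); first by rewrite ler_piMl // t0.
rewrite [leRHS]/Num.Def.normr /= mx_normrE.
exact: (le_trans _ (le_bigmax _ _ (0, i))).
Qed.

Lemma ocell_sub_hull K : ocell K `<=` hull K.
Proof. exact: interior_subset. Qed.

Lemma open_ocell K : open (ocell K).
Proof. exact: open_interior. Qed.

Lemma measurable_ocell K : measurable (ocell K).
Proof. by apply: open_measurable_rV; exact: open_ocell. Qed.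

Lemma simplex_hull_closed K : is_simplex K -> closed (hull K).
Proof.
move=> /hull_subset_affine0[f [c [_ -> _ _]]].
rewrite (_ : mkset _ = \bigcap_j [set x | 0 <= affine (f j) (c j) x]).
  by apply: closed_bigI => j _; exact: closed_affine_ge0.
by apply/seteqP; split=> x xP; [move=> j _; exact: xP|move=> j; exact: xP].
Qed.

Lemma simplex_affine_gt0_ocell K f c :
  hull K = [set x | forall j : 'I_(n + 1), 0 <= affine (f j) (c j) x] ->
  [set x | forall j, 0 < affine (f j) (c j) x] `<=` ocell K.
Proof.
move=> KE; rewrite /ocell -open_subsetE.
  by rewrite KE => x x0 j; exact: ltW.
rewrite openE => x x0; have h (j : 'I_(n + 1)) : nbhs x [set y | 0 < affine (f j) (c j) y].
  by have := @open_affine_gt0 R n (f j) (c j); rewrite openE; apply; exact: x0.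
by have := filter_forall (nbhs_filter x) h; exact.
Qed.

Lemma ocell_neq0 K : is_simplex K -> ocell K !=set0.
Proof.
move=> /hull_subset_affine0[f [c [_ KE [x x0] _]]]; exists x.
exact: (simplex_affine_gt0_ocell KE).
Qed.

Lemma lebesgue_rV_ocell_gt0 K : is_simplex K -> (0 < lebesgue_rV n (ocell K))%E.
Proof.
by move=> sK; apply: lebesgue_rV_open_gt0; [exact: open_ocell|exact: ocell_neq0].
Qed.

Lemma lebesgue_rV_ocell_lty K : (lebesgue_rV n (ocell K) < +oo)%E.
Proof.
have [M KM] := hull_cbox K.
apply: le_lt_trans (lebesgue_rV_cbox_lty (const_mx (- M)) (const_mx M)).
apply: le_measure; rewrite ?inE; [exact: measurable_ocell|exact: measurable_cbox|].
by move=> x /ocell_sub_hull/KM.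
Qed.

Lemma simplex_boundary_negligible K : is_simplex K ->
  (lebesgue_rV n).-negligible (hull K `\` ocell K).
Proof.
move=> /hull_subset_affine0[f [c [fc KE _ _]]].
have : (lebesgue_rV n).-negligible
    (\big[setU/set0]_j [set x | affine (f j) (c j) x = 0]).
  elim/big_ind : _ => [|A B|j _]; [exact: negligible_set0|exact: negligibleU|].
  apply/negligibleP; last exact: lebesgue_rV_affine0.
  by apply: closed_measurable_rV; exact: closed_affine0.
apply: negligibleS => x [Kx nx]; rewrite -bigcup_seq /=.
apply: contrapT => h; apply: nx; apply: (simplex_affine_gt0_ocell KE) => j.
rewrite lt_neqAle eq_sym; apply/andP; split; last by move: Kx; rewrite KE; exact.
by apply/eqP => fj0; apply: h; exists j => //=; exact: mem_index_enum.
Qed.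

(** Distinct simplices have equally many vertices, so [K] has a vertex outside [K'], and their
    common face lies in a hyperplane. The intersection of the open cells is open and null, hence
    empty. *)
Lemma subdivision_ocell_disjoint Omega G K K' :
  simplicial_subdivision Omega G -> K \in G -> K' \in G -> K != K' ->
  ocell K `&` ocell K' = set0.
Proof.
move=> [sG _ GI] KG K'G KK'.
have [v [vK vK']] : exists v, v \in K /\ v \notin K'.
  apply: contrapT => h; move/negP: KK'; apply.
  rewrite eqEfcard; apply/andP; split.
    apply/fsubsetP => v vK; apply: contrapT => vK'; apply: h; exists v; split=> //.
    exact/negP.
  by rewrite (sG _ KG).1 (sG _ K'G).1.
apply: contrapT => /eqP/set0P ne.
have [f [c [fc _ _ /(_ (K `&` K')%fset v)]]] := hull_subset_affine0 (sG _ KG).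
case=> [w|//||j KK'f].
- by rewrite inE => /andP[].
- by rewrite inE (negPf vK') andbF.
have oKK' : open (ocell K `&` ocell K') by apply: openI; exact: open_ocell.
have := lebesgue_rV_open_gt0 oKK' ne; apply/negP; rewrite -leNgt.
rewrite -(lebesgue_rV_affine0 (fc j)); apply: le_measure; rewrite ?inE.
- exact: open_measurable_rV.
- by apply: closed_measurable_rV; exact: closed_affine0.
- by move=> x [/ocell_sub_hull Kx /ocell_sub_hull K'x]; apply: KK'f; rewrite -GI.
Qed.

Lemma closed_bigcup_hull G : (forall K, K \in G -> is_simplex K) ->
  closed (\bigcup_(K in [set` G]) hull K).
Proof.
move=> sG; apply: closed_bigcup; first exact: finite_fset.
by move=> K /= KG; exact/simplex_hull_closed/sG.
Qed.

Lemma polyhedral_domain_open Omega : bounded_polyhedral_domain Omega -> open Omega.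
Proof. by move=> [_ _ [S [_ ->]]]; exact: open_interior. Qed.

(** An open cell lies in the closure of [Omega], thus in the closed union of simplices of which
    [Omega] is the interior; being open, it lies in that interior. *)
Lemma ocell_sub_domain Omega G K : bounded_polyhedral_domain Omega ->
  simplicial_subdivision Omega G -> K \in G -> ocell K `<=` Omega.
Proof.
move=> [_ _ [S [sS OE]]] [_ GO _] KG.
have KO : hull K `<=` closure Omega.
  by rewrite -GO => x Kx; exists K.
rewrite OE -open_subsetE; last exact: open_ocell.
have SE := (closure_id _).1 (closed_bigcup_hull sS).
rewrite SE => x /ocell_sub_hull/KO; apply: closureS.
by rewrite OE; exact: interior_subset.
Qed.

Lemma domain_negligible_ocell Omega G : simplicial_subdivision Omega G ->
  (lebesgue_rV n).-negligible (Omega `\` \bigcup_(K in [set` G]) ocell K).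
Proof.
move=> [sG GO _].
have : (lebesgue_rV n).-negligible
    (\big[setU/set0]_(K <- G) (hull K `\` ocell K)).
  rewrite big_seq; elim/big_ind : _ => [|A B|K KG]; [exact: negligible_set0|exact: negligibleU|].
  exact/simplex_boundary_negligible/sG.
apply: negligibleS => x [Ox nx]; rewrite -bigcup_seq /=.
have : closure Omega x by exact: subset_closure.
rewrite -GO => -[K KG Kx]; exists K => //; split=> // Kox; apply: nx.
by exists K.
Qed.

Lemma domain_cbox Omega G : simplicial_subdivision Omega G ->
  exists M : R, Omega `<=` cbox (const_mx (- M)) (const_mx M).
Proof.
move=> [sG GO _]; have /choice[M MP] := hull_cbox.
exists (\sum_(K <- G) `|M K|) => x Ox.
have : closure Omega x by exact: subset_closure.
rewrite -GO => -[K KG /MP Kx] i; have := Kx i; rewrite !mxE -!ler_norml => /le_trans; apply.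
rewrite (le_trans (ler_norm _)) //.
by rewrite (bigD1_seq K) ?fset_uniq //= lerDl sumr_ge0.
Qed.

Lemma hull_diam K i x y : hull K x -> hull K y ->
  `|x 0 i - y 0 i| <= diam (hull K).
Proof.
move=> Kx Ky; apply: (@le_trans _ _ (enorm (x - y))).
  rewrite /enorm -sqrtr_sqr ler_wsqrtr // (bigD1 i) //= !mxE lerDl.
  by rewrite sumr_ge0 // => j _; exact: sqr_ge0.
apply: ub_le_sup; last by exists (x, y).
(* A supremum bounds its set only if the set is bounded. *)
have [M KM] := hull_cbox K.
exists (Num.sqrt (\sum_(j < n) (2 * M) ^+ 2)) => _ [[u v] [/= Ku Kv] <-].
rewrite /enorm ler_wsqrtr // ler_sum // => j _; rewrite !mxE.
have := KM _ Ku j; have := KM _ Kv j; rewrite !mxE => /andP[? ?] /andP[? ?].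
rewrite -[leLHS]real_normK ?num_real // lerXn2r ?nnegrE //; first lra.
by rewrite ler_norml; apply/andP; split; lra.
Qed.

Lemma diam_mesh_size G K : K \in G -> diam (hull K) <= mesh_size G.
Proof. by move=> KG; exact: (@le_bigmax_seq _ _ _ _ 0 K predT (fun K => diam (hull K))). Qed.

Lemma mesh_size_ge0 G : 0 <= mesh_size G.
Proof. exact: bigmax_ge_id. Qed.

End cells.

(** * Bump functions and the fundamental lemma of the calculus of variations *)

Section flat.
Context {R : realType}.
Implicit Types (t : R) (m : nat).

(** [flat 0] is the classical smooth function [exp(- 1 / t)], extended by 0; the powers of [1 / t]
    make the family stable under differentiation up to linear combinations. *)
Definition flat m t : R := if 0 < t then t^-1 ^+ m * expR (- t^-1) else 0.

Lemma flat_ge0 m t : 0 <= flat m t.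
Proof.
rewrite /flat; case: ifPn => // t0.
by rewrite mulr_ge0 ?expR_ge0 // exprn_ge0 // invr_ge0 ltW.
Qed.

Lemma flat_le0 m t : t <= 0 -> flat m t = 0.
Proof. by rewrite /flat ltNge => ->. Qed.

(** With [s = 1 / t], the exponential series gives [s^(m + 2) / (m + 2)! <= exp s]: quadratic decay
    at the origin, enough for a vanishing derivative there. *)
Lemma flat_le m t : flat m t <= (m.+2)`!%:R * t ^+ 2.
Proof.
rewrite /flat; case: ifPn => t0; last by rewrite mulr_ge0 ?sqr_ge0.
have s0 : 0 < t^-1 by rewrite invr_gt0.
rewrite expRN ler_pdivrMr ?expR_gt0 //.
rewrite -(@ler_pM2r _ (t^-1 ^+ 2)) ?exprn_gt0 //.
have -> : (m.+2)`!%:R * t ^+ 2 * expR t^-1 * t^-1 ^+ 2 = (m.+2)`!%:R * expR t^-1.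
  by field; rewrite gt_eqF.
rewrite -exprD addn2 mulrC -ler_pdivrMr ?ltr0n ?fact_gt0 //.
by apply: le_trans (expR_ge1Dxn m.+1 (ltW s0)); rewrite lerDr.
Qed.

Lemma is_derive_flat m t :
  is_derive t 1 (flat m) (flat m.+2 t - m%:R * flat m.+1 t).
Proof.
have [t0|t0|<-] := ltgtP 0 t.
- apply: (@near_eq_is_derive R R R (fun u : R => u^-1 ^+ m * expR (- u^-1))).
    near=> u; rewrite /flat ifT //; near: u.
    exact: lt_nbhsr.
  have tn0 : t != 0 by rewrite gt_eqF.
  have h1 : is_derive t 1 (fun u : R => u^-1) (- t ^- 2 *: 1) by exact: (is_deriveV tn0).
  have h2 : is_derive t 1 (fun u : R => - u^-1) (- (- t ^- 2 *: 1)) by exact: is_deriveN.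
  have h3 := @is_derive1_comp R expR (fun u => - u^-1) t _ _ (is_derive_expR (- t^-1)) h2.
  have h4 := is_deriveX m h1.
  have h5 := is_deriveM h4 h3.
  have -> : (fun u : R => u^-1 ^+ m * expR (- u^-1)) =
      (fun u : R => u^-1) ^+ m * (expR \o (fun u : R => - u^-1)).
    by apply/funext => u; rewrite fctE exprfctE.
  apply: (is_derive_eq h5).
  rewrite /flat t0 /GRing.scale /= !mulr1.
  have -> : t ^- 2 = t^-1 ^+ 2 by rewrite exprVn.
  have -> : ((fun u : R => u^-1) ^+ m) t = t^-1 ^+ m by rewrite exprfctE.
  case: m {h4 h5} => [|m]; first by rewrite !expr0; ring.
  by rewrite /= (exprS _ m) (exprS _ m.+2) (exprS _ m.+1) (exprS _ m); ring.
- have -> : flat m.+2 t - m%:R * flat m.+1 t = 0.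
    by rewrite /flat !ltNge ltW //= mulr0 subr0.
  apply: (@near_eq_is_derive R R R (cst (0 : R))).
    near=> u; rewrite /flat ifF //; apply/negbTE; rewrite -leNgt; near: u.
    by apply: filterS (lt_nbhsl t0) => u; exact: ltW.
- have -> : flat m.+2 0 - m%:R * flat m.+1 0 = 0 :> R.
    by rewrite /flat ltxx mulr0 subr0.
  (* At the origin the quadratic bound makes the difference quotient of order [|h|]. *)
  have cv : (h^-1 *: ((flat m \o shift 0) (h *: 1) - flat m 0)) @[h --> 0^'] --> (0 : R).
    apply/cvgrPdist_le => /= e e0.
    have C0 : 0 < (m.+2)`!%:R + 1 :> R by rewrite ltr_wpDl.
    near=> h.
    have hn0 : h != 0 by near: h; exact: nbhs_dnbhs_neq.
    rewrite sub0r normrN /shift /= addr0 [_ *: 1]mulr1 {2}/flat ltxx subr0.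
    rewrite normrM normfV ger0_norm ?flat_ge0 // mulrC ler_pdivrMr ?normr_gt0 //.
    apply: le_trans (flat_le _ _) _.
    rewrite -[h ^+ 2]real_normK ?num_real // expr2 mulrA ler_wpM2r //.
    apply: (@le_trans _ _ (((m.+2)`!%:R + 1) * `|h|)).
      by rewrite ler_wpM2r // lerDl.
    rewrite mulrC -ler_pdivlMr //.
    near: h; apply: dnbhs0_le; exact: divr_gt0.
  by apply: DeriveDef; [apply/cvg_ex; exists 0|exact: cvg_lim].
Unshelve. all: by end_near. Qed.

Lemma differentiable_flat m t : differentiable (flat m) t.
Proof. by apply/derivable1_diffP; have [] := is_derive_flat m t. Qed.

Lemma flat0_le1 t : flat 0 t <= 1.
Proof.
rewrite /flat; case: ifPn => // t0.
by rewrite expr0 mul1r -expR0 ler_expR oppr_le0 invr_ge0 ltW.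
Qed.

Lemma flat0_cvg1 t : 0 < t -> flat 0 (m.+1%:R * t) @[m --> \oo] --> (1 : R).
Proof.
move=> t0.
have -> : (fun m => flat 0 (m.+1%:R * t)) = (fun m => expR (- (t^-1 * m.+1%:R^-1))).
  apply/funext => m; rewrite /flat ifT ?mulr_gt0 ?ltr0n //.
  by rewrite expr0 mul1r invfM mulrC.
have h1 : t^-1 * m.+1%:R^-1 @[m --> \oo] --> t^-1 * (0 : R).
  by have := @cvgMl_tmp R _ \oo _ _ t^-1 0 (@cvg_harmonic R); exact.
have := @continuous_cvg _ _ _ \oo _ _ expR (- (t^-1 * 0)) (@continuous_expR R _) (cvgN h1).
by rewrite mulr0 oppr0 expR0; exact.
Qed.

End flat.

Section flat_algebra.
Context {R : realType} {n : nat}.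
Implicit Types (f g : 'rV[R]_n -> R).

(* An algebra of functions that is stable under partial derivatives and
   contains the bump functions below. *)
Inductive flat_algebra : ('rV[R]_n -> R) -> Prop :=
| flat_algebra_flat m (j : 'I_n) (a b : R) :
    flat_algebra (fun x => flat m (a * x 0 j + b))
| flat_algebra_cst (c : R) : flat_algebra (cst c)
| flat_algebraD f g : flat_algebra f -> flat_algebra g -> flat_algebra (f + g)
| flat_algebraM f g : flat_algebra f -> flat_algebra g -> flat_algebra (f * g).

Lemma differentiable_affine_coord (j : 'I_n) (a b : R) (x : 'rV[R]_n) :
  differentiable (fun y : 'rV[R]_n => a * y 0 j + b) x.
Proof.
apply: (@differentiableD _ _ _ (fun y : 'rV[R]_n => a * y 0 j) (cst b)) => //.
by apply: (@differentiableM _ _ (cst a) (fun y : 'rV[R]_n => y 0 j)) => //;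
  exact: differentiable_coord.
Qed.

Lemma flat_algebra_differentiable f : flat_algebra f ->
  forall x, differentiable f x.
Proof.
elim=> {f} [m j a b|c|f g _ df _ dg|f g _ df _ dg] x.
- apply: (@differentiable_comp _ _ _ _ (fun y : 'rV[R]_n => a * y 0 j + b) (flat m)).
    exact: differentiable_affine_coord.
  exact: differentiable_flat.
- exact: differentiable_cst.
- exact: differentiableD.
- exact: differentiableM.
Qed.

Lemma partialD i f g x : differentiable f x -> differentiable g x ->
  partial i (f + g) x = partial i f x + partial i g x.
Proof. by move=> df dg; rewrite /partial deriveD //; exact: diff_derivable. Qed.

Lemma partialM i f g x : differentiable f x -> differentiable g x ->
  partial i (f * g) x = f x * partial i g x + g x * partial i f x.
Proof. by move=> df dg; rewrite /partial deriveM //; exact: diff_derivable. Qed.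

Lemma partial_cst i (c : R) x : partial i (cst c : 'rV[R]_n -> R) x = 0.
Proof. by rewrite /partial derive_cst. Qed.

Lemma partialZ i (c : R) f x : differentiable f x ->
  partial i (fun y => c * f y) x = c * partial i f x.
Proof.
move=> df; rewrite (_ : (fun y => _) = (cst c : 'rV[R]_n -> R) * f) //.
by rewrite partialM //= partial_cst mulr0 addr0.
Qed.

Lemma partial_coord (i j : 'I_n) (x : 'rV[R]_n) :
  partial i (fun y : 'rV[R]_n => y 0 j) x = (i == j)%:R.
Proof.
rewrite /partial /derive; apply: cvg_lim => //.
apply: (@cvg_trans _ (cst ((i == j)%:R : R) @ 0^')); last exact: cvg_cst.
apply: near_eq_cvg; near=> h.
have hn0 : h != 0 by near: h; exact: nbhs_dnbhs_neq.
rewrite /= !mxE addrK /GRing.scale /= mulrA mulVf // mul1r.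
by rewrite eq_sym.
Unshelve. all: by end_near. Qed.

Lemma partial_flat_comp (i j : 'I_n) (a b : R) m (x : 'rV[R]_n) :
  partial i (fun y => flat m (a * y 0 j + b)) x =
  a * (i == j)%:R * (flat m.+2 (a * x 0 j + b) - m%:R * flat m.+1 (a * x 0 j + b)).
Proof.
pose l := fun y : 'rV[R]_n => a * y 0 j + b.
have dl : differentiable l x by exact: differentiable_affine_coord.
have df : differentiable (flat m) (l x) by exact: differentiable_flat.
have -> : (fun y : 'rV[R]_n => flat m (a * y 0 j + b)) = flat m \o l by [].
rewrite /partial deriveE; last exact: differentiable_comp.
rewrite diff_comp //= diff1E // derive1E (@derive_val _ _ _ _ _ _ _ (is_derive_flat m _)).
rewrite /GRing.scale /= -deriveE //; congr (_ * _).
have -> : l = (fun y : 'rV[R]_n => a * y 0 j) + cst b by [].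
rewrite -/(partial i _ x) partialD //; last first.
  by apply: (@differentiableM _ _ (cst a) (fun y : 'rV[R]_n => y 0 j)) => //;
    exact: differentiable_coord.
rewrite partial_cst addr0 partialZ ?partial_coord //; exact: differentiable_coord.
Qed.

Lemma flat_algebra_partial i f : flat_algebra f -> flat_algebra (partial i f).
Proof.
elim=> {f} [m j a b|c|f g hf pf hg pg|f g hf pf hg pg].
- have -> : partial i (fun x => flat m (a * x 0 j + b)) =
      cst (a * (i == j)%:R) * ((fun x => flat m.+2 (a * x 0 j + b)) +
      cst (- m%:R) * (fun x => flat m.+1 (a * x 0 j + b))).
    by apply/funext => x; rewrite partial_flat_comp !fctE mulNr.
  do ?[apply: flat_algebraM|apply: flat_algebraD|exact: flat_algebra_cst|exact: flat_algebra_flat].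
- have -> : partial i (cst c) = cst 0 by apply/funext => x; exact: partial_cst.
  exact: flat_algebra_cst.
- have -> : partial i (f + g) = partial i f + partial i g.
    by apply/funext => x; rewrite partialD //; exact: flat_algebra_differentiable.
  exact: flat_algebraD.
- have -> : partial i (f * g) = f * partial i g + g * partial i f.
    by apply/funext => x; rewrite partialM //; exact: flat_algebra_differentiable.
  by apply: flat_algebraD; exact: flat_algebraM.
Qed.

Lemma flat_algebra_smooth f : flat_algebra f -> smooth f.
Proof.
move=> hf s x; apply: flat_algebra_differentiable.
by elim: s => //= i s; exact: flat_algebra_partial.
Qed.

(** Smooth functions with values in [0, 1] that vanish off [obox l r] and converge pointwise to its
    indicator as [m] grows. *)
Definition bump (l r : 'rV[R]_n) m (x : 'rV[R]_n) : R :=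
  \prod_i (flat 0 (m.+1%:R * (x 0 i - l 0 i)) *
           flat 0 (m.+1%:R * (r 0 i - x 0 i))).

Lemma bump_smooth l r m : smooth (bump l r m).
Proof.
apply: flat_algebra_smooth; pose F (i : 'I_n) (x : 'rV[R]_n) : R :=
  flat 0 (m.+1%:R * (x 0 i - l 0 i)) * flat 0 (m.+1%:R * (r 0 i - x 0 i)).
have -> : bump l r m = \prod_i F i.
  apply/funext => x; apply/esym.
  exact: (@big_morph _ _ (fun f : 'rV[R]_n -> R => f x) 1 *%R 1 *%R).
elim/big_ind : _ => [|f g|i _]; [exact: (flat_algebra_cst 1)|exact: flat_algebraM|].
have -> : F i = (fun x => flat 0 (m.+1%:R * x 0 i + - (m.+1%:R * l 0 i))) *
    (fun x => flat 0 (- m.+1%:R * x 0 i + m.+1%:R * r 0 i)).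
  by apply/funext => x; rewrite /F !fctE !mulrBr mulNr (addrC (- _)).
by apply: flat_algebraM; exact: flat_algebra_flat.
Qed.

Lemma bump_ge0 l r m x : 0 <= bump l r m x.
Proof. by apply: prodr_ge0 => i _; rewrite mulr_ge0 // flat_ge0. Qed.

Lemma bump_le1 l r m x : bump l r m x <= 1.
Proof.
apply: prodr_ile1 => i _; rewrite mulr_ge0 ?flat_ge0 //=.
by rewrite mulr_ile1 // ?flat_ge0 // flat0_le1.
Qed.

Lemma bump_eq0 l r m x : ~ obox l r x -> bump l r m x = 0.
Proof.
move=> /existsNP[i /negP]; rewrite negb_and -!leNgt => lxr.
rewrite /bump (bigD1 i) //=; apply/eqP; rewrite !mulf_eq0; apply/orP; left.
apply/orP; case/orP: lxr => h; [left|right];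
  by rewrite flat_le0 // pmulr_rle0 ?ltr0n // subr_le0.
Qed.

Lemma bump_cvg l r x : obox l r x -> bump l r m x @[m --> \oo] --> (1 : R).
Proof.
move=> lxr; have -> : 1 = \prod_(i < n) 1 :> R by rewrite big1.
apply: cvg_big => [|i _]; first exact: mul_continuous.
have /andP[lx xr] := lxr i.
rewrite -[X in _ --> X]mulr1; apply: cvgM.
  by apply: flat0_cvg1; rewrite subr_gt0.
by apply: flat0_cvg1; rewrite subr_gt0.
Qed.

End flat_algebra.

(** * Fubini and integrals of derivatives of compactly supported functions *)

Section cons_rV_calculus.
Context {R : realType} {n : nat}.
Implicit Types (x : R) (y : 'rV[R]_n) (u : 'rV[R]_n.+1 -> R).

Lemma cons_rVS x y (h : R) :
  cons_rV (h + x, y) = h *: delta_mx 0 0 + cons_rV (x, y).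
Proof.
apply/rowP => i; rewrite !mxE /=; case: (unliftP ord0 i) => [j|] -> /=.
  by rewrite mulr0 add0r.
by rewrite mulr1.
Qed.

Lemma cons_rV_delta x y (h : R) j :
  cons_rV (x, h *: delta_mx 0 j + y) = h *: delta_mx 0 (lift ord0 j) + cons_rV (x, y).
Proof.
apply/rowP => i; rewrite !mxE /=; case: (unliftP ord0 i) => [k|] -> /=.
  by rewrite !mxE (inj_eq lift_inj).
by rewrite mulr0 add0r.
Qed.

Lemma continuous_cons_rVl y : continuous (fun x : R => cons_rV (x, y)).
Proof.
move=> x A /nbhs_ballP[e /= e0 eA]; apply/nbhs_ballP; exists e => //= z xz.
apply: eA; split=> // i j; rewrite (ord1 i) !mxE.
by case: (unliftP ord0 j) => [k _|_] //=; exact: ballxx.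
Qed.

Lemma continuous_cons_rVr x : continuous (fun y : 'rV[R]_n => cons_rV (x, y)).
Proof.
move=> y A /nbhs_ballP[e /= e0 eA]; apply/nbhs_ballP; exists e => //= z [_ yz].
apply: eA; split=> // i j; rewrite (ord1 i) !mxE.
by case: (unliftP ord0 j) => [k _|_] //=; exact: ballxx.
Qed.

(** The two difference quotients are the same function of the increment, so no differentiability is
    involved. *)
Lemma derive_cons_rVl u x y :
  derive (fun z : R => u (cons_rV (z, y))) x 1 = partial ord0 u (cons_rV (x, y)).
Proof.
rewrite /partial /derive; apply: (congr1 (fun F : R -> R => lim (F @ 0^')));
  apply/funext => h /=.
by rewrite [h *: 1]mulr1 cons_rVS.
Qed.

Lemma derivable_cons_rVl u x y : derivable u (cons_rV (x, y)) (delta_mx 0 0) ->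
  derivable (fun z : R => u (cons_rV (z, y))) x 1.
Proof.
rewrite /derivable => H; match type of H with cvg (?F @ _) => set A := F in H end.
match goal with |- cvg (?F @ _) => have -> : F = A end; last exact: H.
apply/funext => h; rewrite /A /=.
by rewrite [h *: 1]mulr1 cons_rVS.
Qed.

Lemma partial_cons_rVr u x y j :
  partial j (fun z => u (cons_rV (x, z))) y = partial (lift ord0 j) u (cons_rV (x, y)).
Proof.
rewrite /partial /derive; apply: (congr1 (fun F : R -> R => lim (F @ 0^')));
  apply/funext => h /=.
by rewrite cons_rV_delta.
Qed.

Lemma derivable_cons_rVr u x y j :
  derivable u (cons_rV (x, y)) (delta_mx 0 (lift ord0 j)) ->
  derivable (fun z => u (cons_rV (x, z))) y (delta_mx 0 j).
Proof.
rewrite /derivable => H; match type of H with cvg (?F @ _) => set A := F in H end.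
match goal with |- cvg (?F @ _) => have -> : F = A end; last exact: H.
apply/funext => h; rewrite /A /=.
by rewrite cons_rV_delta.
Qed.

End cons_rV_calculus.

Lemma integrable_bounded d (T : measurableType d) (R : realType)
    (mu : {measure set T -> \bar R}) (f : T -> R) (D A : set T) (B : R) :
  measurable D -> measurable A -> A `<=` D -> (mu A < +oo)%E ->
  measurable_fun D f ->
  (forall x, A x -> `|f x| <= B) -> (forall x, D x -> ~ A x -> f x = 0) ->
  mu.-integrable D (EFin \o f).
Proof.
move=> mD mA AD Aoo mf fB f0.
apply: (@eq_integrable _ _ _ mu D mD ((EFin \o f) \_ A)).
  move=> x /[!inE] Dx; rewrite patchE /=; case: ifPn => // /negP.
  by rewrite inE => /(f0 _ Dx) ->.
apply/(integrable_restrict mu mA mD); rewrite setIidr //.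
apply: measurable_bounded_integrable => //; first exact: measurable_funS mf.
exists B; split; first exact: num_real.
by move=> M BM x Ax; apply: le_trans (fB x Ax) (ltW BM).
Qed.

Section compact_support.
Context {R : realType} {n : nat}.
Implicit Types (f u : 'rV[R]_n -> R) (C : set 'rV[R]_n).

Lemma partial_eq0 i u C x : closed C -> (forall y, ~ C y -> u y = 0) -> ~ C x ->
  partial i u x = 0.
Proof.
move=> cC u0 nCx; rewrite -(partial_cst i 0 x) /partial.
apply: near_eq_derive.
have := closed_openC cC; rewrite openE => /(_ x nCx).
by apply: filterS => y /u0.
Qed.

Lemma continuous_bounded_on f C : compact C -> continuous f ->
  exists B : R, forall x, C x -> `|f x| <= B.
Proof.
move=> cC cf.
have /compact_bounded[B [_ Bf]] : compact (f @` C).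
  by apply: continuous_compact => //; exact: continuous_subspaceT.
exists (B + 1) => x Cx; apply: Bf; first by rewrite ltrDl.
by exists x.
Qed.

End compact_support.

(** The measure is by construction the image of a product measure under [cons_rV]. Both orders of
    integration are kept, as the variable of differentiation may be the first one or a later one. *)
Lemma lebesgue_rV_fubini (R : realType) n (f : 'rV[R]_n.+1 -> R) :
  measurable_fun setT f ->
  (lebesgue_rV n.+1).-integrable setT (EFin \o f) ->
  (\int[lebesgue_rV n.+1]_x (f x)%:E =
     \int[lebesgue_measure]_x \int[lebesgue_rV n]_y (f (cons_rV (x, y)))%:E)%E /\
  (\int[lebesgue_rV n.+1]_x (f x)%:E =
     \int[lebesgue_rV n]_y \int[lebesgue_measure]_x (f (cons_rV (x, y)))%:E)%E.
Proof.
move=> mf intf.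
have mfE : measurable_fun [set: 'rV[R]_n.+1] (fun x => (f x)%:E) by exact/measurable_EFinP.
pose mu : {measure set (measurableTypeR R * 'rV[R]_n) -> \bar R} :=
  (@lebesgue_measure R \x lebesgue_rV n)%E.
have mfc : measurable_fun setT ((EFin \o f) \o @cons_rV R n).
  by apply: measurableT_comp => //; exact: measurable_cons_rV.
have intfc : mu.-integrable setT ((EFin \o f) \o @cons_rV R n).
  apply/integrableP; split=> //.
  move/integrableP : intf => [_]; apply: le_lt_trans.
  have := @ge0_integral_pushforward _ _ _ _ _ _ (@measurable_cons_rV R n) mu setT
    (fun y => `|(f y)%:E|%E) measurableT.
  rewrite preimage_setT => <- //.
  by apply: measurableT_comp.
have -> : (\int[lebesgue_rV n.+1]_x (f x)%:E =
    \int[mu]_z ((EFin \o f) \o @cons_rV R n) z)%E.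
  have := @integral_pushforward _ _ _ _ _ _ (@measurable_cons_rV R n) mu setT
    (EFin \o f) mfE.
  by rewrite preimage_setT; apply.
split; first by rewrite -integral12_prod_meas1.
by rewrite -integral21_prod_meas1.
Qed.

Lemma integrable_continuous_support (R : realType) n (f : 'rV[R]_n -> R) l r :
  continuous f -> (forall x, ~ cbox l r x -> f x = 0) ->
  (lebesgue_rV n).-integrable setT (EFin \o f).
Proof.
move=> cf f0.
have [B fB] := continuous_bounded_on (@compact_cbox R n l r) cf.
apply: (@integrable_bounded _ _ _ _ _ _ (cbox l r) B) => //.
- exact: measurable_cbox.
- exact: lebesgue_rV_cbox_lty.
- exact: continuous_measurable_rV.
- by move=> x _; exact: f0.
Qed.

Lemma integral_derive_compact_support (R : realType) (h h' : R -> R) (M : R) :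
  (forall x, derivable h x 1) -> (forall x, 'D_1 h x = h' x) -> continuous h' ->
  (forall x, M < `|x| -> h x = 0) -> (forall x, M < `|x| -> h' x = 0) ->
  (\int[lebesgue_measure]_x (h' x)%:E = 0)%E.
Proof.
move=> dh hE ch' h0 h'0.
(* Larger than [M] and positive, whatever the sign of [M]. *)
pose N : R := `|M| + 1.
have MN : M < N by rewrite /N (le_lt_trans (ler_norm _)) // ltrDl.
have N0 : 0 < N by rewrite ltr_wpDl.
pose J : set R := `[- N, N]%classic.
have h'N (x : R) : ~ J x -> h' x = 0.
  move=> /= /negP; rewrite in_itv /= -ler_norml -ltNge => /(lt_trans MN) /h'0 //.
have -> : (\int[lebesgue_measure]_x (h' x)%:E =
    \int[lebesgue_measure]_(x in J) (h' x)%:E)%E.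
  rewrite [RHS]integral_mkcond; apply: eq_integral => x _; rewrite patchE.
  by case: ifPn => // /negP; rewrite inE => /h'N ->.
have ch : continuous h.
  move=> x; apply/differentiable_continuous/derivable1_diffP; exact: dh.
rewrite /J (@continuous_FTC2 _ h' h) //.
- by rewrite !h0 ?subee // ?normrN ger0_norm // ltW.
- by rewrite gtrN.
- exact: continuous_subspaceT.
- split; first by move=> x _; exact: dh.
  + by apply: cvg_at_right_filter; exact: ch.
  + by apply: cvg_at_left_filter; exact: ch.
- by move=> x _; rewrite derive1E.
Qed.

(** For the first variable, integrate it innermost and use the fundamental theorem of calculus on a
    large interval; for a later one, integrate the first variable outermost and apply the induction
    hypothesis to the slices. *)
Lemma integral_partial_compact_support (R : realType) n (i : 'I_n)
    (u : 'rV[R]_n -> R) (M : R) :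
  (forall x, derivable u x (delta_mx 0 i)) -> continuous (partial i u) ->
  (forall x, ~ cbox (const_mx (- M)) (const_mx M) x -> u x = 0) ->
  (\int[lebesgue_rV n]_x (partial i u x)%:E = 0)%E.
Proof.
elim: n i u => [[]//|n IHn] i u du cdu u0.
have du0 x : ~ cbox (const_mx (- M)) (const_mx M) x -> partial i u x = 0.
  by apply: partial_eq0; [exact: closed_cbox|].
have intdu := integrable_continuous_support cdu du0.
have [F1 F2] := lebesgue_rV_fubini (continuous_measurable_rV cdu) intdu.
have nbox x (y : 'rV[R]_n) : M < `|x| -> ~ cbox (const_mx (- M)) (const_mx M) (cons_rV (x, y)).
  move=> Mx /(_ ord0); rewrite !mxE unlift_none /= -ler_norml.
  by rewrite leNgt Mx.
have nboxr x (y : 'rV[R]_n) : ~ cbox (const_mx (- M)) (const_mx M) y ->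
    ~ cbox (const_mx (- M)) (const_mx M) (cons_rV (x, y)).
  move=> ny nxy; apply: ny => j; have := nxy (lift ord0 j).
  by rewrite !mxE liftK.
case: (unliftP ord0 i) => [j ij|i0]; last first.
  rewrite F2 integral0_eq // => y _.
  apply: (@integral_derive_compact_support _ (fun x => u (cons_rV (x, y))) _ M).
  - by move=> x; apply: derivable_cons_rVl; have := du (cons_rV (x, y)); rewrite i0.
  - by move=> x; rewrite derive_cons_rVl i0.
  - by move=> x; apply: (continuous_comp (@continuous_cons_rVl R n y x)); exact: cdu.
  - by move=> x /(nbox _ y) /u0.
  - by move=> x /(nbox _ y) /du0.
rewrite F1 integral0_eq // => x _.
have -> : (fun y => (partial i u (cons_rV (x, y)))%:E) =
    (fun y => (partial j (fun z => u (cons_rV (x, z))) y)%:E).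
  by apply/funext => y; rewrite partial_cons_rVr ij.
apply: IHn.
- by move=> y; apply: derivable_cons_rVr; rewrite -ij; exact: du.
- have -> : partial j (fun z => u (cons_rV (x, z))) = partial i u \o (fun z => cons_rV (x, z)).
    by apply/funext => y; rewrite partial_cons_rVr ij.
  by move=> y; apply: (continuous_comp (@continuous_cons_rVr R n x y)); exact: cdu.
- by move=> y /(nboxr x)/u0.
Qed.

(** * From integrals over boxes to equality almost everywhere *)

Section oboxes.
Context {R : realType} {n : nat}.
Implicit Types (A U : set 'rV[R]_n).

Definition oboxes : set (set 'rV[R]_n) :=
  [set A | exists l r, A = obox l r].

(** The inclusion of closed boxes keeps the intersection admissible whenever the first closed box
    lies in an open set of interest. *)
Lemma obox_setI (l r l' r' : 'rV[R]_n) : exists l'' r'',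
  obox l r `&` obox l' r' = obox l'' r'' /\ cbox l'' r'' `<=` cbox l r.
Proof.
exists (\row_i Num.max (l 0 i) (l' 0 i)), (\row_i Num.min (r 0 i) (r' 0 i)).
split; last first.
  move=> x xlr i; have := xlr i; rewrite !mxE ge_max le_min.
  by move=> /andP[/andP[-> _] /andP[-> _]].
apply/seteqP; split=> x.
  move=> [xlr xlr'] i; have := xlr i; have := xlr' i; rewrite !mxE.
  by rewrite gt_max lt_min => /andP[-> ->] /andP[-> ->].
move=> xlr; split=> i; have := xlr i; rewrite !mxE gt_max lt_min.
  by move=> /andP[/andP[-> _] /andP[-> _]].
by move=> /andP[/andP[_ ->] /andP[_ ->]].
Qed.

Lemma oboxes_setI : setI_closed oboxes.
Proof.
move=> _ _ [l [r ->]] [l' [r' ->]].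
by have [l'' [r'' [-> _]]] := obox_setI l r l' r'; exists l'', r''.
Qed.

Lemma bigcup_oboxes : \bigcup_k obox (const_mx (- k%:R)) (const_mx k%:R) =
  [set: 'rV[R]_n].
Proof.
apply/seteqP; split=> // x _; exists (Num.truncn `|x|).+1 => // i.
rewrite !mxE -ltr_norml; apply: le_lt_trans (truncnS_gt `|x|).
rewrite [leRHS]/Num.Def.normr /= mx_normrE.
exact: (le_trans _ (le_bigmax _ _ (0, i))).
Qed.

(** It suffices to reach preimages of open intervals under one coordinate: such a slab is the union
    of boxes that grow in the other directions. *)
Lemma measurable_oboxes A : measurable A -> <<s oboxes >> A.
Proof.
move: A; apply: smallest_sub; first exact: smallest_sigma_algebra.
rewrite -bigcup_seq /= => A [i _ [B mB <-]]; rewrite setTI.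
have sB : sigma_algebra setT [set B : set R | <<s oboxes >> ((fun x : 'rV[R]_n => x 0 i) @^-1` B)].
  split.
  - by rewrite /= preimage_set0; exact: sigma_algebra0.
  - move=> C mC /=; rewrite setTD preimage_setC -setTD.
    exact: sigma_algebraCD.
  - by move=> F mF /=; rewrite preimage_bigcup; exact: sigma_algebra_bigcup.
have : (@ocitv R).-sigma.-measurable B by exact: mB.
rewrite RGenOpens.measurableE; move: (B).
apply: smallest_sub => // _ [a [b ->]] /=.
rewrite (_ : _ @^-1` _ = \bigcup_k obox (\row_j (if j == i then a else - k%:R))
    (\row_j (if j == i then b else k%:R))).
  apply: sigma_algebra_bigcup => k; apply: sub_sigma_algebra.
  by eexists; eexists.
apply/seteqP; split=> [x /=|x [k _ /(_ i)]]; last by rewrite !mxE eqxx /= in_itv.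
rewrite in_itv /= => xab.
have : [set: 'rV[R]_n] x by [].
rewrite -bigcup_oboxes => -[k _ xk]; exists k => // j; rewrite !mxE.
by case: eqP => [->//|_]; have := xk j; rewrite !mxE.
Qed.

End oboxes.

(** The sets over which [g] has integral 0 form a Dynkin system, so they include all measurable
    sets; the sets where [g] is nonnegative and negative then show that [|g|] has integral 0. *)
Lemma ae_eq0_pi_system d (T : measurableType d) (R : realType)
    (mu : {measure set T -> \bar R}) (H : set (set T)) (Q : set T) (g : T -> R) :
  setI_closed H -> H `<=` measurable -> measurable `<=` <<s H >> -> measurable Q ->
  mu.-integrable Q (EFin \o g) ->
  (forall A, H A -> (\int[mu]_(x in A `&` Q) (g x)%:E = 0)%E) ->
  (\int[mu]_(x in Q) (g x)%:E = 0)%E ->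
  ae_eq mu Q (EFin \o g) (cst 0%E).
Proof.
move=> HI Hm mH mQ ig H0 Q0.
have mg : measurable_fun Q (fun x => (g x)%:E) by exact: (measurable_int mu).
have mgE : measurable_fun Q g by exact/measurable_EFinP.
have igA A : measurable A -> mu.-integrable (A `&` Q) (EFin \o g).
  by move=> mA; apply: (integrableS mQ) => //; exact: measurableI.
have allA A : measurable A -> (\int[mu]_(x in A `&` Q) (g x)%:E = 0)%E.
  move=> mA; pose D := [set A | measurable A /\ (\int[mu]_(x in A `&` Q) (g x)%:E = 0)%E].
  suff : <<s H >> `<=` D by move=> /(_ A (mH _ mA))[].
  apply: lambda_system_subset => //; last first.
  - by move=> B HB; split; [exact: Hm|exact: H0].
  apply/dynkin_lambda_system; split.
  - by split; [exact: measurableT|rewrite setTI].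
  - move=> B [mB B0]; split; first exact: measurableC.
    have : (\int[mu]_(x in Q) (g x)%:E = \int[mu]_(x in B `&` Q) (g x)%:E +
        \int[mu]_(x in ~` B `&` Q) (g x)%:E)%E.
      rewrite -integral_setU.
      + by rewrite -setIUl setUv setTI.
      + exact: measurableI.
      + by apply: measurableI => //; exact: measurableC.
      + by rewrite -setIUl setUv setTI.
      + by rewrite disj_set2E; apply/eqP; rewrite setIACA setICr set0I.
    by rewrite B0 Q0 add0e.
  - move=> F tF DF; split; first by apply: bigcupT_measurable => k; case: (DF k).
    rewrite setI_bigcupl integral_bigcup //.
    + by rewrite eseries0 // => k _ _; case: (DF k).
    + exact: trivIset_setIr.
    + by move=> k; apply: measurableI => //; case: (DF k).
    + rewrite -setI_bigcupl; apply: igA.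
      by apply: bigcupT_measurable => k; case: (DF k).
apply/(ae_eq_integral_abs mu mQ mg).
pose P := Q `&` g @^-1` [set y | 0 <= y]; pose N := Q `&` g @^-1` [set y | y < 0].
have mP : measurable P.
  apply: mgE => //; rewrite (_ : [set y | _] = `[0, +oo[%classic) //.
  by apply/seteqP; split=> y /=; rewrite in_itv /= andbT.
have mN : measurable N.
  apply: mgE => //; rewrite (_ : [set y | _] = `]-oo, 0[%classic) //.
have QPN : P `|` N = Q.
  apply/seteqP; split=> [x [[]|[]]|x Qx] //.
  by case: (leP 0 (g x)) => gx; [left|right].
rewrite -QPN ge0_integral_setU //.
- have -> : (\int[mu]_(x in P) `|(g x)%:E| = \int[mu]_(x in P) (g x)%:E)%E.
    by apply: eq_integral => x /[!inE] -[_ /= gx]; rewrite ger0_norm.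
  have -> : (\int[mu]_(x in N) `|(g x)%:E| = \int[mu]_(x in N) - (g x)%:E)%E.
    by apply: eq_integral => x /[!inE] -[_ /= gx]; rewrite ltr0_norm.
  have -> : (\int[mu]_(x in N) - (g x)%:E = \int[mu]_(x in N) ((-1)%:E * (g x)%:E))%E.
    by apply: eq_integral => x _; rewrite EFinN mulN1e.
  rewrite integralZl //; last by apply: (integrableS mQ mN) => // x [].
  rewrite -(@setIidl _ P Q); last by move=> x [].
  rewrite -(@setIidl _ N Q); last by move=> x [].
  by rewrite !allA // mule0 adde0.
- by rewrite QPN; apply: measurableT_comp.
- by rewrite disj_set2E; apply/eqP; rewrite -subset0 => x [[_ /=] gx [_ /=]]; rewrite ltNge gx.
Qed.

Section fundamental_lemma.
Context {R : realType} {n : nat}.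
Implicit Types (Omega U : set 'rV[R]_n) (g : 'rV[R]_n -> R).

(** Bump functions converge to indicators of boxes, so by dominated convergence [g] has integral 0
    over every box with closure in [U]. Such boxes inside a fixed one suffice for the Dynkin
    argument, and countably many cover [U]. *)
Lemma ae_eq0_of_test_functions Omega U g : measurable Omega -> open U ->
  U `<=` Omega -> (lebesgue_rV n).-integrable Omega (EFin \o g) ->
  (forall phi C, smooth phi -> compact C -> C `<=` U ->
    (forall x, ~ C x -> phi x = 0) ->
    (\int[lebesgue_rV n]_(x in Omega) (phi x * g x)%:E = 0)%E) ->
  ae_eq (lebesgue_rV n) U (EFin \o g) (cst 0%E).
Proof.
move=> mO oU UO ig g0.
have mg : measurable_fun Omega g by apply/measurable_EFinP;
  exact: (measurable_int (lebesgue_rV n)).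
have box0 l r : cbox l r `<=` U ->
    (\int[lebesgue_rV n]_(x in obox l r) (g x)%:E = 0)%E.
  move=> lrU.
  have lrO : obox l r `<=` Omega by move=> x /obox_sub_cbox/lrU/UO.
  have := @dominated_convergence _ _ _ (lebesgue_rV n) Omega mO
    (fun m x => (bump l r m x * g x)%:E) ((EFin \o g) \_ (obox l r)) (abse \o (EFin \o g)).
  case.
  - move=> m; apply/measurable_EFinP; apply: measurable_funM => //.
    apply: measurable_funTS; apply: continuous_measurable_rV => x.
    exact: (differentiable_continuous (@bump_smooth _ _ l r m [::] x)).
  - apply/(measurable_restrict _ (measurable_obox l r) mO).
    by apply/measurable_EFinP; apply: measurable_funS mg => // x [].
  - apply: aeW => x _; rewrite patchE; case: ifPn => [|/negP]; rewrite inE => xlr.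
      apply/fine_cvgP; split; first by near=> m.
      have := cvgMr_tmp (b := g x) (bump_cvg xlr).
      by rewrite mul1r; exact.
    apply: cvg_near_cst; near=> m.
    by rewrite bump_eq0 // mul0r.
  - exact: integrable_abse.
  - apply: aeW => x m _ /=; rewrite lee_fin normrM ger0_norm ?bump_ge0 //.
    by rewrite ler_piMl // bump_le1.
  move=> _ _; rewrite -integral_mkcondr setIidr // => h.
  apply: (cvg_unique _ h) => //.
  apply: cvg_near_cst; near=> m.
  apply: (g0 _ (cbox l r)) => //; [exact: bump_smooth|exact: compact_cbox|].
  by move=> x nx; rewrite bump_eq0 // => /obox_sub_cbox.
have [F UE FP] := open_box_cover oU.
suff Fk k : (lebesgue_rV n).-negligible [set x | F k x /\ g x <> 0].
  have := negligible_bigcup Fk; apply: negligibleS => x /not_implyP[].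
  by rewrite UE => -[k _ Fkx] /= gx; exists k => //; split=> // g0x; apply: gx; rewrite g0x.
case: (FP k) => [->|[l [r [lrU FkE]]]].
  by apply: negligibleS (negligible_set0 _) => x [].
have mF : measurable (F k) by rewrite FkE; exact: measurable_obox.
have FO : F k `<=` Omega by rewrite FkE => x /obox_sub_cbox/lrU/UO.
have : ae_eq (lebesgue_rV n) (F k) (EFin \o g) (cst 0%E).
  apply: (@ae_eq0_pi_system _ _ _ _ oboxes) => //.
  - exact: oboxes_setI.
  - by move=> _ [l' [r' ->]]; exact: measurable_obox.
  - exact: measurable_oboxes.
  - exact: integrableS ig.
  - move=> _ [l' [r' ->]]; rewrite FkE setIC.
    have [l'' [r'' [-> sub]]] := obox_setI l r l' r'.
    by apply: box0; exact: subset_trans lrU.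
  - by rewrite FkE; exact: box0.
apply: negligibleS => x [Fx gx] /= /(_ Fx) [].
exact: gx.
Unshelve. all: by end_near. Qed.

End fundamental_lemma.

(** * The weak codifferential *)

Section L2_forms.
Context {R : realType} {n : nat} (Omega : set 'rV[R]_n).
Hypothesis mOmega : measurable Omega.
Implicit Types (omega mu theta : dform R n).

Notation leb := (lebesgue_rV n).

Definition lincomb (c : R) omega mu : dform R n :=
  fun alpha x => c * omega alpha x + mu alpha x.

(** [|f g| <= f^2 + g^2], from the squares of [f + g] and [f - g]. *)
Lemma L2_form_mul omega mu alpha beta : L2_form Omega omega -> L2_form Omega mu ->
  leb.-integrable Omega (fun x => (omega alpha x * mu beta x)%:E).
Proof.
move=> Lo Lm; have [mo io] := Lo alpha; have [mm im] := Lm beta.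
apply: (le_integrable mOmega _ _ (integrableD mOmega io im)).
  by apply/measurable_EFinP; exact: measurable_funM.
move=> x _; rewrite lee_fin [leRHS]ger0_norm ?addr_ge0 ?sqr_ge0 //.
rewrite ler_norml; apply/andP; split.
  by have := sqr_ge0 (omega alpha x + mu beta x); nra.
by have := sqr_ge0 (omega alpha x - mu beta x); nra.
Qed.

Lemma L2_form_ip_integrable omega mu : L2_form Omega omega -> L2_form Omega mu ->
  leb.-integrable Omega (EFin \o (fun x => \sum_alpha omega alpha x * mu alpha x)).
Proof.
move=> Lo Lm.
apply: (@eq_integrable _ _ _ _ _ mOmega
  (fun x => \sum_alpha (omega alpha x * mu alpha x)%:E)%E).
  by move=> x _; rewrite /= sumEFin.
by apply: (integrable_sum mOmega) => alpha _; exact: L2_form_mul.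
Qed.

Lemma L2_form_lincomb c omega mu : L2_form Omega omega -> L2_form Omega mu ->
  L2_form Omega (lincomb c omega mu).
Proof.
move=> Lo Lm alpha; have [mo io] := Lo alpha; have [mm im] := Lm alpha.
have ml : measurable_fun Omega (lincomb c omega mu alpha).
  by apply: measurable_funD => //; apply: measurable_funM.
split=> //.
have i2 := integrableD mOmega (integrableZl mOmega (2 * c ^+ 2) io)
  (integrableZl mOmega 2 im).
apply: (le_integrable mOmega _ _ i2).
  by apply/measurable_EFinP; exact: measurable_funX.
move=> x _; rewrite lee_fin ger0_norm ?sqr_ge0 // (le_trans _ (ler_norm _)) //.
by rewrite /lincomb; have := sqr_ge0 (c * omega alpha x - mu alpha x); nra.
Qed.

Lemma L2_form0 : L2_form Omega (fun=> cst 0).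
Proof.
move=> alpha; split; first exact: measurable_cst.
by rewrite (_ : (fun x => _) = cst 0%E); [exact: integrable0|apply/funext => x;
  rewrite /= expr0n].
Qed.

Lemma L2_ipC omega mu : L2_ip Omega omega mu = L2_ip Omega mu omega.
Proof.
rewrite /L2_ip; apply: eq_Rintegral => x _.
by apply: eq_bigr => alpha _; rewrite mulrC.
Qed.

Lemma L2_ip_lincombl c omega mu theta :
  L2_form Omega omega -> L2_form Omega mu -> L2_form Omega theta ->
  L2_ip Omega (lincomb c omega mu) theta =
  c * L2_ip Omega omega theta + L2_ip Omega mu theta.
Proof.
move=> Lo Lm Lt; have iot := L2_form_ip_integrable Lo Lt.
have imt := L2_form_ip_integrable Lm Lt.
rewrite /L2_ip -RintegralZl // -RintegralD //; last first.
  exact: (integrableZl mOmega c iot).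
apply: eq_Rintegral => x _; rewrite mulr_sumr -big_split /=.
by apply: eq_bigr => alpha _; rewrite /lincomb mulrDl mulrA.
Qed.

Lemma L2_ip_lincombr c omega mu theta :
  L2_form Omega omega -> L2_form Omega mu -> L2_form Omega theta ->
  L2_ip Omega theta (lincomb c omega mu) =
  c * L2_ip Omega theta omega + L2_ip Omega theta mu.
Proof.
by move=> Lo Lm Lt; rewrite L2_ipC L2_ip_lincombl // !(L2_ipC theta).
Qed.

Lemma L2_ip_ge0 omega : 0 <= L2_ip Omega omega omega.
Proof.
apply: Rintegral_ge0 => x _; apply: sumr_ge0 => alpha _.
by rewrite -expr2 sqr_ge0.
Qed.

(** Parallelogram law: the right side exceeds the left by the square norm of
    [lincomb (- c) omega mu]. *)
Lemma L2_ip_lincomb_le c omega mu : L2_form Omega omega -> L2_form Omega mu ->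
  L2_ip Omega (lincomb c omega mu) (lincomb c omega mu) <=
  2 * c ^+ 2 * L2_ip Omega omega omega + 2 * L2_ip Omega mu mu.
Proof.
move=> Lo Lm; have Ll := L2_form_lincomb (- c) Lo Lm.
have := L2_ip_ge0 (lincomb (- c) omega mu).
rewrite !(L2_ip_lincombl, L2_ip_lincombr) //; last exact: L2_form_lincomb.
rewrite (L2_ipC mu omega).
move: (L2_ip _ _ _) (L2_ip _ _ _) (L2_ip _ _ _) => a b d h.
by rewrite -subr_ge0; apply: le_trans h _; rewrite le_eqVlt; apply/orP; left; apply/eqP; ring.
Qed.

Lemma L2_ip_ae omega theta theta' :
  L2_form Omega omega -> L2_form Omega theta -> L2_form Omega theta' ->
  (forall alpha, ae_eq leb Omega (EFin \o theta alpha) (EFin \o theta' alpha)) ->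
  L2_ip Omega omega theta = L2_ip Omega omega theta'.
Proof.
move=> Lo Lt Lt' tt'; rewrite /L2_ip /Rintegral; congr fine.
apply: ae_eq_integral => //.
- exact: (measurable_int leb (L2_form_ip_integrable Lo Lt)).
- exact: (measurable_int leb (L2_form_ip_integrable Lo Lt')).
have : \forall x \ae leb, forall alpha, Omega x -> (EFin \o theta alpha) x =
  (EFin \o theta' alpha) x.
  exact: (@filter_forall _ _ _ _ _ tt').
apply: filterS => x h Ox; rewrite /=; congr (_%:E); apply: eq_bigr => alpha _.
by have [->] := h alpha Ox.
Qed.

End L2_forms.

(** The classical codifferential of a differentiable form; the minus sign comes from integration by
    parts against [ext_d]. *)
Definition cdelta (R : realType) n (mu : dform R n) : dform R n := fun alpha x =>
  - \sum_(i | i \notin alpha) wedge_sign i alpha * partial i (mu (i |: alpha)) x.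

Section exchange.
Context {R : realType} {n : nat}.
Implicit Types (alpha beta : {set 'I_n}).

(** Removing [i] matches pairs of a set and one of its elements with pairs of a set and an index
    outside it. This is the combinatorial half of the adjointness of the differential and the
    codifferential. *)
Lemma exchange_add_remove (V : nmodType) (F : 'I_n -> {set 'I_n} -> {set 'I_n} -> V) :
  \sum_(beta : {set 'I_n}) \sum_(i in beta) F i beta (beta :\ i) =
  \sum_(alpha : {set 'I_n}) \sum_(i | i \notin alpha) F i (i |: alpha) alpha.
Proof.
rewrite (exchange_big_dep predT) //= [RHS](exchange_big_dep predT) //=.
apply: eq_bigr => i _.
rewrite (reindex_onto (fun alpha : {set 'I_n} => i |: alpha)
  (fun beta => beta :\ i)); last first.
  by move=> beta ib; rewrite finset.setD1K.
apply: eq_big => [alpha|alpha /andP[_ /eqP ->] //].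
rewrite finset.setU11 /=; apply/eqP/idP => [<-|ia]; first by rewrite !inE eqxx.
by rewrite finset.setU1K.
Qed.

Lemma wedge_signU1 i alpha : wedge_sign i (i |: alpha) = wedge_sign i alpha :> R.
Proof.
congr (_ ^+ _); apply: eq_card => j; rewrite !inE.
by case: eqVneq => [->|//]; rewrite ltnn !andbF.
Qed.

Lemma wedge_signD1 i alpha : wedge_sign i (alpha :\ i) = wedge_sign i alpha :> R.
Proof.
congr (_ ^+ _); apply: eq_card => j; rewrite !inE.
by case: eqVneq => [->|//]; rewrite ltnn !andbF.
Qed.

Lemma wedge_sign_sqr i alpha : wedge_sign i alpha * wedge_sign i alpha = 1 :> R.
Proof. by rewrite -expr2 /wedge_sign sqrr_sign. Qed.

End exchange.

Lemma integrable_sumr d (T : measurableType d) (R : realType)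
    (mu : {measure set T -> \bar R}) (D : set T) (I : Type) (s : seq I) (P : pred I)
    (F : I -> T -> R) : measurable D ->
  (forall i, P i -> mu.-integrable D (EFin \o F i)) ->
  mu.-integrable D (EFin \o (fun x => \sum_(i <- s | P i) F i x)).
Proof.
move=> mD iF; apply: (@eq_integrable _ _ _ _ _ mD
    (fun x => \sum_(i <- s | P i) (F i x)%:E)%E).
  by move=> x _; rewrite /= sumEFin.
exact: (integrable_sum mD).
Qed.

Lemma Rintegral_sum d (T : measurableType d) (R : realType)
    (mu : {measure set T -> \bar R}) (D : set T) (I : Type) (s : seq I) (P : pred I)
    (F : I -> T -> R) : measurable D ->
  (forall i, P i -> mu.-integrable D (EFin \o F i)) ->
  \int[mu]_(x in D) (\sum_(i <- s | P i) F i x) =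
  \sum_(i <- s | P i) \int[mu]_(x in D) F i x.
Proof.
move=> mD iF; elim: s => [|i s IHs].
  rewrite big_nil; under eq_Rintegral do rewrite big_nil.
  by rewrite Rintegral_cst // mul0r.
rewrite big_cons; under eq_Rintegral do rewrite big_cons.
case: ifPn => // Pi; rewrite RintegralD // ?IHs //; first exact: iF.
exact: integrable_sumr.
Qed.

Lemma continuous_mul_add (R : realType) n (f g h k : 'rV[R]_n -> R) :
  continuous f -> continuous g -> continuous h -> continuous k ->
  continuous (fun x => f x * g x + h x * k x).
Proof.
move=> cf cg ch ck x.
have c1 := @cvgM R _ (nbhs x) (nbhs_filter x) f g _ _ (cf x) (cg x).
have c2 := @cvgM R _ (nbhs x) (nbhs_filter x) h k _ _ (ch x) (ck x).
exact: (@cvgD R _ _ (nbhs x) (nbhs_filter x) _ _ _ _ c1 c2).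
Qed.

Section test_forms.
Context {R : realType} {n : nat} (Omega : set 'rV[R]_n) (l r : 'rV[R]_n).
Hypotheses (oOmega : open Omega) (bOmega : Omega `<=` cbox l r).
Implicit Types (omega mu theta phi : dform R n).

Notation leb := (lebesgue_rV n).

Let mOmega : measurable Omega. Proof. exact: open_measurable_rV. Qed.

Lemma domain_lty : (leb Omega < +oo)%E.
Proof.
apply: le_lt_trans (lebesgue_rV_cbox_lty l r).
by apply: le_measure; rewrite ?inE //; exact: measurable_cbox.
Qed.

Lemma L2_form_bounded omega (B : R) :
  (forall alpha, measurable_fun Omega (omega alpha)) ->
  (forall alpha x, Omega x -> `|omega alpha x| <= B) -> L2_form Omega omega.
Proof.
move=> mo oB alpha; split=> //.
apply: (@integrable_bounded _ _ _ _ (fun x => omega alpha x ^+ 2) _ Omega (B ^+ 2)) => //.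
- exact: domain_lty.
- exact: measurable_funX.
- move=> x Ox; rewrite normrX lerXn2r ?nnegrE //; last exact: oB.
  exact: le_trans (oB alpha x Ox).
Qed.

Lemma integrable_continuous (f : 'rV[R]_n -> R) : continuous f ->
  leb.-integrable Omega (EFin \o f).
Proof.
move=> cf; have [B fB] := continuous_bounded_on (@compact_cbox R n l r) cf.
apply: (@integrable_bounded _ _ _ _ _ _ Omega B) => //.
- exact: domain_lty.
- by apply: measurable_funTS; exact: continuous_measurable_rV.
- by move=> x /bOmega; exact: fB.
Qed.

Lemma L2_form_continuous omega : (forall alpha, continuous (omega alpha)) ->
  L2_form Omega omega.
Proof.
move=> co.
have /choice[B BP] : forall alpha, exists B : R, forall x, cbox l r x -> `|omega alpha x| <= B.
  by move=> alpha; apply: continuous_bounded_on => //; exact: compact_cbox.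
apply: (@L2_form_bounded _ (\sum_alpha `|B alpha|)).
  by move=> alpha; apply: measurable_funTS; exact: continuous_measurable_rV.
move=> alpha x /bOmega/BP => /(_ alpha)/le_trans; apply.
by rewrite (bigD1 alpha) //= (le_trans (ler_norm _)) // lerDl sumr_ge0.
Qed.

Definition C1_form omega := forall alpha,
  (forall x, differentiable (omega alpha) x) /\
  forall i, continuous (partial i (omega alpha)).

Lemma C1_form_continuous omega alpha : C1_form omega -> continuous (omega alpha).
Proof.
by move=> /(_ alpha)[d _] x; apply: differentiable_continuous; exact: d.
Qed.

Lemma test_form_C1 phi : test_form Omega phi -> C1_form phi.
Proof.
move=> [sphi _] alpha; split=> [x|i x]; first exact: (sphi alpha [::] x).
by apply: differentiable_continuous; exact: (sphi alpha [:: i] x).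
Qed.

Lemma continuous_sum_scale (I : finType) (P : pred I) (c : I -> R) (f : I -> 'rV[R]_n -> R) :
  (forall i, continuous (f i)) ->
  continuous (fun x => \sum_(i | P i) c i * f i x).
Proof.
move=> cf.
have cf1 i : continuous (fun x => c i * f i x).
  by move=> x; have := cvgMl_tmp (a := c i) (cf i x); exact.
by apply: continuous_big => [|i _]; [exact: add_continuous|exact: cf1].
Qed.

Lemma L2_form_ext_d omega : C1_form omega -> L2_form Omega (ext_d omega).
Proof.
move=> o1; apply: L2_form_continuous => beta.
apply: (@continuous_sum_scale _ (mem beta) (fun i => wedge_sign i beta)
  (fun i => partial i (omega (beta :\ i)))) => i.
by have [_] := o1 (beta :\ i); apply.
Qed.

Lemma L2_form_cdelta omega : C1_form omega -> L2_form Omega (cdelta omega).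
Proof.
move=> o1; apply: L2_form_continuous => beta x.
have c := @continuous_sum_scale _ (fun i => i \notin beta) (fun i => wedge_sign i beta)
  (fun i => partial i (omega (i |: beta))) (fun i => (o1 (i |: beta)).2 i).
by have := cvgN (c x); exact.
Qed.

Lemma L2_form_C1 omega : C1_form omega -> L2_form Omega omega.
Proof. by move=> o1; apply: L2_form_continuous => alpha; exact: C1_form_continuous. Qed.

Lemma L2_form_test phi : test_form Omega phi -> L2_form Omega phi.
Proof. by move=> /test_form_C1; exact: L2_form_C1. Qed.

Lemma L2_form_ext_d_test phi : test_form Omega phi -> L2_form Omega (ext_d phi).
Proof. by move=> /test_form_C1; exact: L2_form_ext_d. Qed.

Lemma cbox_symmetric : exists M : R, cbox l r `<=` cbox (const_mx (- M)) (const_mx M).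
Proof.
exists (\sum_i (`|l 0 i| + `|r 0 i|)) => x xlr i; rewrite !mxE -ler_norml.
rewrite (bigD1 i) //=; have := xlr i => /andP[lx xr].
apply: (@le_trans _ _ (`|l 0 i| + `|r 0 i|)); last first.
  by rewrite lerDl sumr_ge0 // => j _; exact: addr_ge0.
rewrite ler_norml; have := ler_norm (r 0 i); have := ler_norm (- l 0 i).
rewrite normrN; have := normr_ge0 (r 0 i); have := normr_ge0 (l 0 i).
by move=> *; apply/andP; split; lra.
Qed.

(** By the product rule the integrand is a partial derivative of a function that vanishes off a
    compact subset of [Omega], so the integral extends to the whole space. *)
Lemma integral_partial_mul phi mu alpha beta i : test_form Omega phi -> C1_form mu ->
  \int[leb]_(x in Omega) (partial i (phi alpha) x * mu beta x
    + phi alpha x * partial i (mu beta) x) = 0.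
Proof.
move=> tphi m1; have [dphi cphi] := test_form_C1 tphi alpha; have [dmu cmu] := m1 beta.
have [_ [C [cC CO phi0]]] := tphi.
have clC : closed C by apply: compact_closed => //; exact: norm_hausdorff.
pose u := phi alpha * mu beta.
have uE x : partial i (phi alpha) x * mu beta x + phi alpha x * partial i (mu beta) x =
    partial i u x.
  by rewrite partialM // addrC (mulrC (mu beta x)).
have u0 x : ~ C x -> u x = 0 by move=> /(phi0 alpha) h; rewrite /u mulrfctE h mul0r.
have du0 x : ~ C x -> partial i u x = 0 by exact: partial_eq0.
have [M lrM] := cbox_symmetric.
have -> : \int[leb]_(x in Omega) (partial i (phi alpha) x * mu beta x
    + phi alpha x * partial i (mu beta) x) = \int[leb]_x partial i u x.
  rewrite Rintegral_mkcond; apply: eq_Rintegral => x _; rewrite patchE.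
  case: ifPn => [_|/negP]; first exact: uE.
  by rewrite inE => nO; rewrite du0 // => /CO.
rewrite /Rintegral (integral_partial_compact_support (M := M)) //.
- move=> x; apply: diff_derivable; exact: differentiableM.
- have -> : partial i u = (fun x => partial i (phi alpha) x * mu beta x +
      phi alpha x * partial i (mu beta) x) by apply/funext => x; rewrite uE.
  apply: continuous_mul_add; [exact: cphi|exact: C1_form_continuous| |exact: cmu].
  by apply: C1_form_continuous; exact: test_form_C1.
- by move=> x nx; apply: u0 => /CO/bOmega/lrM.
Qed.

(** Regrouped over pairs of an index set and an index outside it, the difference of the integrands
    is a signed sum of product-rule expressions, each of integral 0. *)
Lemma L2_ip_ext_d_cdelta phi mu : test_form Omega phi -> C1_form mu ->
  L2_ip Omega (ext_d phi) mu = L2_ip Omega phi (cdelta mu).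
Proof.
move=> tphi m1; apply/eqP; rewrite -subr_eq0.
have i1 := L2_form_ip_integrable mOmega (L2_form_ext_d_test tphi) (L2_form_C1 m1).
have i2 := L2_form_ip_integrable mOmega (L2_form_test tphi) (L2_form_cdelta m1).
rewrite /L2_ip -RintegralB //.
pose F x := \sum_(alpha : {set 'I_n}) \sum_(i | i \notin alpha) wedge_sign i alpha *
  (partial i (phi alpha) x * mu (i |: alpha) x + phi alpha x * partial i (mu (i |: alpha)) x).
have -> : \int[leb]_(x in Omega) (\sum_alpha ext_d phi alpha x * mu alpha x -
    \sum_alpha phi alpha x * cdelta mu alpha x) = \int[leb]_(x in Omega) F x.
  apply: eq_Rintegral => x _; rewrite /F /ext_d /cdelta.
  under eq_bigr do rewrite mulr_suml.
  rewrite (exchange_add_remove (fun i (beta alpha : {set 'I_n}) =>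
    wedge_sign i beta * partial i (phi alpha) x * mu beta x)).
  rewrite -sumrB; apply: eq_bigr => alpha _; rewrite mulrN opprK mulr_sumr -big_split /=.
  by apply: eq_bigr => i _; rewrite wedge_signU1; ring.
have h' (alpha : {set 'I_n}) i : leb.-integrable Omega (EFin \o (fun x =>
    partial i (phi alpha) x * mu (i |: alpha) x + phi alpha x * partial i (mu (i |: alpha)) x)).
  apply: integrable_continuous; apply: continuous_mul_add.
  - exact: (test_form_C1 tphi alpha).2.
  - exact: C1_form_continuous.
  - by apply: C1_form_continuous; exact: test_form_C1.
  - exact: (m1 (i |: alpha)).2.
have h (alpha : {set 'I_n}) i : leb.-integrable Omega (EFin \o (fun x => wedge_sign i alpha *
    (partial i (phi alpha) x * mu (i |: alpha) x +
      phi alpha x * partial i (mu (i |: alpha)) x))).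
  exact: (integrableZl mOmega (wedge_sign i alpha) (h' alpha i)).
rewrite /F Rintegral_sum // => [|alpha _]; last by apply: integrable_sumr => // i _; exact: h.
rewrite big1 // => alpha _; rewrite Rintegral_sum // big1 // => i _.
by rewrite RintegralZl // integral_partial_mul // mulr0.
Qed.

End test_forms.

(** * Weak codifferentials and the closure of the test forms *)

Section codifferential.
Context {R : realType} {n : nat} (Omega : set 'rV[R]_n) (l r : 'rV[R]_n).
Hypotheses (oOmega : open Omega) (bOmega : Omega `<=` cbox l r).
Implicit Types (omega mu theta phi : dform R n).

Notation leb := (lebesgue_rV n).

Let mOmega : measurable Omega. Proof. exact: open_measurable_rV. Qed.

Lemma smooth_lincomb c (f g : 'rV[R]_n -> R) : smooth f -> smooth g ->
  smooth (fun x => c * f x + g x).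
Proof.
move=> sf sg.
suff E s : foldr partial (fun x => c * f x + g x) s =
    (cst c : 'rV[R]_n -> R) * foldr partial f s + foldr partial g s.
  move=> s x; rewrite E; apply: differentiableD; last exact: sg.
  by apply: differentiableM; [exact: differentiable_cst|exact: sf].
elim: s => // i s /= ->; apply/funext => x.
rewrite partialD; last exact: sg; last first.
  by apply: differentiableM; [exact: differentiable_cst|exact: sf].
rewrite partialM; [|exact: differentiable_cst|exact: sf].
by rewrite partial_cst mulr0 addr0.
Qed.

Lemma test_form_lincomb c phi1 phi2 : test_form Omega phi1 -> test_form Omega phi2 ->
  test_form Omega (lincomb c phi1 phi2).
Proof.
move=> [s1 [C1 [cC1 C1O z1]]] [s2 [C2 [cC2 C2O z2]]]; split.
  by move=> alpha; exact: smooth_lincomb.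
exists (C1 `|` C2); split.
- by move: cC1 cC2; exact: compactU.
- by move=> x [/C1O|/C2O].
- move=> alpha x /not_orP[n1 n2]; by rewrite /lincomb z1 // z2 // mulr0 addr0.
Qed.

Lemma test_formS (U : set 'rV[R]_n) phi : U `<=` Omega -> test_form U phi ->
  test_form Omega phi.
Proof.
move=> UO [sphi [C [cC CU z]]]; split=> //; exists C; split=> //.
exact: subset_trans UO.
Qed.

Lemma test_form0 : test_form Omega (fun=> cst 0).
Proof.
split; first by move=> alpha; apply: flat_algebra_smooth; exact: flat_algebra_cst.
by exists set0; split=> //; exact: compact0.
Qed.

Lemma is_kform_lincomb k c omega mu : is_kform k omega -> is_kform k mu ->
  is_kform k (lincomb c omega mu).
Proof. by move=> ko km alpha ak x; rewrite /lincomb ko // km // mulr0 addr0. Qed.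

(** Test forms with a single nonzero coefficient reduce this to the fundamental lemma. An open part
    [U] is allowed so that the comparison can be made inside one cell. *)
Lemma ae_eq_of_test_forms (U : set 'rV[R]_n) theta1 theta2 :
  open U -> U `<=` Omega -> L2_form Omega theta1 -> L2_form Omega theta2 ->
  (forall phi, test_form U phi -> L2_ip Omega phi theta1 = L2_ip Omega phi theta2) ->
  forall alpha, ae_eq leb U (EFin \o theta1 alpha) (EFin \o theta2 alpha).
Proof.
move=> oU UO L1 L2 h alpha.
pose theta := lincomb (-1) theta2 theta1.
have Lt : L2_form Omega theta by exact: L2_form_lincomb.
have L1c : L2_form Omega (fun=> cst 1).
  by apply: (L2_form_continuous oOmega bOmega) => ?; exact: cst_continuous.
suff : ae_eq leb U (EFin \o theta alpha) (cst 0%E).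
  apply: filterS => x tx /tx [/eqP]; rewrite /theta /lincomb mulN1r addrC subr_eq0.
  by move=> /eqP e /=; rewrite e.
apply: (ae_eq0_of_test_functions (Omega := Omega)) => //.
  apply: (@eq_integrable _ _ _ _ _ mOmega (fun x => (1 * theta alpha x)%:E)).
    by move=> x _; rewrite mul1r.
  exact: (L2_form_mul mOmega alpha alpha L1c Lt).
move=> psi C spsi cC CU psi0.
pose phi : dform R n := fun beta x => if beta == alpha then psi x else 0.
have tphi : test_form U phi.
  split.
    move=> beta; rewrite /phi; case: eqP => // _.
    by apply: flat_algebra_smooth; exact: (flat_algebra_cst 0).
  exists C; split=> // beta x /psi0 p0; rewrite /phi; by case: eqP.
have tphiO := test_formS UO tphi.
have Lphi := L2_form_test oOmega bOmega tphiO.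
have : L2_ip Omega phi theta = 0.
  by rewrite L2_ip_lincombr // (h _ tphi) mulN1r addNr.
have E x : \sum_beta phi beta x * theta beta x = psi x * theta alpha x.
  rewrite (bigD1 alpha) //= /phi eqxx big1 ?addr0 // => beta /negPf ->.
  by rewrite mul0r.
rewrite /L2_ip; under eq_Rintegral do rewrite E.
(* [fine] also sends infinite values to 0, so integrability is needed to recover the extended
   integral. *)
rewrite /Rintegral => fine0; rewrite -[LHS]fineK ?fine0 //.
apply: integrable_fin_num => //.
apply: (@eq_integrable _ _ _ _ _ mOmega (fun x => (phi alpha x * theta alpha x)%:E)).
  by move=> x _; rewrite /phi eqxx.
exact: (L2_form_mul mOmega alpha alpha Lphi Lt).
Qed.

Definition has_codiff mu theta := L2_form Omega theta /\ is_codiff Omega mu theta.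

Lemma codiffP mu : (exists theta, has_codiff mu theta) -> has_codiff mu (codiff Omega mu).
Proof. exact: getPex. Qed.

Lemma has_codiff_ae mu theta theta' : has_codiff mu theta -> has_codiff mu theta' ->
  forall alpha, ae_eq leb Omega (EFin \o theta alpha) (EFin \o theta' alpha).
Proof.
move=> [L1 c1] [L2 c2]; apply: ae_eq_of_test_forms => // phi tphi.
by rewrite -c1 // -c2.
Qed.

(** [codiff] is an arbitrary choice among forms equal almost everywhere; under an integral any weak
    codifferential can stand for it. *)
Lemma L2_ip_codiff mu theta omega : L2_form Omega omega -> has_codiff mu theta ->
  L2_ip Omega omega (codiff Omega mu) = L2_ip Omega omega theta.
Proof.
move=> Lo ct; have cc : has_codiff mu (codiff Omega mu) by apply: codiffP; exists theta.
apply: L2_ip_ae => //; [exact: cc.1|exact: ct.1|].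
exact: (has_codiff_ae cc ct).
Qed.

Lemma L2_ip_codiff_sqr mu theta : has_codiff mu theta ->
  L2_ip Omega (codiff Omega mu) (codiff Omega mu) = L2_ip Omega theta theta.
Proof.
move=> ct; have cc : has_codiff mu (codiff Omega mu) by apply: codiffP; exists theta.
rewrite (L2_ip_codiff cc.1 ct) L2_ipC (L2_ip_codiff ct.1 ct) //.
Qed.

Lemma has_codiff_lincomb c mu1 mu2 theta1 theta2 :
  L2_form Omega mu1 -> L2_form Omega mu2 ->
  has_codiff mu1 theta1 -> has_codiff mu2 theta2 ->
  has_codiff (lincomb c mu1 mu2) (lincomb c theta1 theta2).
Proof.
move=> L1 L2 [Lt1 c1] [Lt2 c2]; split; first exact: L2_form_lincomb.
move=> phi tphi; have Lphi := L2_form_test oOmega bOmega tphi.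
have Ldphi := L2_form_ext_d_test oOmega bOmega tphi.
by rewrite !L2_ip_lincombr // c1 // c2.
Qed.

Lemma has_codiff_test phi : test_form Omega phi -> has_codiff phi (cdelta phi).
Proof.
move=> tphi; have c1 := test_form_C1 tphi; split; first exact: (L2_form_cdelta oOmega bOmega).
by move=> psi tpsi; exact: (L2_ip_ext_d_cdelta oOmega bOmega).
Qed.

Lemma Hstar_lincomb k c mu1 mu2 : Hstar Omega k mu1 -> Hstar Omega k mu2 ->
  Hstar Omega k (lincomb c mu1 mu2).
Proof.
move=> [k1 L1 [t1 c1]] [k2 L2 [t2 c2]]; split.
- exact: is_kform_lincomb.
- exact: L2_form_lincomb.
- by exists (lincomb c t1 t2); exact: has_codiff_lincomb.
Qed.

(** Squares are compared through [|c u + v|^2 <= 2 c^2 |u|^2 + 2 |v|^2], applied to the forms and to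
    their codifferentials; the threshold absorbs these factors. *)
Lemma Hstar_norm_lincomb_le c mu1 mu2 (e : R) :
  L2_form Omega mu1 -> L2_form Omega mu2 ->
  (exists theta, has_codiff mu1 theta) -> (exists theta, has_codiff mu2 theta) ->
  0 < e -> Hstar_norm Omega mu1 < e / (2 * (`|c| + 1)) ->
  Hstar_norm Omega mu2 < e / (2 * (`|c| + 1)) ->
  Hstar_norm Omega (lincomb c mu1 mu2) < e.
Proof.
move=> L1 L2 /codiffP c1 /codiffP c2 e0; rewrite /Hstar_norm.
have cl := has_codiff_lincomb c L1 L2 c1 c2.
rewrite (L2_ip_codiff_sqr cl).
have := L2_ip_lincomb_le mOmega c L1 L2.
have := L2_ip_lincomb_le mOmega c c1.1 c2.1.
have := L2_ip_ge0 Omega mu1; have := L2_ip_ge0 Omega mu2.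
have := L2_ip_ge0 Omega (codiff Omega mu1); have := L2_ip_ge0 Omega (codiff Omega mu2).
have := L2_ip_ge0 Omega (lincomb c (codiff Omega mu1) (codiff Omega mu2)).
have := L2_ip_ge0 Omega (lincomb c mu1 mu2).
move: (L2_ip _ _ _) (L2_ip _ _ _) (L2_ip _ _ _) (L2_ip _ _ _) (L2_ip _ _ _) (L2_ip _ _ _).
move=> A B a2 a1 b2 b1 A0 B0 a20 a10 b20 b10 Bb Aa.
pose d := 2 * (`|c| + 1).
have d0 : 0 < d by rewrite mulr_gt0 // ltr_wpDl.
have cc : c ^+ 2 = `|c| ^+ 2 by rewrite real_normK // num_real.
have lt (x : R) : 0 <= x -> Num.sqrt x < e / d -> x * d ^+ 2 < e ^+ 2.
  move=> x0 xe; rewrite -[x]sqr_sqrtr // -exprMn ltrXn2r //.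
  - by rewrite mulr_ge0 ?sqrtr_ge0 // ltW.
  - by rewrite -ltr_pdivlMr.
move=> /lt; rewrite addr_ge0 // => /(_ isT) h1 /lt; rewrite addr_ge0 // => /(_ isT) h2.
rewrite -(@ltr_pXn2r _ 2) ?nnegrE ?sqrtr_ge0 // ?ltW // sqr_sqrtr ?addr_ge0 //.
have c0 := normr_ge0 c; rewrite cc in Aa Bb; rewrite /d in h1 h2.
move: (`|c|) c0 h1 h2 Aa Bb => t t0 h1 h2 Aa Bb.
have q (S : R) : 0 <= S -> 0 <= 2 * S * (2 * t + 1).
  by move=> S0; rewrite !mulr_ge0 // addr_ge0 // mulr_ge0.
(* Half the square of [2 * (t + 1)] dominates both [2 * t ^+ 2] and 2, so each summand stays below
   [e ^+ 2 / 2]. *)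
have q1 : 2 * t ^+ 2 * (A + a2) <= (A + a2) * (2 * (t + 1)) ^+ 2 / 2.
  rewrite -subr_ge0 (_ : _ - _ = 2 * (A + a2) * (2 * t + 1)); last by field.
  by apply: q; exact: addr_ge0.
have q2 : 2 * (B + a1) <= (B + a1) * (2 * (t + 1)) ^+ 2 / 2.
  rewrite -subr_ge0 (_ : _ - _ = 2 * (B + a1) * (t * (t + 2))); last by field.
  by rewrite !mulr_ge0 // addr_ge0.
by lra.
Qed.

Lemma Hstar0_lincomb k c mu1 mu2 : Hstar0 Omega k mu1 -> Hstar0 Omega k mu2 ->
  Hstar0 Omega k (lincomb c mu1 mu2).
Proof.
move=> [H1 a1] [H2 a2]; split; first exact: Hstar_lincomb.
move=> e e0; have e'0 : 0 < e / (2 * (`|c| + 1)).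
  by rewrite divr_gt0 // mulr_gt0 // ltr_wpDl.
have [phi1 [t1 k1 n1]] := a1 _ e'0; have [phi2 [t2 k2 n2]] := a2 _ e'0.
exists (lincomb c phi1 phi2); split.
- exact: test_form_lincomb.
- exact: is_kform_lincomb.
have -> : lincomb c mu1 mu2 - lincomb c phi1 phi2 = lincomb c (mu1 - phi1) (mu2 - phi2).
  apply/funext => alpha; apply/funext => x; rewrite /lincomb !fctE /=; ring.
have subE mu phi : mu - phi = lincomb (-1) phi mu.
  by apply/funext => alpha; apply/funext => x; rewrite /lincomb !fctE mulN1r addrC.
have [[_ L1 [th1 c1]] [_ L2 [th2 c2]]] := (H1, H2).
have Lphi1 := L2_form_test oOmega bOmega t1; have Lphi2 := L2_form_test oOmega bOmega t2.
have has_codiff_sub mu phi th : L2_form Omega mu -> has_codiff mu th ->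
    test_form Omega phi -> exists theta, has_codiff (mu - phi) theta.
  move=> Lmu cmu tphi; exists (lincomb (-1) (cdelta phi) th); rewrite subE.
  have Lphi := L2_form_test oOmega bOmega tphi.
  exact: (has_codiff_lincomb (-1) Lphi Lmu (has_codiff_test tphi) cmu).
apply: (Hstar_norm_lincomb_le _ _ _ _ e0 n1 n2).
- by rewrite subE; exact: L2_form_lincomb.
- by rewrite subE; exact: L2_form_lincomb.
- exact: (has_codiff_sub _ _ _ L1 c1 t1).
- exact: (has_codiff_sub _ _ _ L2 c2 t2).
Qed.

Lemma L2_ip0 omega : L2_ip Omega (fun=> cst 0) omega = 0.
Proof.
rewrite /L2_ip; under eq_Rintegral do under eq_bigr do rewrite mul0r.
by under eq_Rintegral do rewrite big1 //; rewrite Rintegral_cst // mul0r.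
Qed.

Lemma has_codiff0 : has_codiff (fun=> cst 0) (fun=> cst 0).
Proof.
by split; [exact: L2_form0|move=> phi _; rewrite !(L2_ipC _ _ (fun=> cst 0)) !L2_ip0].
Qed.

Lemma Hstar0_0 k : Hstar0 Omega k (fun=> cst 0).
Proof.
split.
  by split=> //; [exact: L2_form0|exists (fun=> cst 0); exact: has_codiff0].
move=> e e0; exists (fun=> cst 0); split=> //; first exact: test_form0.
have -> : (fun=> cst 0 : 'rV[R]_n -> R) - (fun=> cst 0) = (fun=> cst 0) :> dform R n.
  by apply/funext => alpha; apply/funext => x; rewrite !fctE subr0.
by rewrite /Hstar_norm (L2_ip_codiff_sqr has_codiff0) !L2_ip0 addr0 sqrtr0.
Qed.

End codifferential.

(** * Piecewise affine forms *)

Section piecewise_affine.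
Context {R : realType} {n : nat} (Omega : set 'rV[R]_n)
  (G : {fset {fset 'rV[R]_n}}) (l r : 'rV[R]_n).
Hypotheses (oOmega : open Omega) (bOmega : Omega `<=` cbox l r).
Hypothesis sG : forall K, K \in G -> is_simplex K.
Hypothesis dG : forall K K', K \in G -> K' \in G -> K != K' ->
  ocell K `&` ocell K' = set0.
Hypothesis GOmega : forall K, K \in G -> ocell K `<=` Omega.
Implicit Types (K : G) (A e : G -> {set 'I_n} -> R)
  (B : G -> {set 'I_n} -> 'I_n -> R) (omega mu : dform R n).

Notation leb := (lebesgue_rV n).

Let mOmega : measurable Omega. Proof. exact: open_measurable_rV. Qed.

Definition cell K : set 'rV[R]_n := ocell (val K).

Definition vol K : R := fine (leb (cell K)).

Definition centroid K : 'rV[R]_n :=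
  \row_i ((\int[leb]_(x in cell K) x 0 i) / vol K).

(* Expanding about the centroids makes the linear part orthogonal to the
   constants on every cell. *)
Definition pw A B : dform R n := fun alpha x =>
  \sum_(K : G) \1_(cell K) x *
    (A K alpha + \sum_i (x 0 i - centroid K 0 i) * B K alpha i).

Lemma vol_gt0 K : 0 < vol K.
Proof.
rewrite /vol fine_gt0 // lebesgue_rV_ocell_gt0; last exact: (sG (valP K)).
exact: lebesgue_rV_ocell_lty.
Qed.

Lemma measurable_cell K : measurable (cell K).
Proof. exact: measurable_ocell. Qed.

Lemma cell_sub K : cell K `<=` Omega.
Proof. exact: (GOmega (valP K)). Qed.

Lemma cell_inj K K' x : cell K x -> cell K' x -> K = K'.
Proof.
move=> Kx K'x; apply: contrapT => KK'.
have := dG (valP K) (valP K'); rewrite (inj_eq val_inj) => /(_ (introN eqP KK')).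
by rewrite -subset0 => /(_ x); apply.
Qed.

Lemma pw_in A B K alpha x : cell K x ->
  pw A B alpha x = A K alpha + \sum_i (x 0 i - centroid K 0 i) * B K alpha i.
Proof.
move=> Kx; rewrite /pw (bigD1 K) //= [X in _ + X = _]big1 => [|K' K'K].
  by rewrite addr0 indicE mem_set // mul1r.
rewrite indicE memNset ?mul0r // => K'x.
by move/eqP: K'K; apply; exact: (cell_inj K'x Kx).
Qed.

Lemma pw_out A B alpha x : (forall K, ~ cell K x) -> pw A B alpha x = 0.
Proof.
by move=> nx; rewrite /pw big1 // => K _; rewrite indicE memNset ?mul0r.
Qed.

Lemma eq_pw omega A B :
  (forall K alpha x, cell K x ->
     omega alpha x = A K alpha + \sum_i (x 0 i - centroid K 0 i) * B K alpha i) ->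
  (forall alpha x, (forall K, ~ cell K x) -> omega alpha x = 0) ->
  omega = pw A B.
Proof.
move=> oin oout; apply/funext => alpha; apply/funext => x.
have [[K Kx]|nx] := pselect (exists K, cell K x).
  by rewrite (pw_in _ _ _ Kx); exact: oin.
have {}nx : forall K, ~ cell K x by move=> K Kx; apply: nx; exists K.
by rewrite pw_out // oout.
Qed.

Lemma pw_lincomb c A B A' B' :
  lincomb c (pw A B) (pw A' B') =
  pw (fun K alpha => c * A K alpha + A' K alpha)
     (fun K alpha i => c * B K alpha i + B' K alpha i).
Proof.
apply: eq_pw => [K alpha x Kx|alpha x nx]; last first.
  by rewrite /lincomb !pw_out // mulr0 addr0.
rewrite /lincomb !(pw_in _ _ _ Kx) mulrDr mulr_sumr addrACA -big_split /=.
by congr (_ + _); apply: eq_bigr => i _; ring.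
Qed.

Let integrable_coord_cell K i (a b : R) :
  leb.-integrable (cell K) (EFin \o (fun x : 'rV[R]_n => (x 0 i - a) * b)).
Proof.
apply: (integrableS mOmega (measurable_cell K) (@cell_sub K)).
apply: (integrable_continuous oOmega bOmega).
have -> : (fun x : 'rV[R]_n => (x 0 i - a) * b) = affine (b *: delta_mx 0 i) (- (a * b)).
  apply/funext => x; rewrite /affine (bigD1 i) //= big1 => [|j /negPf ji].
    by rewrite !mxE !eqxx mulr1 addr0 mulrBl mulrC.
  by rewrite !mxE ji andbF mulr0 mul0r.
exact: continuous_affine.
Qed.

Lemma Rintegral_centroid K i : \int[leb]_(x in cell K) (x 0 i - centroid K 0 i) = 0.
Proof.
have i1 := integrable_coord_cell K i 0 1.
have i1' : leb.-integrable (cell K) (EFin \o (fun x : 'rV[R]_n => x 0 i)).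
  apply: (@eq_integrable _ _ _ _ _ (measurable_cell K) _ _ _ i1) => x _.
  by rewrite /= subr0 mulr1.
have mc := measurable_cell K.
have i2 : leb.-integrable (cell K) (EFin \o (fun x : 'rV[R]_n => centroid K 0 i)).
  apply: (integrableS mOmega mc (@cell_sub K)).
  by apply: (integrable_continuous oOmega bOmega); exact: cst_continuous.
rewrite RintegralB // Rintegral_cst // -/(vol K) mxE divfK ?subrr //.
by rewrite gt_eqF // vol_gt0.
Qed.

Lemma measurable_pw A B alpha : measurable_fun setT (pw A B alpha).
Proof.
rewrite /pw; apply: measurable_sum => K.
apply: measurable_funM.
  exact: measurable_indic (measurable_cell K).
apply: measurable_funD => //; apply: measurable_sum => i.
apply: measurable_funM => //; apply: measurable_funB => //.
exact: (@measurable_coord_rV _ (measurableTypeR R)).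
Qed.

Lemma L2_form_pw A B : L2_form Omega (pw A B).
Proof.
pose C (K : G) (alpha : {set 'I_n}) : R := `|A K alpha| +
  \sum_i (`|l 0 i| + `|r 0 i| + `|centroid K 0 i|) * `|B K alpha i|.
have C0 K alpha : 0 <= C K alpha.
  by rewrite addr_ge0 // sumr_ge0 // => i _; rewrite mulr_ge0 // !addr_ge0.
apply: (@L2_form_bounded _ _ _ _ _ oOmega bOmega _ (\sum_K \sum_alpha C K alpha)).
  by move=> alpha; apply: measurable_funTS; exact: measurable_pw.
move=> alpha x Ox; have [[K Kx]|nx] := pselect (exists K, cell K x); last first.
  rewrite pw_out ?normr0 ?sumr_ge0 //.
    by move=> K _; apply: sumr_ge0 => beta _.
  by move=> K Kx; apply: nx; exists K.
rewrite (pw_in _ _ _ Kx); apply: (@le_trans _ _ (C K alpha)); last first.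
  rewrite (bigD1 K) //= (bigD1 alpha) //= -addrA lerDl addr_ge0 // sumr_ge0 // => K' _.
  by apply: sumr_ge0 => beta _.
rewrite /C (le_trans (ler_normD _ _)) // lerD2l (le_trans (ler_norm_sum _ _ _)) //.
apply: ler_sum => i _; rewrite normrM ler_wpM2r // (le_trans (ler_normB _ _)) // lerD2r.
have /andP[lx xr] := bOmega Ox i.
rewrite ler_norml; have := ler_norm (r 0 i); have := ler_norm (- l 0 i).
rewrite normrN; have := normr_ge0 (r 0 i); have := normr_ge0 (l 0 i).
by move=> *; apply/andP; split; lra.
Qed.

(** Against a constant the linear part integrates to 0 on each cell, by the choice of the
    centroid. *)
Lemma L2_ip_pw_cst A B A' :
  L2_ip Omega (pw A B) (pw A' (fun _ _ _ => 0)) =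
  \sum_(K : G) vol K * \sum_alpha A K alpha * A' K alpha.
Proof.
pose E K i := \sum_alpha B K alpha i * A' K alpha.
pose F K (x : 'rV[R]_n) := \sum_alpha A K alpha * A' K alpha +
  \sum_i (x 0 i - centroid K 0 i) * E K i.
have fE x : \sum_alpha pw A B alpha x * pw A' (fun _ _ _ => 0) alpha x =
    \sum_(K : G) \1_(cell K) x * F K x.
  have [[K Kx]|nx] := pselect (exists K, cell K x); last first.
    have {}nx : forall K, ~ cell K x by move=> K Kx; apply: nx; exists K.
    rewrite !big1 // => [K _|alpha _]; first by rewrite indicE memNset ?mul0r.
    by rewrite pw_out // mul0r.
  rewrite [RHS](bigD1 K) //= [X in _ = _ + X]big1 ?addr0; last first.
    move=> K' K'K; rewrite indicE memNset ?mul0r // => K'x.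
    by move/eqP: K'K; apply; exact: cell_inj Kx.
  rewrite indicE mem_set // mul1r /F.
  transitivity (\sum_alpha (A K alpha * A' K alpha +
      \sum_i (x 0 i - centroid K 0 i) * B K alpha i * A' K alpha)).
    apply: eq_bigr => alpha _; rewrite !(pw_in _ _ _ Kx).
    by rewrite [X in _ * (_ + X)]big1 ?addr0 => [|i _]; rewrite ?mulr0 // mulrDl mulr_suml.
  rewrite big_split /=; congr (_ + _); rewrite exchange_big /=; apply: eq_bigr => i _.
  by rewrite /E mulr_sumr; apply: eq_bigr => alpha _; rewrite mulrA.
have i1 K (a : R) : leb.-integrable (cell K) (EFin \o cst a).
  apply: (integrableS mOmega (measurable_cell K) (@cell_sub K)).
  by apply: (integrable_continuous oOmega bOmega); exact: cst_continuous.
have i2 K : leb.-integrable (cell K)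
    (EFin \o (fun x : 'rV[R]_n => \sum_i (x 0 i - centroid K 0 i) * E K i)).
  apply: integrable_sumr => [|i _]; first exact: measurable_cell.
  exact: integrable_coord_cell.
have iF K : leb.-integrable (cell K) (EFin \o F K).
  exact: (integrableD (measurable_cell K) (i1 K _) (i2 K)).
have indF K : (fun x => \1_(cell K) x * F K x) = (F K) \_ (cell K).
  apply/funext => x; rewrite patchE indicE; case: ifPn => _; rewrite ?mul1r ?mul0r //.
have iindF K : leb.-integrable Omega (EFin \o (fun x => \1_(cell K) x * F K x)).
  rewrite indF (_ : EFin \o _ = (EFin \o F K) \_ (cell K)); last first.
    by apply/funext => x; rewrite /= !patchE; case: ifPn.
  apply/(integrable_restrict leb (measurable_cell K) mOmega).
  by rewrite setIidr //; exact: cell_sub.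
rewrite /L2_ip; under eq_Rintegral do rewrite fE.
rewrite (@Rintegral_sum _ _ _ leb Omega G (index_enum G) predT _ mOmega (fun K _ => iindF K)).
apply: eq_bigr => K _; rewrite indF -Rintegral_mkcondr setIidr; last exact: cell_sub.
have mc := measurable_cell K.
rewrite (RintegralD mc (i1 K _) (i2 K)).
rewrite Rintegral_cst // -/(vol K) mulrC
  (Rintegral_sum _ mc (fun i _ => integrable_coord_cell K i _ _)).
rewrite [X in _ + X]big1 ?addr0 // => i _; rewrite RintegralZr //.
  by rewrite Rintegral_centroid mul0r.
have := integrable_coord_cell K i (centroid K 0 i) 1.
by apply: eq_integrable => // x _ /=; rewrite mulr1.
Qed.

End piecewise_affine.

(** * Coordinates with respect to piecewise constant forms *)

Section coordinates.
Context {R : realType} {n : nat} (Omega : set 'rV[R]_n)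
  (G : {fset {fset 'rV[R]_n}}) (l r : 'rV[R]_n).
Hypotheses (oOmega : open Omega) (bOmega : Omega `<=` cbox l r).
Hypothesis sG : forall K, K \in G -> is_simplex K.
Hypothesis dG : forall K K', K \in G -> K' \in G -> K != K' ->
  ocell K `&` ocell K' = set0.
Hypothesis GOmega : forall K, K \in G -> ocell K `<=` Omega.
Implicit Types (K : G) (A e : G -> {set 'I_n} -> R)
  (B : G -> {set 'I_n} -> 'I_n -> R) (omega mu : dform R n).

Notation leb := (lebesgue_rV n).
Notation h := (mesh_size G).

Let mOmega : measurable Omega. Proof. exact: open_measurable_rV. Qed.

Definition pwcst A := pw A (fun _ _ _ => 0).

(** The centroid is a mean of points of the cell, all of whose coordinates are within [h] of those
    of [x]. *)
Lemma centroid_dist K x i : cell K x -> `|x 0 i - centroid K 0 i| <= h.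
Proof.
move=> Kx; have mc := measurable_cell K.
have icst (a : R) : leb.-integrable (cell K) (EFin \o cst a).
  apply: (integrableS mOmega mc (cell_sub GOmega (K := K))).
  by apply: (integrable_continuous oOmega bOmega); exact: cst_continuous.
have icoord : leb.-integrable (cell K) (EFin \o (fun y : 'rV[R]_n => y 0 i)).
  apply: (integrableS mOmega mc (cell_sub GOmega (K := K))).
  by apply: (integrable_continuous oOmega bOmega); exact: coord_continuous.
have xy y : cell K y -> `|x 0 i - y 0 i| <= h.
  move=> Ky; apply: le_trans (diam_mesh_size (valP K)).
  by apply: hull_diam; exact: ocell_sub_hull.
have v0 := vol_gt0 sG K.
rewrite mxE ler_norml; apply/andP; split.
  rewrite lerBrDl -lerBrDr ler_pdivrMr // opprK -(Rintegral_cst leb mc).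
  apply: (le_Rintegral mc icoord (icst (x 0 i + h))) => y Ky; rewrite /cst.
  by have := xy y Ky; rewrite ler_norml => /andP[? ?]; lra.
rewrite lerBlDl -lerBlDr ler_pdivlMr // -(Rintegral_cst leb mc).
apply: (le_Rintegral mc (icst (x 0 i - h)) icoord) => y Ky; rewrite /cst.
by have := xy y Ky; rewrite ler_norml => /andP[? ?]; lra.
Qed.

Lemma L2_ip_le omega mu : L2_form Omega omega -> L2_form Omega mu ->
  (forall x, Omega x -> \sum_alpha omega alpha x * omega alpha x <=
     \sum_alpha mu alpha x * mu alpha x) ->
  L2_ip Omega omega omega <= L2_ip Omega mu mu.
Proof.
by move=> Lo Lm om; apply: le_Rintegral => //; exact: L2_form_ip_integrable.
Qed.

Lemma L2_ip_pw_split A B : L2_ip Omega (pw A B) (pw A B) =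
  \sum_(K : G) vol K * (\sum_alpha A K alpha ^+ 2) +
  L2_ip Omega (pw (fun _ _ => 0) B) (pw (fun _ _ => 0) B).
Proof.
have E : pw A B = lincomb 1 (pwcst A) (pw (fun _ _ => 0) B).
  rewrite /pwcst (pw_lincomb dG) //;
    apply: (eq_pw dG) => [K alpha x Kx|alpha x nx]; last exact: pw_out.
  rewrite (pw_in dG _ _ _ Kx) mul1r addr0; congr (_ + _).
  by apply: eq_bigr => i _; rewrite mulr0 add0r.
have L1 : L2_form Omega (pwcst A) by exact: (L2_form_pw oOmega bOmega dG).
have L2 : L2_form Omega (pw (fun _ _ => 0) B) by exact: (L2_form_pw oOmega bOmega dG).
have ip := L2_ip_pw_cst oOmega bOmega sG dG GOmega.
have cross : L2_ip Omega (pw (fun _ _ => 0) B) (pwcst A) = 0.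
  rewrite /pwcst ip big1 // => K _; rewrite big1 ?mulr0 // => alpha _.
  by rewrite mul0r.
rewrite E L2_ip_lincombl //; last exact: L2_form_lincomb.
rewrite !L2_ip_lincombr // !mul1r cross (L2_ipC _ (pwcst A) (pw _ _)) cross addr0 add0r.
by rewrite /pwcst ip.
Qed.

(** Pointwise Cauchy-Schwarz between [x - centroid] and the coefficients. The bound is read as the
    square norm of the piecewise constant form [D], so that a pointwise comparison suffices. *)
Lemma L2_ip_pw_lin_le B : L2_ip Omega (pw (fun _ _ => 0) B) (pw (fun _ _ => 0) B) <=
  \sum_(K : G) vol K * (n%:R * h ^+ 2 * \sum_alpha \sum_i B K alpha i ^+ 2).
Proof.
pose D K alpha : R := Num.sqrt (n%:R * h ^+ 2 * \sum_i B K alpha i ^+ 2).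
have D0 K alpha : 0 <= n%:R * h ^+ 2 * \sum_i B K alpha i ^+ 2.
  apply: mulr_ge0; first by apply: mulr_ge0 => //; exact: sqr_ge0.
  by apply: sumr_ge0 => i _; exact: sqr_ge0.
have -> : \sum_(K : G) vol K * (n%:R * h ^+ 2 * \sum_alpha \sum_i B K alpha i ^+ 2) =
    L2_ip Omega (pwcst D) (pwcst D).
  rewrite /pwcst (L2_ip_pw_cst oOmega bOmega sG dG GOmega).
  apply: eq_bigr => K _; congr (_ * _); rewrite mulr_sumr.
  by apply: eq_bigr => alpha _; rewrite -expr2 sqr_sqrtr.
apply: L2_ip_le; [exact: (L2_form_pw oOmega bOmega dG)|exact: (L2_form_pw oOmega bOmega dG)|].
move=> x _; apply: ler_sum => alpha _; rewrite /pwcst.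
have [[K Kx]|nx] := pselect (exists K : G, cell K x); last first.
  have {}nx : forall K : G, ~ cell K x by move=> K Kx; apply: nx; exists K.
  by rewrite !pw_out // !mul0r.
rewrite !(pw_in dG _ _ _ Kx) add0r [X in _ <= (_ + X) * _]big1; last by move=> i _;
  rewrite mulr0.
rewrite [X in _ <= _ * (_ + X)]big1; last by move=> i _; rewrite mulr0.
rewrite addr0 -!expr2 sqr_sqrtr //.
pose u : 'rV[R]_n := \row_i (x 0 i - centroid K 0 i); pose v : 'rV[R]_n := \row_i B K alpha i.
have := dotmx_CS u v; rewrite !dotmxE.
have uE i : u 0 i = x 0 i - centroid K 0 i by rewrite [LHS]mxE.
have vE i : v 0 i = B K alpha i by rewrite [LHS]mxE.
under eq_bigr do rewrite uE vE.
move=> /le_trans; apply; apply: ler_pM.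
- by apply: sumr_ge0 => i _; rewrite -expr2 sqr_ge0.
- by apply: sumr_ge0 => i _; rewrite -expr2 sqr_ge0.
- rewrite -[n in n%:R]card_ord -sumr_const mulr_suml.
  apply: ler_sum => i _; rewrite uE mul1r -expr2 -[leLHS]real_normK ?num_real //.
  by rewrite lerXn2r ?nnegrE ?mesh_size_ge0 //; exact: centroid_dist.
- by apply: ler_sum => i _; rewrite vE expr2.
Qed.

Definition deg_index (p : nat) : {set G * {set 'I_n}} :=
  finset (fun q : G * {set 'I_n} => #|q.2| == p).

(** Coefficients in the orthonormal basis of piecewise constant [p]-forms made of normalised
    indicators. Being defined by inner products, they make sense for any square-integrable form and
    only depend on its class, as the weak codifferential requires. *)
Definition crd p omega : 'rV[R]_#|deg_index p| :=
  \row_j (L2_ip Omega omega (pwcst (fun K alpha => ((K, alpha) == enum_val j)%:R))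
          / Num.sqrt (vol (enum_val j).1)).

Lemma crd_lincomb p c omega mu : L2_form Omega omega -> L2_form Omega mu ->
  crd p (lincomb c omega mu) = c *: crd p omega + crd p mu.
Proof.
move=> Lo Lm; apply/rowP => j; rewrite !mxE L2_ip_lincombl //.
  by rewrite mulrDl mulrA.
exact: (L2_form_pw oOmega bOmega dG).
Qed.

Lemma crd_pw p A B j :
  crd p (pw A B) 0 j = Num.sqrt (vol (enum_val j).1) * A (enum_val j).1 (enum_val j).2.
Proof.
rewrite mxE /pwcst (L2_ip_pw_cst oOmega bOmega sG dG GOmega).
case: (enum_val j) => K alpha /=.
rewrite (bigD1 K) //= [X in _ + X]big1 ?addr0 => [|K' K'K]; last first.
  rewrite big1 ?mulr0 // => beta _; rewrite xpair_eqE (negPf K'K) mulr0 //.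
rewrite (bigD1 alpha) //= eqxx mulr1 big1 ?addr0 => [|beta ba]; last first.
  by rewrite xpair_eqE (negPf ba) andbF mulr0.
have v0 := vol_gt0 sG K.
rewrite -{1}(sqr_sqrtr (ltW v0)) expr2 -!mulrA; congr (_ * _).
by rewrite mulrCA mulfV ?mulr1 // gt_eqF // sqrtr_gt0.
Qed.

Definition degree_supported (p : nat) A :=
  forall K (alpha : {set 'I_n}), #|alpha| != p -> A K alpha = 0.

(** The coordinates only record degree [p]; in the other degrees the right side vanishes with
    [A']. *)
Lemma dotmx_crd p A B A' B' : degree_supported p A' ->
  dotmx (crd p (pw A B)) (crd p (pw A' B')) =
  \sum_(K : G) vol K * \sum_alpha A K alpha * A' K alpha.
Proof.
move=> A'p; rewrite dotmxE; under eq_bigr do rewrite !crd_pw.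
rewrite -(big_enum_val (fun q : G * {set 'I_n} => Num.sqrt (vol q.1) * A q.1 q.2 *
  (Num.sqrt (vol q.1) * A' q.1 q.2))).
transitivity (\sum_q vol q.1 * (A q.1 q.2 * A' q.1 q.2)).
  rewrite big_mkcond /=; apply: eq_bigr => -[K alpha] _; rewrite inE /=.
  case: ifPn => [_|/(A'p K) ->]; last by rewrite !mulr0.
  by rewrite mulrACA -expr2 sqr_sqrtr // ltW // vol_gt0.
rewrite -(pair_bigA _ (fun K alpha => vol K * (A K alpha * A' K alpha))) /=.
by apply: eq_bigr => K _; rewrite mulr_sumr.
Qed.

Lemma crd_eq p A B A' B' : crd p (pw A B) = crd p (pw A' B') ->
  degree_supported p A -> degree_supported p A' -> forall K alpha, A K alpha = A' K alpha.
Proof.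
move=> AA' Ap A'p K alpha; have [ap|ap] := eqVneq #|alpha| p; last by rewrite Ap ?A'p.
have q : (K, alpha) \in deg_index p by rewrite inE ap eqxx.
move/rowP/(_ (enum_rank_in q (K, alpha))) : AA'.
rewrite !crd_pw enum_rankK_in //= => /mulfI; apply.
by rewrite gt_eqF // sqrtr_gt0 vol_gt0.
Qed.

(** Every coordinate vector arises, whatever the linear part: constants and linear parts can thus be
    prescribed independently. *)
Lemma crd_surj p (a : 'rV[R]_#|deg_index p|) : exists2 A, degree_supported p A &
  forall B, crd p (pw A B) = a.
Proof.
exists (fun K alpha => \sum_(j | enum_val j == (K, alpha)) a 0 j / Num.sqrt (vol K)).
  move=> K alpha ap; rewrite big1 // => j /eqP e.
  by have := enum_valP j; rewrite e inE /= (negPf ap).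
move=> B; apply/rowP => j; rewrite crd_pw -surjective_pairing.
rewrite (big_pred1 j) => [|i]; last by rewrite (inj_eq enum_val_inj).
by rewrite mulrC divfK // gt_eqF // sqrtr_gt0 vol_gt0.
Qed.

(** Common to both spaces: [T v] is a piecewise constant form [g], possibly only as a class, and [g]
    controls the coefficients [B] of the linear part of [v]. The equality with [g] is therefore
    tested against square-integrable forms. *)
Lemma pw_icr_coordinates p q (T : dform R n -> dform R n) (D : set (dform R n)) :
  D (fun=> cst 0) ->
  (forall c v w, D v -> D w -> D (lincomb c v w)) ->
  (forall v, D v -> exists e, exists2 B, v = pw e B & degree_supported p e /\
    exists2 g, degree_supported q g & [/\
      forall K, \sum_alpha \sum_i B K alpha i ^+ 2 <= n%:R * \sum_alpha g K alpha ^+ 2,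
      forall mu, L2_form Omega mu -> L2_ip Omega (T v) mu = L2_ip Omega (pwcst g) mu &
      L2_ip Omega (T v) (T v) = L2_ip Omega (pwcst g) (pwcst g)]) ->
  (forall c v w mu, D v -> D w -> L2_form Omega mu ->
    L2_ip Omega (T (lincomb c v w)) mu = c * L2_ip Omega (T v) mu + L2_ip Omega (T w) mu) ->
  icr_coordinates (L2_ip Omega) (L2_ip Omega) T D (crd p) (fun v => crd q (T v)) (n%:R * h).
Proof.
move=> D0 DP Dpw TP.
have Lpw A B : L2_form Omega (pw A B) by exact: (L2_form_pw oOmega bOmega dG).
have crdT v g : (forall mu, L2_form Omega mu ->
  L2_ip Omega (T v) mu = L2_ip Omega (pwcst g) mu) ->
    crd q (T v) = crd q (pwcst g).
  by move=> Tv; apply/rowP => j; rewrite !mxE Tv //; exact: Lpw.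
have LD v : D v -> L2_form Omega v by move=> /Dpw[e [B -> _]]; exact: Lpw.
have dotT v : D v -> L2_ip Omega (T v) (T v) = dotmx (crd q (T v)) (crd q (T v)).
  move=> /Dpw[e [B _ [_ [g gq [_ Tv ->]]]]].
  by rewrite (crdT _ _ Tv) dotmx_crd // /pwcst (L2_ip_pw_cst oOmega bOmega sG dG GOmega).
have dotv e B : degree_supported p e -> dotmx (crd p (pw e B)) (crd p (pw e B)) =
    \sum_(K : G) vol K * (\sum_alpha e K alpha ^+ 2).
  by move=> ep; rewrite dotmx_crd.
have lin0 : lincomb (-1) (fun=> cst 0) (fun=> cst 0) =
  (fun=> cst 0 : 'rV[R]_n -> R) :> dform R n.
  by apply/funext => alpha; apply/funext => x; rewrite /lincomb /= mulr0 addr0.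
split=> //.
- exists (fun=> cst 0) => //.
  split; apply/rowP => j; rewrite !mxE; first by rewrite (L2_ip0 oOmega) mul0r.
  (* [T 0 = 0] follows from linearity applied to the combination [- 0 + 0]. *)
  have := TP (-1) _ _ _ D0 D0 (Lpw (fun K alpha => ((K, alpha) == enum_val j)%:R) (fun _ _ _ => 0)).
  by rewrite lin0 mulN1r addNr /pwcst => ->; rewrite mul0r.
- move=> c v w Dv Dw; exists (lincomb c v w); first exact: DP.
  split; first by rewrite crd_lincomb //; exact: LD.
  apply/rowP => j; rewrite !mxE TP //; last exact: Lpw.
  by rewrite mulrDl mulrA.
- move=> v w Dv Dw Tw0; have [e [B -> _]] := Dpw _ Dv.
  have [f [C wE [fp [g gq [Cg Tw _]]]]] := Dpw _ Dw.
  (* On the kernel [g] is 0, hence so is the linear part: [w] is piecewise constant and only the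
     constant part of [v] meets it. *)
  have g0 K alpha : g K alpha = 0.
    apply: (@crd_eq q g (fun _ _ _ => 0) (fun _ _ => 0) (fun _ _ _ => 0)) => //.
    rewrite -/(pwcst g) -(crdT _ _ Tw) Tw0; apply/rowP => j; rewrite crd_pw mulr0 mxE //.
  have C0 K alpha i : C K alpha i = 0.
    have : \sum_alpha \sum_i C K alpha i ^+ 2 <= 0.
      apply: le_trans (Cg K) _; rewrite [X in _ * X]big1 ?mulr0 // => beta _.
      by rewrite g0 expr0n.
    move=> le0; apply/eqP; rewrite -sqrf_eq0 eq_le sqr_ge0 andbT; apply: le_trans le0.
    rewrite (bigD1 alpha) //= (bigD1 i) //= -addrA lerDl addr_ge0 //.
      by apply: sumr_ge0 => j _; exact: sqr_ge0.
    by apply: sumr_ge0 => beta _; apply: sumr_ge0 => j _; exact: sqr_ge0.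
  have {}C0 : C = (fun _ _ _ => 0).
    by apply/funext => K; apply/funext => alpha; apply/funext => i.
  by rewrite wE C0 (L2_ip_pw_cst oOmega bOmega sG dG GOmega) dotmx_crd.
- move=> v /Dpw[e [B -> [ep _]]]; rewrite dotv // L2_ip_pw_split lerDl.
  exact: L2_ip_ge0.
- move=> v Dv; rewrite -dotT //; have [e [B -> [ep [g gq [Bg _ ->]]]]] := Dpw _ Dv.
  rewrite dotv // L2_ip_pw_split lerD2l; apply: le_trans (L2_ip_pw_lin_le B) _.
  rewrite /pwcst (L2_ip_pw_cst oOmega bOmega sG dG GOmega) mulr_sumr.
  apply: ler_sum => K _; rewrite [leRHS]mulrCA; apply: ler_wpM2l;
    first by rewrite ltW // vol_gt0.
  (* One factor [n] comes from the coordinates of [x - centroid], the other from the bound of [B] by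
     [g]. *)
  apply: (@le_trans _ _ (n%:R * h ^+ 2 * (n%:R * \sum_alpha g K alpha ^+ 2))).
    by apply: ler_wpM2l => //; apply: mulr_ge0 => //; exact: sqr_ge0.
  by rewrite le_eqVlt; apply/orP; left; apply/eqP; rewrite exprMn; ring.
Qed.

End coordinates.

(** * Whitney forms *)

Section signs.
Context {R : realType} {n : nat}.
Implicit Types (i j : 'I_n) (alpha beta : {set 'I_n}).

Definition inversion_sign j i : R := if (j < i)%N then -1 else 1.

Lemma inversion_sign_sqr j i : inversion_sign j i * inversion_sign j i = 1.
Proof. by rewrite /inversion_sign; case: ifP => _; rewrite ?mulrNN mulr1. Qed.

Lemma inversion_signN i j : i != j -> inversion_sign i j * inversion_sign j i = -1.
Proof.
rewrite /inversion_sign neq_ltn => /orP[] h; rewrite h ltnNge (ltnW h) /=.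
  by rewrite mulr1.
by rewrite mul1r.
Qed.

Lemma wedge_signE i alpha : wedge_sign i alpha = \prod_(j in alpha) inversion_sign j i.
Proof.
transitivity (\prod_(j in alpha | (j < i)%N) (-1 : R)); last by rewrite big_mkcondr.
rewrite /wedge_sign -prodr_const; apply: eq_bigl => j.
transitivity (j \in finset (fun k : 'I_n => (k \in alpha) && (k < i)%N)) => //.
by rewrite inE.
Qed.

Lemma hodge_signE alpha : hodge_sign alpha =
  \prod_(p in alpha) \prod_(q | q \notin alpha) inversion_sign q p.
Proof.
rewrite pair_big_dep /=.
transitivity (\prod_(p : 'I_n * 'I_n | ((p.1 \in alpha) && (p.2 \notin alpha))
  && (p.2 < p.1)%N) (-1 : R)).
  rewrite /hodge_sign -prodr_const; apply: eq_bigl => -[p q].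
  rewrite unfold_in -andbA.
  by apply/idP/idP => [/set_mem|h]; [exact|exact: mem_set].
by rewrite big_mkcondr.
Qed.

(** Both Hodge signs share the inversions between [~: beta] and [beta :\ i]. The pairs of [i] with
    an index outside [beta] occur once in each order, and each such pair contributes -1. *)
Lemma hodge_sign_remove i beta : i \in beta ->
  hodge_sign (~: beta) * wedge_sign i (~: beta) =
  (-1) ^+ #|~: beta| * wedge_sign i beta * hodge_sign (~: (beta :\ i)) :> R.
Proof.
move=> ib.
pose C : R := \prod_(p in ~: beta) \prod_(q in beta :\ i) inversion_sign q p.
have CC : C * C = 1.
  rewrite /C -big_split /= big1 // => p _; rewrite -big_split /= big1 // => q _.
  exact: inversion_sign_sqr.
have h1 : hodge_sign (~: beta) = (\prod_(p in ~: beta) inversion_sign i p) * C.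
  rewrite hodge_signE /C -big_split /=; apply: eq_bigr => p _.
  rewrite (bigD1 i) /= ?inE ?negbK //; congr (_ * _); apply: eq_bigl => q.
  by rewrite !inE negbK andbC.
have h2 : hodge_sign (~: (beta :\ i)) = wedge_sign i (beta :\ i) * C.
  rewrite hodge_signE (bigD1 i) /= ?inE ?eqxx // wedge_signE; congr (_ * _).
    by apply: eq_bigl => q; rewrite !inE negbK.
  rewrite /C; apply: eq_big => p; last first.
    by move=> _; apply: eq_bigl => q; rewrite !inE negbK.
  by rewrite !inE; case: eqVneq => [->|]; rewrite ?ib //= ?andbT.
have h3 : (\prod_(p in ~: beta) inversion_sign i p) * wedge_sign i (~: beta) =
  (-1) ^+ #|~: beta|.
  rewrite wedge_signE -big_split /= -prodr_const; apply: eq_bigr => p pb.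
  apply: inversion_signN; apply: contraTneq pb => <-; by rewrite inE ib.
rewrite h1 h2 wedge_signD1 mulrAC h3.
by rewrite -!mulrA (mulrA (wedge_sign i beta)) wedge_sign_sqr mul1r.
Qed.

End signs.

Section pieces.
Context {R : realType} {n : nat} (G : {fset {fset 'rV[R]_n}}).
Hypothesis dG : forall K K', K \in G -> K' \in G -> K != K' ->
  ocell K `&` ocell K' = set0.
Implicit Types (K : G) (a b e g : G -> {set 'I_n} -> R) (omega : dform R n).

Definition koszul_lin b K (alpha : {set 'I_n}) (i : 'I_n) : R :=
  if i \notin alpha then wedge_sign i alpha * b K (i |: alpha) else 0.

(** The coefficients of [x_i] in the exterior product of [\sum_i x_i dx^i] with [g]. *)
Definition wedge_lin g K (beta : {set 'I_n}) (i : 'I_n) : R :=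
  if i \in beta then wedge_sign i beta * g K (beta :\ i) else 0.

(** Recentring at the centroid only changes the constant part. *)
Lemma sum_centroid K (x : 'rV[R]_n) (c : R) (u : 'I_n -> R) :
  c + \sum_i x 0 i * u i =
  (c + \sum_i centroid K 0 i * u i) + \sum_i (x 0 i - centroid K 0 i) * u i.
Proof.
rewrite -addrA -big_split /=; congr (_ + _); apply: eq_bigr => i _.
by rewrite mulrBl addrC subrK.
Qed.

Lemma card_setU1C (i : 'I_n) (alpha : {set 'I_n}) : i \notin alpha -> #|i |: alpha| = #|alpha|.+1.
Proof. by move=> ia; rewrite cardsU1 ia. Qed.

Lemma piecewise_P1m k omega : piecewise G (P1m k) omega ->
  exists a, exists2 b, omega = pw a (koszul_lin b) &
    degree_supported k a /\ degree_supported k.+1 b.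
Proof.
move=> pomega.
have /choice[f fP] : forall K, exists f : {set 'I_n} -> R, exists g : {set 'I_n} -> R,
    [/\ forall alpha : {set 'I_n}, #|alpha| != k -> f alpha = 0,
      forall alpha : {set 'I_n}, #|alpha| != k.+1 -> g alpha = 0 &
    forall (alpha : {set 'I_n}) x, cell K x -> omega alpha x = f alpha +
      \sum_i x 0 i * (if i \notin alpha then wedge_sign i alpha * g (i |: alpha) else 0)].
  move=> K; have [p [a0 [ka ca] [b0 [kb cb] pE]] oE] := pomega.1 _ (valP K).
  exists (fun alpha => a0 alpha 0), (fun alpha => b0 alpha 0); split.
  - by move=> alpha /ka ->.
  - by move=> alpha /kb ->.
  move=> alpha x Kx; rewrite (oE _ _ Kx) pE.
  rewrite (_ : (a0 + koszul b0) alpha x = a0 alpha x + koszul b0 alpha x) //.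
  rewrite (ca _ x 0); congr (_ + _); rewrite /koszul big_mkcond; apply: eq_bigr => i _.
  by case: ifP => _; rewrite ?mulr0 // (cb _ x 0) mulrCA mulrA.
have /choice[g gP] := fP.
exists (fun K alpha => f K alpha +
  \sum_i centroid K 0 i * koszul_lin g K alpha i), g; last first.
  split=> [K alpha ak|K alpha ak]; have [fk gk _] := gP K; last exact: gk.
  rewrite fk // add0r big1 // => i _; rewrite /koszul_lin; case: ifP => [ia|];
    last by rewrite mulr0.
  by rewrite gk ?mulr0 // card_setU1C // eqSS.
apply: (eq_pw dG) => [K alpha x Kx|alpha x nx]; last first.
  by apply: pomega.2 => K KG Kx; exact: (nx [` KG]%fset).
have [_ _ ->] := gP K; last exact: Kx.
exact: sum_centroid.
Qed.

Lemma pw_piecewise_P1m k a b : degree_supported k a -> degree_supported k.+1 b ->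
  piecewise G (P1m k) (pw a (koszul_lin b)).
Proof.
move=> ka kb; split; last first.
  move=> x nx alpha; apply: pw_out => K; exact: (nx _ (valP K)).
move=> K0 KG; pose K : G := [` KG]%fset.
pose a0 alpha := a K alpha - \sum_i centroid K 0 i * koszul_lin b K alpha i.
exists ((fun alpha => cst (a0 alpha)) + koszul (fun alpha => cst (b K alpha))).
  exists (fun alpha => cst (a0 alpha)).
    split=> // alpha ak x; rewrite /a0 /= ka // sub0r big1 ?oppr0 // => i _.
    rewrite /koszul_lin; case: ifP => [ia|]; last by rewrite mulr0.
    by rewrite kb ?mulr0 // card_setU1C // eqSS.
  exists (fun alpha => cst (b K alpha)) => //.
  by split=> // alpha ak x /=; rewrite kb.
move=> alpha x Kx; rewrite (pw_in dG _ _ _ (K := K) Kx).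
rewrite (_ : (_ + _ : dform R n) alpha x = a0 alpha + koszul (fun alpha => cst (b K alpha)) alpha x) //.
have -> : koszul (fun alpha => cst (b K alpha)) alpha x = \sum_i x 0 i * koszul_lin b K alpha i.
  rewrite /koszul big_mkcond; apply: eq_bigr => i _; rewrite /koszul_lin.
  by case: ifP => _; rewrite ?mulr0 // mulrCA mulrA.
by rewrite (sum_centroid K) /a0 subrK.
Qed.

(** The Hodge star turns the Koszul operator into exterior multiplication by [\sum_i x_i dx^i], up
    to a sign that [g] absorbs. *)
Lemma piecewise_P1sm k omega : (k < n)%N -> piecewise G (P1sm k.+1) omega ->
  exists e, exists2 g, omega = pw e (wedge_lin g) &
    degree_supported k.+1 e /\ degree_supported k g.
Proof.
move=> kn pomega.
have cardC (beta : {set 'I_n}) : #|~: beta| =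
  (n - #|beta|)%N by rewrite cardsCs card_ord finset.setCK.
have le_card (beta : {set 'I_n}) : (#|beta| <= n)%N by rewrite -[n in (_ <= n)%N]card_ord max_card.
have /choice[f fP] : forall K, exists f : {set 'I_n} -> R, exists g : {set 'I_n} -> R,
    [/\ forall alpha : {set 'I_n}, #|alpha| != k.+1 -> f alpha = 0,
      forall alpha : {set 'I_n}, #|alpha| != k -> g alpha = 0 &
    forall (beta : {set 'I_n}) x, cell K x -> omega beta x = f beta +
      \sum_i x 0 i * (if i \in beta then wedge_sign i beta * g (beta :\ i) else 0)].
  move=> K; have [p [q [a0 [ka ca] [b0 [kb cb] qE]] pE] oE] := pomega.1 _ (valP K).
  (* Hodge stars of the constant forms [a0] and [b0]; the exponent [n - k.+1] is the size of
     [~: beta] when [beta] has [k.+1] elements. *)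
  exists (fun beta => hodge_sign (~: beta) * a0 (~: beta) 0),
    (fun gamma => (-1) ^+ (n - k.+1) * hodge_sign (~: gamma) * b0 (~: gamma) 0); split.
  - move=> beta bk; rewrite ka ?mulr0 // cardC; apply: contra bk => /eqP h.
    by apply/eqP; have := le_card beta; lia.
  - move=> gamma gk; rewrite kb ?mulr0 // cardC; apply: contra gk => /eqP h.
    by apply/eqP; have := le_card gamma; lia.
  move=> beta x Kx; rewrite (oE _ _ Kx) -pE /hodge qE.
  rewrite (_ : (a0 + koszul b0) (~: beta) x = a0 (~: beta) x + koszul b0 (~: beta) x) //.
  rewrite (ca _ x 0) mulrDr; congr (_ + _).
  rewrite /koszul mulr_sumr big_mkcond; apply: eq_bigr => i _.
  rewrite inE negbK; case: ifP => [ib|_]; last by rewrite mulr0.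
  rewrite (cb _ x 0).
  have -> : i |: ~: beta = ~: (beta :\ i).
    by apply/setP => j; rewrite !inE negb_and negbK.
  have [bk|bk] := eqVneq #|beta| k.+1; last first.
    rewrite kb ?mulr0 // cardC; apply: contra bk => /eqP h.
    by apply/eqP; have := le_card beta; have := cardsD1 i beta; rewrite ib; lia.
  have := @hodge_sign_remove R _ _ _ ib; rewrite cardC bk => sE.
  rewrite !mulrA [_ * x 0 i]mulrC -!mulrA; congr (_ * _).
  by rewrite !mulrA sE; ring.
have /choice[g gP] := fP.
exists (fun K beta => f K beta + \sum_i centroid K 0 i * wedge_lin g K beta i), g; last first.
  split=> [K beta bk|K alpha ak]; have [fk gk _] := gP K; last exact: gk.
  rewrite fk // add0r big1 // => i _; rewrite /wedge_lin; case: ifP => [ib|];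
    last by rewrite mulr0.
  rewrite gk ?mulr0 //; apply: contra bk => /eqP h.
  by rewrite (cardsD1 i beta) ib h.
apply: (eq_pw dG) => [K beta x Kx|beta x nx]; last first.
  by apply: pomega.2 => K KG Kx; exact: (nx [` KG]%fset).
have [_ _ ->] := gP K; last exact: Kx.
exact: sum_centroid.
Qed.

End pieces.

(** * Differential and codifferential cell by cell *)

Section operators.
Context {R : realType} {n : nat} (Omega : set 'rV[R]_n)
  (G : {fset {fset 'rV[R]_n}}) (l r : 'rV[R]_n).
Hypotheses (oOmega : open Omega) (bOmega : Omega `<=` cbox l r).
Hypothesis dG : forall K K', K \in G -> K' \in G -> K != K' ->
  ocell K `&` ocell K' = set0.
Hypothesis GOmega : forall K, K \in G -> ocell K `<=` Omega.
Hypothesis negG : (lebesgue_rV n).-negligible (Omega `\` \bigcup_(K in [set` G]) ocell K).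
Implicit Types (K : G) (a b e g : G -> {set 'I_n} -> R)
  (B : G -> {set 'I_n} -> 'I_n -> R) (omega mu theta phi : dform R n).

Notation leb := (lebesgue_rV n).

Let mOmega : measurable Omega. Proof. exact: open_measurable_rV. Qed.

(** The form of a single cell, continued affinely to the whole space so that the calculus of C1
    forms applies to it. *)
Definition piece a B K : dform R n := fun alpha x =>
  a K alpha + \sum_i (x 0 i - centroid K 0 i) * B K alpha i.

Lemma pieceE a B K alpha : piece a B K alpha =
  affine (\row_i B K alpha i) (a K alpha - \sum_i centroid K 0 i * B K alpha i).
Proof.
apply/funext => x; rewrite /piece /affine addrCA; congr (_ + _).
by rewrite -sumrB; apply: eq_bigr => i _; rewrite mxE mulrBl (mulrC (B K alpha i)).
Qed.

Lemma affine_sumE (f : 'rV[R]_n) (c : R) :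
  affine f c = \sum_i (fun x : 'rV[R]_n => f 0 i * x 0 i) + cst c.
Proof.
apply/funext => x; rewrite /affine addrfctE; congr (_ + _); apply/esym.
exact: (@big_morph _ _ (fun g : 'rV[R]_n -> R => g x) 0 +%R 0 +%R).
Qed.

Lemma differentiable_affine (f : 'rV[R]_n) (c : R) x : differentiable (affine f c) x.
Proof.
rewrite affine_sumE; apply: differentiableD; last exact: differentiable_cst.
apply: differentiable_sum => i.
by have := @differentiable_affine_coord R n i (f 0 i) 0 x; under eq_fun do rewrite addr0.
Qed.

Lemma partial_affine (f : 'rV[R]_n) (c : R) j x : partial j (affine f c) x = f 0 j.
Proof.
rewrite /partial /derive; apply: cvg_lim => //.
apply: (@cvg_trans _ (cst (f 0 j) @ 0^')); last exact: cvg_cst.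
apply: near_eq_cvg; near=> t.
have tn0 : t != 0 by near: t; exact: nbhs_dnbhs_neq.
rewrite /= /affine opprD addrACA subrr addr0 -sumrB (bigD1 j) //= big1 => [|i ij].
  rewrite addr0 !mxE !eqxx mulr1 mulrDr addrK /GRing.scale /= mulrCA mulVf ?mulr1 //.
by rewrite !mxE (negPf ij) andbF mulr0 add0r subrr.
Unshelve. all: by end_near. Qed.

Lemma partial_piece a B K alpha j x : partial j (piece a B K alpha) x = B K alpha j.
Proof. by rewrite pieceE partial_affine mxE. Qed.

Lemma C1_form_piece a B K : C1_form (piece a B K).
Proof.
move=> alpha; split=> [x|i]; first by rewrite pieceE; exact: differentiable_affine.
have -> : partial i (piece a B K alpha) = cst (B K alpha i).
  by apply/funext => x; rewrite partial_piece.
exact: cst_continuous.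
Qed.

(** Each of the [k.+1] indices of [beta] contributes [b K beta], since the sign of the Koszul
    operator and that of the differential cancel. *)
Lemma ext_dh_pw k a b : degree_supported k.+1 b ->
  ext_dh G (pw a (koszul_lin b)) = pwcst (fun K beta => k.+1%:R * b K beta).
Proof.
move=> kb; rewrite /pwcst; apply: (eq_pw dG) => [K beta x Kx|beta x nx]; last first.
  rewrite /ext_dh; case: asboolP => // -[K KG Kx].
  by have := nx [` KG]%fset.
rewrite [X in _ + X]big1 ?addr0 => [|i _]; last by rewrite mulr0.
rewrite /ext_dh; case: asboolP => [_|]; last by case; exists (val K) => //; exact: (valP K).
(* A derivative at a point of an open cell only sees the affine form of that cell. *)
have nearE i alpha : partial i (pw a (koszul_lin b) alpha) x = koszul_lin b K alpha i.
  rewrite -(partial_piece a _ K alpha i x); apply: near_eq_derive.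
  have := @open_ocell R n (val K); rewrite openE => /(_ x Kx); apply: filterS => y Ky.
  by rewrite (pw_in dG _ _ _ (K := K) Ky).
rewrite /ext_d; under eq_bigr => i ib.
  rewrite nearE /koszul_lin !inE eqxx /= wedge_signD1 mulrA wedge_sign_sqr mul1r.
  rewrite finset.setD1K //; over.
rewrite sumr_const -[LHS]mulr_natl; have [->//|/kb ->] := eqVneq #|beta| k.+1.
by rewrite !mulr0.
Qed.

(** Each of the [n - k] indices outside [alpha] contributes [g K alpha] with cancelling signs. *)
Lemma cdelta_piece k e g K alpha x : degree_supported k g ->
  cdelta (piece e (wedge_lin g) K) alpha x = - (n%:R - k%:R) * g K alpha.
Proof.
move=> kg; rewrite /cdelta.
under eq_bigr => i ia.
  rewrite partial_piece /wedge_lin finset.setU11 wedge_signU1 mulrA wedge_sign_sqr mul1r.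
  rewrite finset.setU1K //; over.
rewrite sumr_const mulNr; congr (- _); rewrite -[LHS]mulr_natl.
have [<-|/kg ->] := eqVneq #|alpha| k; last by rewrite !mulr0.
congr (_ * _); have := cardsC alpha; rewrite card_ord => /(congr1 (fun m => m%:R : R)).
rewrite natrD => <-; rewrite addrC addKr; congr (_%:R).
by apply: eq_card => i; rewrite !inE.
Qed.

(** The existence of some weak codifferential carries the conformity across the cells. Test forms
    supported in one cell identify it there with the classical one, and the cells fill [Omega] up to
    a null set. *)
Lemma has_codiff_pw k e g theta : degree_supported k g ->
  has_codiff Omega (pw e (wedge_lin g)) theta ->
  has_codiff Omega (pw e (wedge_lin g)) (pwcst (fun K alpha => - (n%:R - k%:R) * g K alpha)).
Proof.
move=> kg [Lt ct]; set gamma := fun K alpha => _.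
have Lg : L2_form Omega (pwcst gamma) by exact: (L2_form_pw oOmega bOmega dG).
split=> //.
have aeK K alpha : ae_eq leb (cell K) (EFin \o theta alpha) (EFin \o pwcst gamma alpha).
  apply: (ae_eq_of_test_forms oOmega bOmega) => //.
  - exact: open_ocell.
  - exact: (cell_sub GOmega).
  move=> phi tphi; have tphiO := test_formS (cell_sub GOmega (K := K)) tphi.
  rewrite -ct //.
  have [_ [C [cC CK phi0]]] := tphi.
  have clC : closed C by apply: compact_closed => //; exact: norm_hausdorff.
  (* The test form lives in [K], so the piecewise form can be replaced by its affine continuation,
     to which integration by parts applies. *)
  transitivity (L2_ip Omega (ext_d phi) (piece e (wedge_lin g) K)).
    apply: eq_Rintegral => x _; apply: eq_bigr => beta _.
    have [Cx|nCx] := pselect (C x); first by rewrite (pw_in dG _ _ _ (CK _ Cx)).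
    rewrite /ext_d big1 ?mul0r // => i _; rewrite (partial_eq0 _ clC) ?mulr0 //.
    exact: phi0.
  rewrite (L2_ip_ext_d_cdelta oOmega bOmega) //; last exact: C1_form_piece.
  apply: eq_Rintegral => x _; apply: eq_bigr => beta _.
  have [Cx|nCx] := pselect (C x); last by rewrite phi0 // !mul0r.
  rewrite (cdelta_piece _ _ _ _ kg) /pwcst (pw_in dG _ _ _ (CK _ Cx)).
  by rewrite [X in _ = _ * (_ + X)]big1 ?addr0 // => i _; rewrite mulr0.
have ae alpha : ae_eq leb Omega (EFin \o theta alpha) (EFin \o pwcst gamma alpha).
  have : \forall x \ae leb, (forall K, cell K x -> (EFin \o theta alpha) x =
    (EFin \o pwcst gamma alpha) x) /\
      ~ (Omega `\` \bigcup_(K in [set` G]) ocell K) x.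
    apply: filterI; first exact: (@filter_forall _ _ _ _ _ (fun K => aeK K alpha)).
    by apply: negligibleS negG => x /= /notP.
  apply: filterS => x [h nx] Ox.
  have [[K Kx]|nK] := pselect (exists K, cell K x); first exact: (h K Kx).
  exfalso; apply: nx; split=> // -[K KG Kx]; apply: nK.
  by exists [` KG]%fset.
move=> phi tphi; rewrite ct //.
apply: L2_ip_ae => //; exact: (L2_form_test oOmega bOmega).
Qed.

(** Each coefficient [b K beta] occurs once for every index of [beta], at most [n] times. *)
Lemma koszul_lin_sqr b K : \sum_alpha \sum_i koszul_lin b K alpha i ^+ 2 <=
  n%:R * \sum_alpha b K alpha ^+ 2.
Proof.
have -> : \sum_alpha \sum_i koszul_lin b K alpha i ^+ 2 =
    \sum_(beta : {set 'I_n}) \sum_(i in beta) b K beta ^+ 2.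
  rewrite (exchange_add_remove (fun _ beta _ => b K beta ^+ 2)).
  apply: eq_bigr => alpha _; rewrite [RHS]big_mkcond; apply: eq_bigr => i _.
  rewrite /koszul_lin; case: ifP => _; last by rewrite expr0n.
  by rewrite exprMn expr2 wedge_sign_sqr mul1r.
rewrite mulr_sumr; apply: ler_sum => beta _; rewrite sumr_const -[leLHS]mulr_natl.
apply: ler_wpM2r; first exact: sqr_ge0.
by rewrite ler_nat -[n in (_ <= n)%N]card_ord max_card.
Qed.

(** Each coefficient [g K alpha] occurs once for every index outside [alpha], at most [n] times. *)
Lemma wedge_lin_sqr g K : \sum_alpha \sum_i wedge_lin g K alpha i ^+ 2 <=
  n%:R * \sum_alpha g K alpha ^+ 2.
Proof.
have -> : \sum_alpha \sum_i wedge_lin g K alpha i ^+ 2 =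
    \sum_(beta : {set 'I_n}) \sum_(i in beta) g K (beta :\ i) ^+ 2.
  apply: eq_bigr => beta _; rewrite [RHS]big_mkcond; apply: eq_bigr => i _.
  rewrite /wedge_lin; case: ifP => _; last by rewrite expr0n.
  by rewrite exprMn expr2 wedge_sign_sqr mul1r.
rewrite (exchange_add_remove (fun _ _ alpha => g K alpha ^+ 2)).
rewrite mulr_sumr; apply: ler_sum => beta _; rewrite sumr_const -[leLHS]mulr_natl.
apply: ler_wpM2r; first exact: sqr_ge0.
by rewrite ler_nat -[n in (_ <= n)%N]card_ord max_card.
Qed.

Lemma sum_sqr_scale_le (c : R) g K : 1 <= c ^+ 2 ->
  n%:R * \sum_alpha g K alpha ^+ 2 <= n%:R * \sum_alpha (c * g K alpha) ^+ 2.
Proof.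
move=> c1; apply: ler_wpM2l => //; apply: ler_sum => alpha _.
by rewrite exprMn ler_peMl // sqr_ge0.
Qed.

End operators.

(** * The discrete spaces as mutually adjoint relations *)

Section mesh.
Context {R : realType} {n k : nat} (Omega : set 'rV[R]_n)
  (G : {fset {fset 'rV[R]_n}}) (l r : 'rV[R]_n).
Hypotheses (kn : (k < n)%N) (oOmega : open Omega) (bOmega : Omega `<=` cbox l r).
Hypothesis sG : forall K, K \in G -> is_simplex K.
Hypothesis dG : forall K K', K \in G -> K' \in G -> K != K' ->
  ocell K `&` ocell K' = set0.
Hypothesis GOmega : forall K, K \in G -> ocell K `<=` Omega.
Hypothesis negG : (lebesgue_rV n).-negligible (Omega `\` \bigcup_(K in [set` G]) ocell K).
Implicit Types (A a b e g : G -> {set 'I_n} -> R)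
  (B : G -> {set 'I_n} -> 'I_n -> R) (omega eta mu : dform R n).

Let mOmega : measurable Omega. Proof. exact: open_measurable_rV. Qed.
Let Lpw A B : L2_form Omega (pw A B).
Proof. exact: (L2_form_pw oOmega bOmega dG). Qed.
Let ip_pwcst := L2_ip_pw_cst oOmega bOmega sG dG GOmega.
Let dot_crd := dotmx_crd oOmega bOmega sG dG GOmega.

Notation W := (Wstar0 Omega G k.+1).
Notation V := (Wnc Omega G k).

Let c : R := - (n%:R - k%:R).

Let c_sqr : 1 <= c ^+ 2.
Proof.
(* By [k < n] the factor is, up to sign, a positive integer. *)
rewrite /c sqrrN -natrB; last exact: ltnW.
by rewrite -natrX ler1n expn_gt0 subn_gt0 kn.
Qed.

Lemma P1sm_lincomb p q (v w : dform R n) : P1sm p v -> P1sm p w -> P1sm p (lincomb q v w).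
Proof.
move=> [v' [a1 [ka1 ca1] [b1 [kb1 cb1] ->]] <-] [w' [a2 [ka2 ca2] [b2 [kb2 cb2] ->]] <-].
exists (lincomb q (a1 + koszul b1) (a2 + koszul b2)).
  exists (lincomb q a1 a2).
    split; first exact: is_kform_lincomb.
    by move=> alpha x y; rewrite /lincomb (ca1 _ x y) (ca2 _ x y).
  exists (lincomb q b1 b2).
    split; first exact: is_kform_lincomb.
    by move=> alpha x y; rewrite /lincomb (cb1 _ x y) (cb2 _ x y).
  apply/funext => alpha; apply/funext => x; rewrite /lincomb !addrfctE /koszul.
  rewrite mulrDr mulr_sumr addrACA -big_split /=; congr (_ + _).
  by apply: eq_bigr => i _; ring.
by apply/funext => alpha; apply/funext => x; rewrite /hodge /lincomb; ring.
Qed.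

Lemma P1sm0 p : P1sm p (fun=> cst 0 : 'rV[R]_n -> R).
Proof.
exists (fun=> cst 0); last first.
  by apply/funext => alpha; apply/funext => x; rewrite /hodge mulr0.
exists (fun=> cst 0) => //; exists (fun=> cst 0) => //.
apply/funext => alpha; apply/funext => x; rewrite !addrfctE /koszul /= add0r big1 // => i _.
by rewrite mulr0.
Qed.

Lemma Wstar0_lincomb q v w : W v -> W w -> W (lincomb q v w).
Proof.
move=> [[vin vout] vH] [[win wout] wH]; split; last exact: (Hstar0_lincomb oOmega bOmega).
split=> [K KG|x nx alpha]; last by rewrite /lincomb vout // wout // mulr0 addr0.
have [p1 Pp1 p1E] := vin K KG; have [p2 Pp2 p2E] := win K KG.
exists (lincomb q p1 p2); first exact: P1sm_lincomb.
by move=> alpha x Kx; rewrite /lincomb p1E // p2E.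
Qed.

Lemma Wstar0_0 : W (fun=> cst 0).
Proof.
split; last exact: (Hstar0_0 oOmega bOmega).
by split=> // K KG; exists (fun=> cst 0) => //; exact: P1sm0.
Qed.

Lemma Wstar0_pw eta : W eta -> exists e, exists2 g, eta = pw e (wedge_lin g) &
  [/\ degree_supported k.+1 e, degree_supported k g &
    has_codiff Omega eta (pwcst (fun K alpha => c * g K alpha))].
Proof.
move=> [peta [[_ _ [theta ct]] _]].
have [e [g etaE [ke kg]]] := piecewise_P1sm dG kn peta.
exists e, g => //; split=> //; rewrite etaE in ct *.
exact: (has_codiff_pw oOmega bOmega dG GOmega negG kg ct).
Qed.

Lemma Wstar0_codiff eta : W eta -> has_codiff Omega eta (codiff Omega eta).
Proof. by move=> [_ [[_ _ h] _]]; exact: codiffP. Qed.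

Lemma Wstar0_coordinates : icr_coordinates (L2_ip Omega) (L2_ip Omega)
  (codiff Omega) W (crd Omega G k.+1) (fun v => crd Omega G k (codiff Omega v))
  (n%:R * mesh_size G).
Proof.
apply: (pw_icr_coordinates oOmega bOmega sG dG GOmega).
- exact: Wstar0_0.
- exact: Wstar0_lincomb.
- move=> v Wv; have [e [g -> [ke kg ct]]] := Wstar0_pw Wv.
  exists e, (wedge_lin g) => //; split=> //.
  exists (fun K alpha => c * g K alpha); first by move=> K alpha /kg ->; rewrite mulr0.
  split.
  + by move=> K; apply: le_trans (wedge_lin_sqr g K) (sum_sqr_scale_le g K c_sqr).
  + by move=> mu Lmu; rewrite !(L2_ipC _ _ mu) (L2_ip_codiff oOmega bOmega Lmu ct).
  + exact: (L2_ip_codiff_sqr oOmega bOmega ct).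
- move=> q v w mu Wv Ww Lmu.
  have cv := Wstar0_codiff Wv; have cw := Wstar0_codiff Ww.
  have [[_ Lv _] _] := Wv.2; have [[_ Lw _] _] := Ww.2.
  have cl := has_codiff_lincomb oOmega bOmega q Lv Lw cv cw.
  rewrite L2_ipC (L2_ip_codiff oOmega bOmega Lmu cl) L2_ip_lincombr //; [|exact: cv.1|exact: cw.1].
  by rewrite !(L2_ipC _ mu).
Qed.

(** The codifferential of [eta] is piecewise constant almost everywhere, so the pairing only sees
    the constant part of the other form. *)
Lemma pairing_codiff A B eta : degree_supported k A -> W eta ->
  L2_ip Omega (pw A B) (codiff Omega eta) =
  dotmx (crd Omega G k (pw A B)) (crd Omega G k (codiff Omega eta)).
Proof.
move=> kA Weta; have [e [g _ [_ kg ct]]] := Wstar0_pw Weta.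
rewrite (L2_ip_codiff oOmega bOmega (Lpw A B) ct) /pwcst ip_pwcst.
have -> : crd Omega G k (codiff Omega eta) =
  crd Omega G k (pwcst (fun K alpha => c * g K alpha)).
  apply/rowP => j; rewrite !mxE L2_ipC (L2_ip_codiff oOmega bOmega _ ct); last exact: Lpw.
  by rewrite L2_ipC.
by rewrite dot_crd // => K alpha /kg ->; rewrite mulr0.
Qed.

Lemma pairing_ext_dh b eta : W eta ->
  L2_ip Omega (pwcst b) eta = dotmx (crd Omega G k.+1 (pwcst b)) (crd Omega G k.+1 eta).
Proof.
move=> Weta; have [e [g -> [ke _ _]]] := Wstar0_pw Weta.
rewrite L2_ipC /pwcst ip_pwcst dot_crd //.
by apply: eq_bigr => K _; congr (_ * _); apply: eq_bigr => alpha _; rewrite mulrC.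
Qed.

(** Both terms of the defining equation are pairings with a piecewise constant form, hence inner
    products of coordinates: what is left is the equation of an adjoint relation. *)
Lemma Wnc_pwP omega : V omega <->
  exists a, exists2 b, omega = pw a (koszul_lin b) &
  [/\ degree_supported k a, degree_supported k.+1 b &
    forall eta, W eta -> dotmx (crd Omega G k omega) (crd Omega G k (codiff Omega eta)) =
      dotmx (crd Omega G k.+1 (ext_dh G omega)) (crd Omega G k.+1 eta)].
Proof.
split=> [[pomega orth]|[a [b -> [ka kb orth]]]].
  have [a [b oE [ka kb]]] := piecewise_P1m dG pomega.
  exists a, b => //; split=> // eta Weta; have := orth eta Weta.
  rewrite oE (ext_dh_pw dG a kb) pairing_codiff // pairing_ext_dh //.
  by move/eqP; rewrite subr_eq0 => /eqP.
split; first exact: (pw_piecewise_P1m dG ka kb).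
move=> eta Weta; have := orth eta Weta.
by rewrite (ext_dh_pw dG a kb) pairing_codiff // pairing_ext_dh // => ->; rewrite subrr.
Qed.

(** Linearity of [ext_dh] is read off its explicit values on piecewise forms, where
    differentiability is available. *)
Lemma ext_dh_lincomb q a b a' b' :
  degree_supported k.+1 b -> degree_supported k.+1 b' ->
  lincomb q (pw a (koszul_lin b)) (pw a' (koszul_lin b')) =
    pw (fun K alpha => q * a K alpha + a' K alpha)
       (koszul_lin (fun K alpha => q * b K alpha + b' K alpha)) /\
  ext_dh G (lincomb q (pw a (koszul_lin b)) (pw a' (koszul_lin b'))) =
    lincomb q (ext_dh G (pw a (koszul_lin b))) (ext_dh G (pw a' (koszul_lin b'))).
Proof.
move=> kb kb'.
have E : lincomb q (pw a (koszul_lin b)) (pw a' (koszul_lin b')) =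
    pw (fun K alpha => q * a K alpha + a' K alpha)
       (koszul_lin (fun K alpha => q * b K alpha + b' K alpha)).
  rewrite (pw_lincomb dG); congr pw.
  apply/funext => K; apply/funext => alpha; apply/funext => i.
  by rewrite /koszul_lin; case: ifP => _; ring.
split=> //; rewrite E !(@ext_dh_pw _ _ _ dG k) //; last first.
  by move=> K alpha ak; rewrite kb // kb' // mulr0 addr0.
rewrite /pwcst (pw_lincomb dG); congr pw.
  by apply/funext => K; apply/funext => alpha; ring.
by apply/funext => K; apply/funext => alpha; apply/funext => i; rewrite mulr0 addr0.
Qed.

Lemma Wnc_coordinates : icr_coordinates (L2_ip Omega) (L2_ip Omega)
  (ext_dh G) V (crd Omega G k) (fun v => crd Omega G k.+1 (ext_dh G v))
  (n%:R * mesh_size G).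
Proof.
have k1 : (1 : R) <= k.+1%:R ^+ 2 by rewrite -natrX ler1n expn_gt0.
have E : (fun=> cst 0) = pw (fun (_ : G) _ => 0) (koszul_lin (fun _ _ => 0)) :> dform R n.
  apply: (eq_pw dG) => [K alpha x Kx|//]; rewrite big1 ?addr0 // => i _.
  by rewrite /koszul_lin; case: ifP => _; rewrite ?mulr0 // mulr0.
apply: (pw_icr_coordinates oOmega bOmega sG dG GOmega).
- apply/Wnc_pwP; exists (fun _ _ => 0), (fun _ _ => 0); first exact: E.
  split=> // eta Weta.
  rewrite E (@ext_dh_pw _ _ _ dG k) // -pairing_ext_dh // -pairing_codiff // -E (L2_ip0 oOmega).
  have -> : pwcst (fun (K : G) (beta : {set 'I_n}) => k.+1%:R * 0) =
    (fun=> cst 0 : 'rV[R]_n -> R) :> dform R n.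
    by apply/esym/(eq_pw dG) => // K alpha x Kx;
      rewrite mulr0 big1 ?addr0 // => i _; rewrite mulr0.
  by rewrite (L2_ip0 oOmega).
- move=> q v w /Wnc_pwP[a [b -> [ka kb va]]] /Wnc_pwP[a' [b' -> [ka' kb' wa]]].
  have [E1 E2] := ext_dh_lincomb q a a' kb kb'.
  apply/Wnc_pwP; eexists; eexists; first exact: E1; split.
  + by move=> K alpha ak; rewrite ka // ka' // mulr0 addr0.
  + by move=> K alpha ak; rewrite kb // kb' // mulr0 addr0.
  + move=> eta Weta; rewrite E2 !(crd_lincomb oOmega bOmega dG) //; last 2 first.
    * by rewrite (ext_dh_pw dG a kb); exact: Lpw.
    * by rewrite (ext_dh_pw dG a' kb'); exact: Lpw.
    by rewrite !dotmxDl !dotmxZl va // wa.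
- move=> v /Wnc_pwP[a [b -> [ka kb _]]]; exists a, (koszul_lin b) => //; split=> //.
  exists (fun K alpha => k.+1%:R * b K alpha); first by move=> K alpha /kb ->; rewrite mulr0.
  rewrite (ext_dh_pw dG a kb); split=> // K.
  exact: le_trans (koszul_lin_sqr b K) (sum_sqr_scale_le b K k1).
- move=> q v w mu /Wnc_pwP[a [b -> [_ kb _]]] /Wnc_pwP[a' [b' -> [_ kb' _]]] Lmu.
  have [_ ->] := ext_dh_lincomb q a a' kb kb'.
  rewrite L2_ip_lincombl //.
  + by rewrite (ext_dh_pw dG a kb); exact: Lpw.
  + by rewrite (ext_dh_pw dG a' kb'); exact: Lpw.
Qed.

(** Conversely, any pair of coordinate vectors comes from a piecewise form, and the adjoint
    equations are then exactly its membership in Wnc. *)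
Lemma Wnc_adjoint (x : 'rV[R]_#|deg_index G k|) (y : 'rV[R]_#|deg_index G k.+1|) :
  coord_rel V (crd Omega G k) (fun v => crd Omega G k.+1 (ext_dh G v)) x y <->
  forall eta, W eta ->
    dotmx x (crd Omega G k (codiff Omega eta)) = dotmx y (crd Omega G k.+1 eta).
Proof.
split=> [[v /Wnc_pwP[a [b _ [_ _ orth]]] [<- <-]]|xy]; first exact: orth.
have [A kA AE] := crd_surj oOmega bOmega sG dG GOmega x.
have [B kB BE] := crd_surj oOmega bOmega sG dG GOmega y.
(* Division by [k.+1] compensates the factor that the cellwise differential produces. *)
pose b K alpha : R := k.+1%:R^-1 * B K alpha.
have kb : degree_supported k.+1 b by move=> K alpha /kB bE; rewrite /b bE mulr0.
have yE : crd Omega G k.+1 (ext_dh G (pw A (koszul_lin b))) = y.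
  rewrite (ext_dh_pw dG A kb) -(BE (fun _ _ _ => 0)); congr (crd _ _ _ (pw _ _)).
  by apply/funext => K; apply/funext => alpha; rewrite /b mulrA mulfV ?mul1r // pnatr_eq0.
exists (pw A (koszul_lin b)); last by rewrite AE.
apply/Wnc_pwP; exists A, b => //; split=> // eta Weta.
by rewrite AE yE; exact: xy.
Qed.

Lemma icr_dist_mesh :
  (`| icr (L2_ip Omega) (L2_ip Omega) (codiff Omega) W
      - icr (L2_ip Omega) (L2_ip Omega) (ext_dh G) V |
   <= (n%:R * mesh_size G)%:E)%E.
Proof.
apply: (icr_dist_adjoint Wstar0_coordinates Wnc_coordinates _ Wnc_adjoint).
by rewrite mulr_ge0 // mesh_size_ge0.
Qed.

End mesh.

Theorem lemma3p10 (R : realType) (n k : nat) (Omega : set 'rV[R]_n)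
    (I : Type) (G : I -> {fset {fset 'rV[R]_n}}) :
  (1 <= n)%N -> (k <= n - 1)%N ->
  bounded_polyhedral_domain Omega ->
  (forall i, simplicial_subdivision Omega (G i)) ->
  shape_regular G ->
  exists C : R, forall i,
    (`| icr (L2_ip Omega) (L2_ip Omega) (codiff Omega) (Wstar0 Omega (G i) k.+1)
        - icr (L2_ip Omega) (L2_ip Omega) (ext_dh (G i)) (Wnc Omega (G i) k) |
     <= (C * mesh_size (G i))%:E)%E.
Proof.
(* The constant is the dimension, the same for all meshes. *)
move=> n1 kn domO sGO _; exists n%:R => i.
have [sG _ _] := sGO i.
have [M OM] := domain_cbox (sGO i).
apply: (icr_dist_mesh _ (polyhedral_domain_open domO) OM sG).
- by lia.
- by move=> K K' KG K'G; exact: (subdivision_ocell_disjoint (sGO i)).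
- by move=> K KG; exact: (ocell_sub_domain domO (sGO i) KG).
- exact: (domain_negligible_ocell (sGO i)).
Qed.
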